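(* Let $\mu$ be a balanced Borel measure on $\mathbb{R}^n$, and let $T=T^{r,s}$ be a Haar shift operator of complexity $(r,s)$ (defined with respect to $\mu$) which is bounded on $L^2(\mu)$. Then: (i) $T$ can be extended to a bounded operator on $\mathrm{H}^1(\mu)$. (ii) $T$ can be extended to a bounded operator on $\mathrm{BMO}(\mu)$.
   Context: Dyadic system. $\mathcal{D}=\bigcup_{k\in\mathbb{Z}}\mathcal{D}_k$ is a fixed dyadic system on $\mathbb{R}^n$: each $\mathcal{D}_k$ is a partition of $\mathbb{R}^n$ into half-open cubes with sides parallel to the axes and side length $2^{-k}$, and any two cubes of $\mathcal{D}$ are either disjoint or nested. For an integer $r\ge 0$ and $Q\in\mathcal{D}$, $\mathcal{D}_r(Q)$ is the family of $R\in\mathcal{D}$ with $R\subset Q$ and $\ell(Q)=2^r\ell(R)$, where $\ell$ denotes side length. $Q^{(N)}$ is the $N$-th dyadic ancestor of $Q$. Measure. $\mu$ is a Borel measure with $0<\mu(Q)<\infty$ for all $Q\in\mathcal{D}$ and $\lim_{N\to\infty}\mu(Q^{(N)})=\infty$ for all $Q\in\mathcal{D}$ (every dyadic quadrant has infinite measure). Write $\langle f\rangle_Q=\mu(Q)^{-1}\int_Q f\,d\mu$ and $\langle f,g\rangle=\int fg\,d\mu$. Haar functions. A Haar system $\{h_Q^j\}_{Q\in\mathcal{D},\,1\le j<2^n}$ is fixed: $h_Q^j$ is supported on $Q$, is constant on each $R\in\mathcal{D}_1(Q)$, satisfies $\int h_Q^j\,d\mu=0$, and the whole family is an orthonormal basis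 of $L^2(\mu)$. Balanced. $\mu$ is balanced if $$\sup_{Q\in\mathcal{D}}\ \sup_{R\in\mathcal{D}_1(Q)}\ \Big[\|h_Q^{j}\|_{L^1(\mu)}\|h_R^{j'}\|_{L^\infty(\mu)}+\|h_Q^{j}\|_{L^\infty(\mu)}\|h_R^{j'}\|_{L^1(\mu)}\Big]<\infty ,$$ the supremum being taken also over all indices $j,j'$. Haar shifts. A (cancellative) Haar shift operator of complexity $(r,s)$, with $r,s$ nonnegative integers, is an operator of the form $$T^{r,s}f(x)=\sum_{Q\in\mathcal{D}}\ \sum_{R\in\mathcal{D}_r(Q),\,S\in\mathcal{D}_s(Q)}\ \sum_{j,j'}\alpha^Q_{R,S}\,\langle f,h_R^j\rangle\,h_S^{j'}(x)$$ with scalar coefficients $\alpha^Q_{R,S}$. Spaces. $\mathsf{E}_kf=\sum_{Q\in\mathcal{D}_k}\langle f\rangle_Q\mathbf{1}_Q$ and $\mathsf{D}_kf=\mathsf{E}_kf-\mathsf{E}_{k-1}f$. $\mathrm{H}^1(\mu)$ is the Banach space of $f\in L^1(\mu)$ with $$\|f\|_{\mathrm{H}^1}=\Big\|\Big(\sum_{k\in\mathbb{Z}}|\mathsf{D}_kf|^2\Big)^{1/2}\Big\|_{L^1(\mu)}<\infty,$$ and $\mathrm{BMO}(\mu)$ is the Banach space of locally $\mu$-integrable $f$ with $$\|f\|_{\mathrm{BMO}}=\sup_{k\in\mathbb{Z}}\big\|\mathsf{E}_k|f-\mathsf{E}_{k-1}f|\big\|_{L^\infty(\mu)}<\infty,$$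 modulo functions of zero seminorm (functions a.e. constant on each dyadic quadrant). $T$ is initially defined on $L^2(\mu)$; ''extended to a bounded operator on $X$'' means that there is a bounded linear operator on $X$ which coincides with $T$ on $L^2(\mu)\cap X$. *)

(* Defs.v *)
(* MathComp-Analysis. All functions and scalars are real-valued. *)
From HB Require Import structures.
From mathcomp Require Import all_boot all_order all_algebra.
From mathcomp Require Import all_classical all_reals all_analysis.

Set Implicit Arguments.
Unset Strict Implicit.
Unset Printing Implicit Defensive.

Import Order.TTheory GRing.Theory Num.Theory.
Import numFieldNormedType.Exports.

Local Open Scope classical_set_scope.
Local Open Scope ring_scope.

(* R^n carries its Borel sigma-algebra, generated by the open sets. *)
HB.instance Definition _ (R : realType) (n : nat) :=
  @isMeasurable.Build (sigma_display (@open 'rV[R]_n)) 'rV[R]_n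
    <<s open >> (@sigma_algebra0 _ setT open) (@sigma_algebraC _ open)
    (@sigma_algebra_bigcup _ setT open).

Section dyadic.
Context (R : realType) (n : nat).
Local Notation Rn := 'rV[R]_n.
Implicit Types (D : int -> set (set Rn)) (Q S : set Rn).

Definition half_open_cube (a : Rn) (l : R) : set Rn :=
  [set x | forall i : 'I_n, a ord0 i <= x ord0 i < a ord0 i + l].

Definition dyadic_cubes D : set (set Rn) := \bigcup_(k in [set: int]) D k.

Definition dyadic_system D : Prop :=
  [/\ forall k Q, D k Q -> exists a, Q = half_open_cube a (2 ^ (- k)),
      forall k, partition (D k) id [set: Rn] &
      forall Q S, dyadic_cubes D Q -> dyadic_cubes D S ->
        [\/ Q `&` S = set0, Q `<=` S | S `<=` Q]].

(* As cubes of [D k] have side length 2^-k, the condition l(Q) = 2^r l(S) says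
   that the generations of S and Q differ by r. *)
Definition descendants D (r : nat) Q : set (set Rn) :=
  [set S | exists2 k : int, D k Q & D (k + r%:Z) S /\ S `<=` Q].

(* The default value [set0] of [xget] is never taken on dyadic cubes. *)
Definition ancestor D (N : nat) Q : set Rn :=
  xget set0 [set S | descendants D N S Q].

End dyadic.

Section spaces.
Context (R : realType) (n : nat).
Local Notation Rn := 'rV[R]_n.
Variables (D : int -> set (set Rn)) (mu : {measure set Rn -> \bar R}).
Implicit Types (f g : Rn -> R) (Q S : set Rn).

Local Notation "'N_ p [ f ]" := (Lnorm mu p (EFin \o f%R)).

Definition dyadic_measure : Prop :=
  (forall Q, dyadic_cubes D Q -> (0 < mu Q < +oo)%E) /\
  (forall Q, dyadic_cubes D Q ->
     mu (ancestor D N Q) @[N --> \oo] --> +oo%E).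

Definition average f Q : R := (fine (mu Q))^-1 * \int[mu]_(x in Q) f x.

Definition pairing f g : R := \int[mu]_x (f x * g x).

(* At each x a single term is nonzero, so the finitely supported sum [\sum_(Q
   \in _)] is the genuine one. *)
Definition condexp (k : int) f : Rn -> R :=
  fun x => \sum_(Q \in D k) average f Q * \1_Q x.

Definition martingale_diff (k : int) f : Rn -> R :=
  condexp k f \- condexp (k - 1) f.

Definition square_function f : Rn -> \bar R :=
  fun x => ((\esum_(k in [set: int]) (`|martingale_diff k f x| ^+ 2)%:E)
              `^ 2^-1)%E.

(* Vectors of the three function spaces are functions, considered up to the
   equivalence relation [fs_eq]; [fs_norm] is the (semi)norm. *)
Record function_space := FunctionSpace {
  fs_mem : set (Rn -> R);
  fs_eq : (Rn -> R) -> (Rn -> R) -> Prop;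
  fs_norm : (Rn -> R) -> \bar R }.

Definition L2 : function_space := {|
  fs_mem := [set f | f \in Lfun mu 2%:E];
  fs_eq f g := f = g %[ae mu];
  fs_norm f := 'N_2%:E[f] |}.

Definition H1_norm f : \bar R := ('N[mu]_1[square_function f])%E.

Definition H1 : function_space := {|
  fs_mem := [set f | f \in Lfun mu 1 /\ (H1_norm f < +oo)%E];
  fs_eq f g := f = g %[ae mu];
  fs_norm := H1_norm |}.

Definition loc_integrable f : Prop :=
  measurable_fun [set: Rn] f /\
  forall K : set Rn, compact K -> mu.-integrable K (EFin \o f).

Definition BMO_norm f : \bar R :=
  ereal_sup (range (fun k : int =>
    'N_+oo%E[condexp k (fun x => `|f x - condexp (k - 1) f x|)])).

Definition BMO : function_space := {|
  fs_mem := [set f | loc_integrable f /\ (BMO_norm f < +oo)%E];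
  fs_eq f g := BMO_norm (f \- g) = 0%E;
  fs_norm := BMO_norm |}.

Definition bounded_operator (X : function_space)
    (T : (Rn -> R) -> (Rn -> R)) : Prop :=
  [/\ forall f, fs_mem X f -> fs_mem X (T f),
      forall f g, fs_mem X f -> fs_mem X g ->
        fs_eq X f g -> fs_eq X (T f) (T g),
      forall (a : R) f g, fs_mem X f -> fs_mem X g ->
        fs_eq X (T (fun x => a * f x + g x)) (fun x => a * T f x + T g x) &
      exists C : R, forall f, fs_mem X f ->
        (fs_norm X (T f) <= C%:E * fs_norm X f)%E].

Definition extends_boundedly (X : function_space)
    (T : (Rn -> R) -> (Rn -> R)) : Prop :=
  exists2 T' : (Rn -> R) -> (Rn -> R), bounded_operator X T' &
    forall f, fs_mem L2 f -> fs_mem X f -> fs_eq X (T' f) (T f).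

(* Unconditional convergence in L^2(mu): the finite partial sums converge to g
   along the finite subsets of A ordered by inclusion. *)
Definition L2_sum (I : choiceType) (A : set I) (F : I -> Rn -> R) g : Prop :=
  forall e : R, 0 < e ->
    exists J0 : set I, [/\ finite_set J0, J0 `<=` A &
      forall J : set I, finite_set J -> J0 `<=` J -> J `<=` A ->
        ('N_2%:E[ (fun x => g x - \sum_(i \in J) F i x) ] < e%:E)%E].

Definition orthonormal_basis (I : choiceType) (A : set I)
    (e : I -> Rn -> R) : Prop :=
  [/\ forall i, A i -> fs_mem L2 (e i),
      forall i j, A i -> A j -> pairing (e i) (e j) = (i == j)%:R &
      forall f, fs_mem L2 f ->
        L2_sum A (fun i x => pairing f (e i) * e i x) f].

End spaces.

Section haar.
Context (R : realType) (n : nat).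
Local Notation Rn := 'rV[R]_n.
Variables (D : int -> set (set Rn)) (mu : {measure set Rn -> \bar R}).
Variable h : set Rn -> 'I_(2 ^ n).-1 -> Rn -> R.

Definition haar_system : Prop :=
  [/\ forall Q j, dyadic_cubes D Q -> forall x, ~ Q x -> h Q j x = 0,
      forall Q j, dyadic_cubes D Q -> forall S, descendants D 1 Q S ->
        forall x y, S x -> S y -> h Q j x = h Q j y,
      forall Q j, dyadic_cubes D Q -> \int[mu]_x h Q j x = 0 &
      orthonormal_basis mu
        [set p : set Rn * 'I_(2 ^ n).-1 | dyadic_cubes D p.1]
        (fun p => h p.1 p.2)].

Local Notation "'N_ p [ f ]" := (Lnorm mu p (EFin \o f%R)).

Definition balanced : Prop :=
  (ereal_sup [set t : \bar R |
     exists Q S (j j' : 'I_(2 ^ n).-1),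
       [/\ dyadic_cubes D Q, descendants D 1 Q S &
           t = 'N_1%:E[h Q j] * 'N_+oo%E[h S j'] +
               'N_+oo%E[h Q j] * 'N_1%:E[h S j']]] < +oo)%E.

(* The sum over Q below is unconditional in L^2(mu); for each Q the sums over
   P and S are finite, so the finitely supported sums are the genuine ones. *)
Definition haar_shift (r s : nat) (T : (Rn -> R) -> (Rn -> R)) : Prop :=
  exists alpha : set Rn -> set Rn -> set Rn -> R,
    forall f, fs_mem (L2 mu) f ->
      L2_sum mu (dyadic_cubes D)
        (fun Q x => \sum_(P \in descendants D r Q)
                    \sum_(S \in descendants D s Q)
                    \sum_(j : 'I_(2 ^ n).-1) \sum_(j' : 'I_(2 ^ n).-1)
                      alpha Q P S * pairing mu f (h P j) * h S j' x)
        (T f).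

End haar.

(* Main.v *)
(* Everything happens on the side of the Haar coefficients, on which T acts by
   (a_P) |-> (sum_P alpha_{P,S} a_P)_S, where P runs over the boundedly
   many cubes at bounded dyadic distance of S and, since T is bounded on L^2, the
   alpha_{P,S} are bounded. Balance says that sigma(Q) = ||h_Q||_1 is comparable
   to 1 / ||h_Q||_oo and to sigma of the children of Q. Hence coefficients b with
   |b_Q| <= M sigma(Q) and the Carleson condition
   sum_{S subset of Q} b_S^2 <= M^2 mu(Q) are stable under such sums.

   For BMO these two conditions characterize the coefficients: the Carleson
   condition comes from a John-Nirenberg inequality, and conversely a function is
   rebuilt from coefficients satisfying it as an L^1_loc limit of Haar sums, from
   which a constant on each dyadic quadrant is subtracted. For H^1 one dualizes:
   Fefferman's inequality |sum a_Q b_Q| <= 2 M ||S a||_1, applied to coefficients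
   of bounded functions and of families with square sum at most one, gives both
   Davis' inequality ||f||_1 <= C ||S f||_1 and the bound for the square function
   of T f. As every quadrant has infinite measure, an integrable or square
   integrable function is determined by its Haar coefficients. *)
Require Import Defs.
From mathcomp Require Import all_boot all_order all_algebra finmap.
From mathcomp Require Import all_classical all_reals all_analysis.
From mathcomp Require Import measurable_realfun ess_sup_inf zify ring lra.
Set Implicit Arguments.
Unset Strict Implicit.
Unset Printing Implicit Defensive.
Import Order.TTheory GRing.Theory Num.Theory.
Import numFieldNormedType.Exports.
Local Open Scope classical_set_scope.
Local Open Scope ring_scope.

(** Fefferman's and John-Nirenberg's inequalities are both proved by induction on finite trees of
    cubes with a free parameter: the square function energy y accumulated above the tree,
    respectively the reference value c. These parameters take the place of stopping times and atoms.
    As mu is not assumed doubling, a cube and its parent may have very different measures, so the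
    jump of averages from a cube to its parent has to be controlled separately from the oscillation.
    Balance relates a cube only to its children, so a comparison between two Haar functions of one
    cube passes through a child. A shifted coefficient at a cube just below Q may involve cubes
    outside Q, where the Carleson condition on Q says nothing; for these few generations the bound
    by sigma, with sigma(Q)^2 <= mu(Q), takes over. Inequalities are stated for finite families of
    cubes, and limits enter only through the function space norms and in the synthesis of functions.
    The extensions are not given by formulas: for each f some function with the shifted coefficients
    is chosen, and linearity and agreement with T follow because coefficients determine the
    function. *)

Section haar_shifts.
Context (R : realType) (n : nat).
Local Notation Rn := 'rV[R]_n.
Implicit Types (Q S P : set Rn) (x y : Rn).

(** * Dyadic cubes *)

Lemma half_open_cube_corner (a : Rn) (l : R) : 0 < l -> half_open_cube a l a.
Proof. by move=> l0 i; rewrite lexx ltrDl. Qed.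

Lemma sub_half_open_cube (a b : Rn) (l l' : R) : (0 < n)%N -> 0 < l ->
  half_open_cube a l `<=` half_open_cube b l' -> l <= l'.
Proof.
move=> n0 l0 ab; rewrite leNgt; apply/negP => ll'.
pose i0 := Ordinal n0.
have /ab/(_ i0)/andP[ba _] := half_open_cube_corner a l0.
have : half_open_cube a l (\row_i (a ord0 i + Num.max 0 l')).
  move=> i; rewrite mxE lerDl le_max lexx/= ltrD2l.
  by rewrite /Num.max; case: ifP.
move=> /ab/(_ i0); rewrite mxE => /andP[_].
rewrite ltNge lerD//; first by rewrite le_max lexx orbT.
Qed.

Context (n0 : (0 < n)%N) (D : int -> set (set Rn)) (hD : dyadic_system D).
Local Notation cube := (dyadic_cubes D).

Lemma side_gt0 (k : int) : 0 < 2 ^ k :> R.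
Proof. by rewrite exprz_gt0. Qed.

(** Positive dimension enters here: in dimension zero all generations consist of the same one-point
    cube and side lengths cannot be compared. *)
Lemma cube_sub_gen (k l : int) Q S : D k Q -> D l S -> Q `<=` S -> l <= k.
Proof.
case: hD => hc _ _ /hc[a ->] /hc[b ->] /(sub_half_open_cube n0 (side_gt0 _)).
by rewrite ler_eXz2l ?ltr1n// lerN2.
Qed.

Lemma gen_uniq (k l : int) Q : D k Q -> D l Q -> k = l.
Proof.
by move=> h1 h2; apply/eqP; rewrite eq_le (cube_sub_gen h1 h2)// (cube_sub_gen h2 h1).
Qed.

Definition gen Q : int := xget 0 [set k | D k Q].

Lemma genP k Q : D k Q -> gen Q = k.
Proof. by move=> kQ; apply: xget_unique => // l /= lQ; exact: gen_uniq lQ kQ. Qed.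

Lemma cubeP k Q : D k Q -> cube Q.
Proof. by move=> kQ; exists k. Qed.

Lemma cube_gen Q : cube Q -> D (gen Q) Q.
Proof. by move=> [k _ kQ]; rewrite (genP kQ). Qed.

Lemma cube_neq0 Q : cube Q -> Q !=set0.
Proof. by case: hD => _ hp _ [k _ kQ]; have [_ _] := hp k; apply. Qed.

Lemma gen_inj k Q S x : D k Q -> D k S -> Q x -> S x -> Q = S.
Proof.
case: hD => _ hp _ kQ kS Qx Sx; have [_ /trivIsetP tI _] := hp k.
by apply: contrapT => /eqP QS; have : (Q `&` S) x by []; rewrite (tI _ _ kQ kS QS).
Qed.

Definition dcube (k : int) x : set Rn := xget set0 [set Q | D k Q /\ Q x].

Lemma dcube_spec k x : D k (dcube k x) /\ dcube k x x.
Proof.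
case: hD => _ hp _; have [cv _ _] := hp k.
have : [set: Rn] x by []; rewrite -cv => -[Q kQ Qx].
by have := xgetI set0 (conj kQ Qx : [set Q | D k Q /\ Q x] Q).
Qed.

Lemma dcubeP k x : D k (dcube k x). Proof. by have [] := dcube_spec k x. Qed.
Lemma dcube_mem k x : dcube k x x. Proof. by have [] := dcube_spec k x. Qed.

Lemma dcube_eq k Q x : D k Q -> Q x -> dcube k x = Q.
Proof. move=> kQ Qx; exact: (gen_inj (dcubeP k x) kQ (dcube_mem k x)). Qed.

Lemma dcube_cube k x : cube (dcube k x).
Proof. exact: cubeP (dcubeP _ _). Qed.
Hint Resolve dcube_cube dcubeP dcube_mem : core.

Lemma gen_dcube k x : gen (dcube k x) = k.
Proof. exact: genP. Qed.

Lemma dcube_gen Q x : cube Q -> Q x -> dcube (gen Q) x = Q.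
Proof. by move=> cQ; apply: dcube_eq (cube_gen cQ). Qed.

Lemma cube_nested Q S x : cube Q -> cube S -> Q x -> S x -> gen S <= gen Q -> Q `<=` S.
Proof.
move=> cQ cS Qx Sx SQ; case: hD => _ _ /(_ _ _ cQ cS)[QS|//|SsQ].
  by have : (Q `&` S) x by []; rewrite QS.
have := cube_sub_gen (cube_gen cS) (cube_gen cQ) SsQ => QS.
have gE : gen Q = gen S by apply/eqP; rewrite eq_le QS SQ.
have := gen_inj (cube_gen cQ) _ Qx Sx; rewrite gE => ->//; exact: cube_gen.
Qed.

Lemma cube_sub_genE Q S : cube Q -> cube S -> Q `<=` S -> gen S <= gen Q.
Proof. by move=> cQ cS; apply: cube_sub_gen; exact: cube_gen. Qed.

Lemma dcube_sub k l x : k <= l -> dcube l x `<=` dcube k x.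
Proof. by move=> kl; apply: (@cube_nested _ _ x) => //; rewrite !gen_dcube. Qed.

Definition pt Q : Rn := xget 0 Q.
Lemma pt_mem Q : cube Q -> Q (pt Q).
Proof. by move=> /cube_neq0[x Qx]; exact: xgetI Qx. Qed.

Lemma descendantsP i Q S : cube Q ->
  descendants D i Q S <-> [/\ cube S, gen S = gen Q + i%:Z & S `<=` Q].
Proof.
move=> cQ; split=> [[k kQ [kS SQ]]|[cS gS SQ]].
  by rewrite (genP kQ) (genP kS); split => //; exact: cubeP kS.
by exists (gen Q); [exact: cube_gen | rewrite -gS; split => //; exact: cube_gen].
Qed.

Lemma ancestorE i Q x : cube Q -> Q x -> ancestor D i Q = dcube (gen Q - i%:Z) x.
Proof.
move=> cQ Qx; apply: xget_unique => /=.
  apply/descendantsP => //; split => //; first by rewrite gen_dcube subrK.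
  by apply: (@cube_nested _ _ x) => //; rewrite gen_dcube gerBl.
move=> S hS; have cS : cube S by case: hS => k kS _; exact: cubeP kS.
have := hS => /(descendantsP _ _ cS)[_ gQ QS].
by rewrite gQ addrK dcube_gen//; exact: QS.
Qed.

Lemma ancestor_cube i Q : cube Q -> cube (ancestor D i Q).
Proof. by move=> cQ; rewrite (ancestorE i cQ (pt_mem cQ)). Qed.

Lemma gen_ancestor i Q : cube Q -> gen (ancestor D i Q) = gen Q - i%:Z.
Proof. by move=> cQ; rewrite (ancestorE i cQ (pt_mem cQ)) gen_dcube. Qed.

Lemma sub_ancestor i Q : cube Q -> Q `<=` ancestor D i Q.
Proof.
move=> cQ; rewrite (ancestorE i cQ (pt_mem cQ)).
by apply: (@cube_nested _ _ (pt Q)) => //; [exact: pt_mem | rewrite gen_dcube gerBl].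
Qed.

Lemma ancestor_desc i Q S : cube Q -> descendants D i Q S -> ancestor D i S = Q.
Proof.
move=> cQ /(descendantsP _ _ cQ)[cS gS SQ].
rewrite (ancestorE i cS (pt_mem cS)) gS addrK dcube_gen//; exact: SQ (pt_mem cS).
Qed.

Lemma desc_ancestor i S : cube S -> descendants D i (ancestor D i S) S.
Proof.
move=> cS; apply/descendantsP; first exact: ancestor_cube.
by rewrite gen_ancestor// subrK; split => //; exact: sub_ancestor.
Qed.


(** * Integer keys of cubes: finiteness and countability *)

Definition corner Q : Rn := xget 0 [set a | Q = half_open_cube a (2 ^ (- gen Q))].

Lemma cornerE Q : cube Q -> Q = half_open_cube (corner Q) (2 ^ (- gen Q)).
Proof.
move=> cQ; have [hc _ _] := hD; have [a Qa] := hc _ _ (cube_gen cQ).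
exact: (xgetI 0 (Qa : [set a | Q = half_open_cube a (2 ^ (- gen Q))] a)).
Qed.

Lemma corner_mem Q : cube Q -> Q (corner Q).
Proof.
move=> cQ; have := half_open_cube_corner (corner Q) (side_gt0 (- gen Q)).
by rewrite -cornerE.
Qed.

(** The dyadic system is arbitrary, possibly translated, so corners need not lie on a lattice;
    taking integer parts codes the cubes of one generation by integer vectors all the same. *)
Definition key Q : {ffun 'I_n -> int} :=
  [ffun i => Num.floor (corner Q ord0 i * 2 ^ gen Q)].

(* Two half-open cubes of side l whose corners have the same integer part
   in units of l intersect. *)
Lemma key_inj Q S : cube Q -> cube S -> gen Q = gen S -> key Q = key S -> Q = S.
Proof.
move=> cQ cS gQS kQS.
pose x : Rn := \row_i Num.max (corner Q ord0 i) (corner S ord0 i).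
have l0 : (0 : R) < 2 ^ gen Q by exact: side_gt0.
have clo i : `|corner Q ord0 i - corner S ord0 i| < 2 ^ (- gen Q).
  have /ffunP/(_ i) := kQS; rewrite !ffunE -gQS => fE.
  rewrite -invr_expz -(ltr_pM2r l0) mulVf ?gt_eqF// -[X in _ * X]gtr0_norm// -normrM mulrBl.
  have /andP[h1 h2] := floor_itv (corner Q ord0 i * 2 ^ gen Q).
  have /andP[h3 h4] := floor_itv (corner S ord0 i * 2 ^ gen Q).
  rewrite -fE in h3 h4.
  move: h2 h4; rewrite intrD => h2 h4.
  by rewrite ltr_norml; apply/andP; split; lra.
apply: (@gen_inj (gen Q) Q S x); [exact: cube_gen | rewrite gQS; exact: cube_gen | |].
- rewrite (cornerE cQ) => i; rewrite mxE le_max lexx/=.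
  by have := clo i; rewrite ltr_norml gt_max => /andP[h1 h2]; apply/andP; split; lra.
- rewrite (cornerE cS) => i; rewrite mxE le_max lexx orbT/= -gQS.
  by have := clo i; rewrite ltr_norml gt_max => /andP[h1 h2]; apply/andP; split; lra.
Qed.

(** Both conclusions come from the same injection: the keys, shifted by [lo], are functions from
    ['I_n] to ['I_N.+1], and these are counted. *)
Lemma fin_keys (k : int) (lo : 'I_n -> int) (N : nat) (X : set (set Rn)) :
  (forall Q, X Q -> D k Q /\ forall i, lo i <= key Q i <= lo i + N%:Z) ->
  finite_set X /\ forall s : seq (set Rn), uniq s ->
    (forall Q, Q \in s -> X Q) -> (size s <= N.+1 ^ n)%N.
Proof.
move=> hX.
pose f Q : {ffun 'I_n -> 'I_N.+1} := [ffun i => inord `|key Q i - lo i|%N].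
have finj Q S : X Q -> X S -> f Q = f S -> Q = S.
  move=> XQ XS fE; have [kQ loQ] := hX _ XQ; have [kS loS] := hX _ XS.
  apply: key_inj; [exact: cubeP kQ|exact: cubeP kS|by rewrite (genP kQ) (genP kS)|].
  have fi P i : val (f P i) = (inord `|key P i - lo i|%N : 'I_N.+1) by rewrite ffunE.
  apply/ffunP => i; have := congr1 (fun g : {ffun _ -> _} => val (g i)) fE; rewrite !fi.
  have := loQ i; have := loS i; move: (key Q i) (key S i) (lo i) => a b c h1 h2.
  by rewrite !inordK; lia.
split.
  have fX : {in X &, injective f} by move=> Q S /set_mem XQ /set_mem XS; exact: finj.
  by rewrite -(eq_finite_set (inj_card_eq fX)); exact: finite_finset.
move=> s us sX.
have : uniq (map f s).
  by rewrite map_inj_in_uniq// => Q S Qs Ss; apply: finj; exact: sX.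
move=> /card_uniqP; rewrite size_map => <-.
by apply: leq_trans (max_card _) _; rewrite card_ffun !card_ord.
Qed.

(** Without locating the subcubes inside Q one allows 2^i + 1 integer parts per coordinate; what
    matters later is a bound that depends on i and n alone. *)
Lemma desc_fin i Q : cube Q -> finite_set (descendants D i Q) /\
  forall s : seq (set Rn), uniq s -> (forall S, S \in s -> descendants D i Q S) ->
    (size s <= (2 ^ i).+1 ^ n)%N.
Proof.
move=> cQ.
apply: (@fin_keys (gen Q + i%:Z) (fun j => Num.floor (corner Q ord0 j * 2 ^ (gen Q + i%:Z)))).
move=> S /(descendantsP _ _ cQ)[cS gS SQ]; split; first by rewrite -gS; exact: cube_gen.
move=> j; have := SQ _ (corner_mem cS); rewrite {1}(cornerE cQ) => /(_ j)/andP[h1 h2].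
rewrite ffunE gS; apply/andP; split; first by apply: le_floor; rewrite ler_pM2r ?side_gt0.
rewrite -ltzD1 -(ltr_int R); apply: le_lt_trans (floor_le _) _.
have := floor_itv (corner Q ord0 j * 2 ^ (gen Q + i%:Z)) => /andP[_].
have : corner S ord0 j * 2 ^ (gen Q + i%:Z) <
   corner Q ord0 j * 2 ^ (gen Q + i%:Z) + 2 ^+ i.
  have -> : (2 : R) ^+ i = 2 ^ (- gen Q) * 2 ^ (gen Q + i%:Z).
    by rewrite -expfzDr// addrA addNr add0r.
  by rewrite -mulrDl ltr_pM2r ?side_gt0.
rewrite !intrD -natrX => h3 h4.
have -> : ((2 ^ i)%N%:Z)%:~R = (2 ^ i)%N%:R :> R by [].
lra.
Qed.

Definition desc i Q : seq (set Rn) := fset_set (descendants D i Q).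

Lemma desc_uniq i Q : uniq (desc i Q). Proof. exact: fset_uniq. Qed.

Lemma mem_desc i Q S : cube Q -> S \in desc i Q <-> [/\ cube S, gen S = gen Q + i%:Z & S `<=` Q].
Proof.
move=> cQ; rewrite -(descendantsP _ _ cQ); have [fin _] := desc_fin i cQ.
by rewrite /desc (in_fset_set fin); split => [/set_mem//|/mem_set].
Qed.

Lemma size_desc i Q : cube Q -> (size (desc i Q) <= (2 ^ i).+1 ^ n)%N.
Proof.
move=> cQ; have [_] := desc_fin i cQ; apply; first exact: desc_uniq.
by move=> S /(mem_desc _ _ cQ)/(descendantsP _ _ cQ).
Qed.

Lemma fin_meet (k : int) (M : R) :
  finite_set [set Q | D k Q /\ exists2 x, Q x & forall i, `|x ord0 i| <= M].
Proof.
pose B : R := (M + 2 ^ (- k)) * 2 ^ k.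
pose N := absz (Num.floor B + 1).
apply: (proj1 (@fin_keys k (fun=> - N%:Z) (2 * N) _ _)).
move=> Q [kQ [x Qx xM]]; split => // i; rewrite ffunE (genP kQ).
have cQ := cubeP kQ.
have l0 : (0 : R) < 2 ^ k by exact: side_gt0.
have l1 : (0 : R) < 2 ^ (- k) by exact: side_gt0.
move: Qx; rewrite {1}(cornerE cQ) (genP kQ) => /(_ i)/andP[h1 h2].
have := xM i; rewrite ler_norml => /andP[h3 h4].
have BN : B <= (N%:Z)%:~R.
  have /andP[_ h5] := floor_itv B; apply/ltW/(lt_le_trans h5).
  by rewrite ler_int /N; move: (Num.floor B + 1) => b; lia.
have c1 : corner Q ord0 i * 2 ^ k <= B.
  by rewrite ler_pM2r//; lra.
have c2 : - B <= corner Q ord0 i * 2 ^ k.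
  by rewrite -mulNr ler_pM2r//; lra.
apply/andP; split.
  rewrite floor_ge_int intrN; lra.
rewrite -(ler_int R); apply: le_trans (floor_le _) _.
apply: le_trans c1 _; apply: le_trans BN _; rewrite ler_int; lia.
Qed.

(** Generation and key identify a cube, so coding the pair by a natural number enumerates all cubes.
    The inverse [cenum] is empty at indices that code no cube. *)
Definition cidx Q : nat := choice.pickle (gen Q, key Q).

Lemma cidx_inj Q S : cube Q -> cube S -> cidx Q = cidx S -> Q = S.
Proof.
by move=> cQ cS /(pcan_inj choice.pickleK)[gQS kQS]; exact: key_inj.
Qed.

Definition cenum (i : nat) : set Rn := xget set0 [set Q | cube Q /\ cidx Q = i].

Lemma cenumE Q : cube Q -> cenum (cidx Q) = Q.
Proof.
move=> cQ; apply: xget_unique => //= S [cS]; exact: cidx_inj.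
Qed.

Lemma cenumP i : cube (cenum i) \/ cenum i = set0.
Proof.
rewrite /cenum; case: (pselect (exists Q, cube Q /\ cidx Q = i)) => [/(xgetPex set0)[]|nex].
  by left.
by right; apply: xgetPN => Q hQ; apply: nex; exists Q.
Qed.

Lemma cube_cenum i : cube (cenum i) -> cidx (cenum i) = i.
Proof.
rewrite /cenum; case: (pselect (exists Q, cube Q /\ cidx Q = i)) => [/(xgetPex set0)[]//|nex].
rewrite xgetPN => [/cube_neq0[x []]|Q hQ]; by apply: nex; exists Q.
Qed.

(** * The cubes as generators of the Borel sets *)

Lemma open_coord_lt (i : 'I_n) (c : R) : open [set x : Rn | x ord0 i < c].
Proof.
apply: (@open_comp _ _ (fun x : Rn => x ord0 i) [set t | t < c]); last exact: open_lt.
by move=> x _; exact: coord_continuous.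
Qed.

Lemma cube_measurable Q : cube Q -> measurable Q.
Proof.
move=> cQ; rewrite (cornerE cQ).
have -> : half_open_cube (corner Q) (2 ^ (- gen Q)) =
  \bigcap_(i in [set: 'I_n]) (~` [set x : Rn | x ord0 i < corner Q ord0 i] `&`
     [set x : Rn | x ord0 i < corner Q ord0 i + 2 ^ (- gen Q)]).
  apply/seteqP; split => x /= hx i.
    by move=> _; have /andP[h1 h2] := hx i; split => //; apply/negP; rewrite -leNgt.
  by have [/negP h1 h2] := hx i I; rewrite h2 andbT leNgt.
apply: fin_bigcap_measurable; first exact: finite_finset.
move=> i _; apply: measurableI; first apply: measurableC.
  by apply: sub_sigma_algebra; exact: open_coord_lt.
by apply: sub_sigma_algebra; exact: open_coord_lt.
Qed.

Lemma pow_small (e : R) : 0 < e -> exists k : nat, 2 ^ (- k%:Z) < e :> R.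
Proof.
move=> e0; exists (Num.bound e^-1); rewrite -invr_expz -[ltRHS]invrK.
rewrite ltf_pV2 ?posrE ?invr_gt0 ?exprz_gt0//.
exact: (@upper_nthrootP R e^-1 (Num.bound e^-1) (leqnn _)).
Qed.

Lemma open_bigcup_cubes (U : set Rn) : open U ->
  U = \bigcup_i (if pselect (cenum i `<=` U) then cenum i else set0).
Proof.
move=> oU; apply/seteqP; split => [x Ux|x [i _]]; last first.
  by case: (pselect (cenum i `<=` U)) => //= + Qx; apply.
have : nbhs x U by exact: open_nbhs_nbhs.
move=> /nbhs_ballP[e /= e0 xeU].
have [k ke] := pow_small e0.
have QU : dcube k%:Z x `<=` U.
  move=> y; rewrite (cornerE (dcube_cube _ _)) gen_dcube => Qy; apply: xeU.
  have := dcube_mem k x; rewrite {1}(cornerE (dcube_cube k x)) gen_dcube => Qx.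
  split => // i j; rewrite ord1; apply: lt_trans ke.
  have /andP[h1 h2] := Qx j; have /andP[h3 h4] := Qy j.
  by rewrite ltr_norml; apply/andP; split; lra.
exists (cidx (dcube k%:Z x)) => //; rewrite cenumE//.
by case: (pselect (dcube k%:Z x `<=` U)) => //= _; exact: dcube_mem.
Qed.

(** An open set is the countable union of the cubes inside it. The empty set is added to the
    generators so that they are stable under intersection, as Dynkin's argument requires. *)
Lemma measurable_cubes : @measurable _ Rn = <<s [set Q | Q = set0 \/ cube Q] >>.
Proof.
rewrite eqEsubset; split; last first.
  apply: smallest_sub; first exact: sigma_algebra_measurable.
  by move=> Q [->|/cube_measurable].
apply: smallest_sub; first exact: smallest_sigma_algebra.
move=> U /open_bigcup_cubes ->; apply: sigma_algebra_bigcup => i.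
case: (pselect (cenum i `<=` U)) => /= _; last by apply: sub_sigma_algebra; left.
by apply: sub_sigma_algebra; case: (cenumP i) => ?; [right|left].
Qed.

Lemma cubes_setI_closed : setI_closed [set Q | Q = set0 \/ cube Q].
Proof.
move=> Q S [->|cQ] [->|cS]; rewrite /= ?set0I ?setI0; try by left.
have [_ _ hn] := hD; case: (hn _ _ cQ cS) => [->|/setIidPl ->|/setIidPr ->]; by [left|right].
Qed.

(** * Integration over dyadic cubes *)

Context (mu : {measure set Rn -> \bar R}) (hmu : dyadic_measure D mu).

Lemma mu_gt0 Q : cube Q -> (0 < mu Q)%E.
Proof. by case: hmu => h _ /h/andP[]. Qed.
Lemma mu_lty Q : cube Q -> (mu Q < +oo)%E.
Proof. by case: hmu => h _ /h/andP[]. Qed.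

(** Dynkin's pi-lambda argument: the sets A for which f has integral zero over the part of A in Q
    form a lambda-system containing the cubes, hence all Borel sets. This plays the role of
    Lebesgue's differentiation theorem. *)
Lemma cube_integral_eq0 Q (f : Rn -> R) : cube Q -> mu.-integrable Q (EFin \o f) ->
  (forall S, cube S -> S `<=` Q -> \int[mu]_(x in S) f x = 0) ->
  ae_eq mu Q (EFin \o f) (cst 0%E).
Proof.
move=> cQ fi f0; have mQ := cube_measurable cQ.
have iS A : measurable A -> mu.-integrable (A `&` Q) (EFin \o f).
  by move=> mA; apply: integrableS fi => //; exact: measurableI.
have H : forall A, <<s [set Q | Q = set0 \/ cube Q] >> A ->
    (\int[mu]_(x in A `&` Q) (EFin \o f) x = 0)%E.
  apply: (dynkin_induction measurable_cubes cubes_setI_closed).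
  - rewrite setTI -[LHS]fineK; last exact: integrable_fin_num.
    by congr EFin; exact: f0.
  - move=> S /= [->|cS]; first by rewrite set0I integral_set0.
    have [_ _ hn] := hD; case: (hn _ _ cS cQ) => [->|SQ|QS].
    + by rewrite integral_set0.
    + have mS := cube_measurable cS.
      rewrite (setIidl SQ) -[LHS]fineK; first by congr EFin; exact: f0.
      by apply: integrable_fin_num => //; exact: integrableS fi.
    + rewrite (setIidr QS) -[LHS]fineK; last exact: integrable_fin_num.
      by congr EFin; exact: f0.
  - move=> A mA A0.
    have := @integral_setU_EFin _ _ _ mu (A `&` Q) (~` A `&` Q) f.
    rewrite -setIUl setUv setTI A0 add0e => <-.
    + rewrite -[LHS]fineK; last exact: integrable_fin_num.
      by congr EFin; exact: f0.
    + exact: measurableI.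
    + by apply: measurableI => //; exact: measurableC.
    + by have /integrableP[/measurable_EFinP] := fi.
    + by apply/disj_setPS => x [[Ax _] [nAx _]].
  - move=> F mF tF F0; rewrite setI_bigcupl integral_bigcup.
    + by rewrite eseries0// => i _ _; exact: F0.
    + exact: trivIset_setIr.
    + by move=> i; exact: measurableI.
    + rewrite -setI_bigcupl; apply: iS; exact: bigcupT_measurable.
apply: integral_ae_eq => //.
move=> E EQ mE; rewrite integral0 -(setIidl EQ); apply: H.
by rewrite -measurable_cubes.
Qed.

Definition w Q : R := fine (mu Q).

Lemma w_gt0 Q : cube Q -> 0 < w Q.
Proof. by move=> cQ; rewrite fine_gt0// mu_gt0// mu_lty. Qed.

Lemma wE Q : cube Q -> (w Q)%:E = mu Q.
Proof. by move=> cQ; rewrite fineK// ge0_fin_numE// mu_lty. Qed.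

(** Integrability on cubes is the form used throughout; [loc_integrableP] identifies it with
    integrability on compact sets. *)
Definition loc_int (f : Rn -> R) : Prop :=
  measurable_fun setT f /\ forall Q, cube Q -> mu.-integrable Q (EFin \o f).

Definition bdd_meas (f : Rn -> R) : Prop :=
  measurable_fun setT f /\ exists C, forall x, `|f x| <= C.

Lemma bounded_le (f : Rn -> R) C (A : set Rn) :
  (forall x, A x -> `|f x| <= C) -> [bounded f x | x in A].
Proof.
move=> fC; exists C; split; first exact: num_real.
by move=> M CM x Ax; apply: le_trans (fC x Ax) (ltW CM).
Qed.

Lemma bdd_meas_loc_int f : bdd_meas f -> loc_int f.
Proof.
move=> [mf [C fC]]; split => // Q cQ; apply: measurable_bounded_integrable.
- exact: cube_measurable.
- exact: mu_lty.
- exact: measurable_funTS.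
- by apply: (@bounded_le _ C) => x _.
Qed.

Lemma bdd_meas_cst c : bdd_meas (fun=> c).
Proof. by split; [exact: measurable_cst | exists `|c|]. Qed.

Lemma bdd_meas_indic (A : set Rn) : measurable A -> bdd_meas (\1_A).
Proof.
move=> mA; split; first exact: measurable_indic.
by exists 1 => x; rewrite indicE; case: (x \in A); rewrite ?normr1// normr0.
Qed.

Lemma bdd_meas_mul f g : bdd_meas f -> bdd_meas g -> bdd_meas (fun x => f x * g x).
Proof.
move=> [mf [C fC]] [mg [C' gC]]; split; first exact: measurable_funM.
by exists (C * C') => x; rewrite normrM ler_pM.
Qed.

Lemma bdd_meas_add f g : bdd_meas f -> bdd_meas g -> bdd_meas (fun x => f x + g x).
Proof.
move=> [mf [C fC]] [mg [C' gC]]; split; first exact: measurable_funD.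
by exists (C + C') => x; rewrite (le_trans (ler_normD _ _))// lerD.
Qed.

Lemma bdd_meas_sum (I : eqType) (s : seq I) (F : I -> Rn -> R) :
  (forall i, i \in s -> bdd_meas (F i)) -> bdd_meas (fun x => \sum_(i <- s) F i x).
Proof.
elim: s => [_|i s ih hs].
  by under eq_fun do rewrite big_nil; exact: bdd_meas_cst.
under eq_fun do rewrite big_cons; apply: bdd_meas_add; first exact/hs/mem_head.
by apply: ih => j js; apply: hs; rewrite inE js orbT.
Qed.

Lemma loc_int_cst c : loc_int (fun=> c). Proof. exact/bdd_meas_loc_int/bdd_meas_cst. Qed.

Lemma loc_int_add f g : loc_int f -> loc_int g -> loc_int (fun x => f x + g x).
Proof.
move=> [mf fi] [mg gi]; split; first exact: measurable_funD.
by move=> Q cQ; apply: integrableD (fi Q cQ) (gi Q cQ); exact: cube_measurable.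
Qed.

Lemma loc_int_mul f g : loc_int f -> bdd_meas g -> loc_int (fun x => f x * g x).
Proof.
move=> [mf fi] [mg [C gC]]; split; first exact: measurable_funM.
move=> Q cQ; apply: (integrableMl (cube_measurable cQ) (fi Q cQ)).
  exact: measurable_funTS.
by apply: (@bounded_le _ C) => x _.
Qed.

Lemma loc_int_scale c f : loc_int f -> loc_int (fun x => c * f x).
Proof.
move=> fL; have -> : (fun x => c * f x) = (fun x => f x * c) by apply/funext => x; rewrite mulrC.
exact: loc_int_mul fL (bdd_meas_cst c).
Qed.

Lemma loc_int_opp f : loc_int f -> loc_int (fun x => - f x).
Proof.
move=> fL; have -> : (fun x => - f x) = (fun x => -1 * f x).
  by apply/funext => x; rewrite mulN1r.
exact: loc_int_scale.
Qed.

Lemma loc_int_sub f g : loc_int f -> loc_int g -> loc_int (fun x => f x - g x).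
Proof. by move=> fL gL; apply: loc_int_add => //; exact: loc_int_opp. Qed.

Lemma loc_int_sum (I : eqType) (s : seq I) (F : I -> Rn -> R) :
  (forall i, i \in s -> loc_int (F i)) -> loc_int (fun x => \sum_(i <- s) F i x).
Proof.
elim: s => [_|i s ih hs].
  by under eq_fun do rewrite big_nil; exact: loc_int_cst.
under eq_fun do rewrite big_cons; apply: loc_int_add; first exact/hs/mem_head.
by apply: ih => j js; apply: hs; rewrite inE js orbT.
Qed.

Lemma loc_int_norm f : loc_int f -> loc_int (fun x => `|f x|).
Proof.
move=> [mf fi]; split; first exact: measurableT_comp.
move=> Q cQ; exact: integrable_norm (fi Q cQ).
Qed.

Lemma intD Q f g : cube Q -> loc_int f -> loc_int g ->
  \int[mu]_(x in Q) (f x + g x) = \int[mu]_(x in Q) f x + \int[mu]_(x in Q) g x.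
Proof.
by move=> cQ [_ fL] [_ gL]; apply: RintegralD; [exact: cube_measurable|exact: fL|exact: gL].
Qed.

Lemma intB Q f g : cube Q -> loc_int f -> loc_int g ->
  \int[mu]_(x in Q) (f x - g x) = \int[mu]_(x in Q) f x - \int[mu]_(x in Q) g x.
Proof.
by move=> cQ [_ fL] [_ gL]; apply: RintegralB; [exact: cube_measurable|exact: fL|exact: gL].
Qed.

Lemma intZ Q c f : cube Q -> loc_int f ->
  \int[mu]_(x in Q) (c * f x) = c * \int[mu]_(x in Q) f x.
Proof. by move=> cQ [_ fL]; apply: RintegralZl; [exact: cube_measurable|exact: fL]. Qed.

Lemma int_cst Q c : cube Q -> \int[mu]_(x in Q) c = c * w Q.
Proof. by move=> cQ; rewrite Rintegral_cst//; exact: cube_measurable. Qed.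

Lemma int_le Q f g : cube Q -> loc_int f -> loc_int g -> (forall x, Q x -> f x <= g x) ->
  \int[mu]_(x in Q) f x <= \int[mu]_(x in Q) g x.
Proof.
by move=> cQ [_ fL] [_ gL]; apply: le_Rintegral; [exact: cube_measurable|exact: fL|exact: gL].
Qed.

Lemma int_norm Q f : cube Q -> loc_int f ->
  `|\int[mu]_(x in Q) f x| <= \int[mu]_(x in Q) `|f x|.
Proof.
by move=> cQ [_ fL]; apply: le_normr_Rintegral; [exact: cube_measurable|exact: fL].
Qed.

Lemma int_sum (I : eqType) (s : seq I) (F : I -> Rn -> R) Q : cube Q ->
  (forall i, i \in s -> loc_int (F i)) ->
  \int[mu]_(x in Q) (\sum_(i <- s) F i x) = \sum_(i <- s) \int[mu]_(x in Q) F i x.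
Proof.
move=> cQ; elim: s => [_|i s ih hs].
  rewrite big_nil -[RHS](mul0r (w Q)) -int_cst//.
  by apply: eq_Rintegral => x _; rewrite big_nil.
have Ls : forall j, j \in s -> loc_int (F j) by move=> j js; apply: hs; rewrite inE js orbT.
rewrite big_cons -ih// -intD//; [|exact/hs/mem_head|exact: loc_int_sum].
by apply: eq_Rintegral => x _; rewrite big_cons.
Qed.

Lemma int_eq Q f g : (forall x, Q x -> f x = g x) ->
  \int[mu]_(x in Q) f x = \int[mu]_(x in Q) g x.
Proof. by move=> fg; apply: eq_Rintegral => x /set_mem; exact: fg. Qed.

Lemma int_setT Q (f : Rn -> R) : (forall x, ~ Q x -> f x = 0) ->
  \int[mu]_x f x = \int[mu]_(x in Q) f x.
Proof.
move=> f0; rewrite [RHS]Rintegral_mkcond; apply: eq_Rintegral => x _.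
rewrite patchE; case: ifPn => // /negP xQ; apply: f0 => Qx; apply: xQ; exact: mem_set.
Qed.

Lemma desc_mem i Q x : cube Q -> Q x ->
  dcube (gen Q + i%:Z) x \in desc i Q.
Proof.
move=> cQ Qx; apply/(mem_desc _ _ cQ); split => //; first by rewrite gen_dcube.
by apply: (@cube_nested _ _ x) => //; rewrite gen_dcube lerDl.
Qed.

Lemma desc_disj i Q S S' x : cube Q -> S \in desc i Q -> S' \in desc i Q ->
  S x -> S' x -> S = S'.
Proof.
move=> cQ /(mem_desc _ _ cQ)[cS gS _] /(mem_desc _ _ cQ)[cS' gS' _].
by apply: (@gen_inj (gen Q + i%:Z)); [rewrite -gS|rewrite -gS']; exact: cube_gen.
Qed.

Lemma int_cubes (s : seq (set Rn)) (U : set Rn) f : uniq s ->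
  (forall S, S \in s -> cube S /\ S `<=` U) ->
  (forall S S' x, S \in s -> S' \in s -> S x -> S' x -> S = S') ->
  (forall x, U x -> exists2 S, S \in s & S x) -> loc_int f ->
  \int[mu]_(x in U) f x = \sum_(S <- s) \int[mu]_(x in S) f x.
Proof.
move=> us cs dj cov [mf fL].
(* [F] is the identity on cubes and empty elsewhere, so that measurability holds for every index and
   not just for those in the list. *)
pose F S : set Rn := if pselect (cube S) then S else set0.
have FE S : cube S -> F S = S by rewrite /F; case: pselect.
have FE' S : S \in s -> F S = S by move=> /cs[/FE].
have QE : U = \big[setU/set0]_(S <- s) F S.
  rewrite -bigcup_seq; apply/seteqP; split => x.
    by move=> /cov[S Ss Sx]; exists S; rewrite // FE'.
  by move=> [S /=] => /[dup] /FE' -> /cs[_]; apply.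
rewrite {1}QE {1}/Rintegral integral_bigsetU_EFin//; first last.
- exact/measurable_funTS/measurable_EFinP.
- move=> S S' /= Ss Ss' [x []]; rewrite !FE'//; exact: dj.
- by move=> S; rewrite /F; case: (pselect (cube S)) => //= cS; exact: cube_measurable.
rewrite big_seq [in RHS]big_seq.
rewrite -[RHS]/(fine (\sum_(S <- s | S \in s) \int[mu]_(x in S) f x)%:E).
congr fine; rewrite -sumEFin; apply: eq_bigr => S Ss.
have [cS _] := cs _ Ss.
rewrite FE// /Rintegral fineK//; apply: (integrable_fin_num (cube_measurable cS)).
exact: fL.
Qed.

Lemma int_desc i Q f : cube Q -> loc_int f ->
  \int[mu]_(x in Q) f x = \sum_(S <- desc i Q) \int[mu]_(x in S) f x.
Proof.
move=> cQ fL; apply: int_cubes => //; first exact: desc_uniq.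
- by move=> S /(mem_desc _ _ cQ)[cS _ SQ].
- by move=> S S' x Ss S's; exact: (desc_disj cQ Ss S's).
- by move=> x Qx; exists (dcube (gen Q + i%:Z) x) => //; exact: desc_mem.
Qed.

Lemma w_desc i Q : cube Q -> w Q = \sum_(S <- desc i Q) w S.
Proof.
move=> cQ; have := int_desc i cQ (loc_int_cst 1); rewrite int_cst// mul1r => ->.
rewrite big_seq [RHS]big_seq; apply: eq_bigr => S /(mem_desc _ _ cQ)[cS _ _].
by rewrite int_cst// mul1r.
Qed.

(** * Haar coefficients *)

Context (h : set Rn -> 'I_(2 ^ n).-1 -> Rn -> R) (hh : haar_system D mu h).
Local Notation J := 'I_(2 ^ n).-1.

Lemma pt_inj_child Q S x : cube Q -> S \in desc 1 Q -> S x -> forall j, h Q j x = h Q j (pt S).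
Proof.
move=> cQ Ss Sx j; have [_ hc _ _] := hh.
have /(mem_desc _ _ cQ)[cS gS SQ] := Ss.
apply: (hc Q j cQ S) => //; last exact: pt_mem.
by apply/(descendantsP _ _ cQ).
Qed.

Lemma haar_out Q j x : cube Q -> ~ Q x -> h Q j x = 0.
Proof. by move=> cQ; have [h0 _ _ _] := hh; exact: h0. Qed.

Lemma haarE Q j : cube Q -> h Q j = fun x => \sum_(S <- desc 1 Q) h Q j (pt S) * \1_S x.
Proof.
move=> cQ; apply/funext => x; have [Qx|nQx] := pselect (Q x).
  have xs := desc_mem 1 cQ Qx.
  rewrite (bigD1_seq _ xs (desc_uniq _ _))/= indicE (mem_set (dcube_mem _ _)) mulr1.
  rewrite (pt_inj_child cQ xs (dcube_mem _ _)) big1_seq ?addr0// => S /andP[Sne Ss].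
  rewrite indicE memNset ?mulr0// => Sx; move/eqP: Sne; apply.
  exact: (desc_disj cQ Ss xs Sx (dcube_mem _ _)).
rewrite haar_out// big1_seq// => S /andP[_ Ss].
have /(mem_desc _ _ cQ)[_ _ SQ] := Ss.
by rewrite indicE memNset ?mulr0// => /SQ.
Qed.

Lemma haar_bdd_meas Q j : cube Q -> bdd_meas (h Q j).
Proof.
move=> cQ; rewrite haarE//; apply: bdd_meas_sum => S /(mem_desc _ _ cQ)[cS _ _].
by apply: bdd_meas_mul; [exact: bdd_meas_cst|apply: bdd_meas_indic; exact: cube_measurable].
Qed.

Lemma pairing_int Q j f : cube Q -> pairing mu f (h Q j) = \int[mu]_(x in Q) (f x * h Q j x).
Proof.
by move=> cQ; rewrite /pairing (@int_setT Q)// => x nQx; rewrite haar_out ?mulr0.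
Qed.

Lemma pairingE Q j f : cube Q -> loc_int f ->
  pairing mu f (h Q j) = \sum_(S <- desc 1 Q) h Q j (pt S) * \int[mu]_(x in S) f x.
Proof.
move=> cQ fL; rewrite pairing_int// (int_desc 1 cQ); last exact/loc_int_mul/haar_bdd_meas.
rewrite big_seq [RHS]big_seq; apply: eq_bigr => S Ss.
have /(mem_desc _ _ cQ)[cS _ _] := Ss.
rewrite -intZ//; apply: int_eq => x Sx.
by rewrite (pt_inj_child cQ Ss Sx) mulrC.
Qed.

Lemma int_haar_child Q S j : cube Q -> S \in desc 1 Q ->
  \int[mu]_(x in S) h Q j x = h Q j (pt S) * w S.
Proof.
move=> cQ Ss; have /(mem_desc _ _ cQ)[cS _ _] := Ss.
rewrite -int_cst//; apply: int_eq => x Sx; exact: pt_inj_child.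
Qed.

Lemma haar_orth Q i j : cube Q ->
  \sum_(S <- desc 1 Q) w S * (h Q i (pt S) * h Q j (pt S)) = (i == j)%:R.
Proof.
move=> cQ; have [_ _ _ [_ orth _]] := hh.
have -> : (i == j)%:R = ((Q, i) == (Q, j))%:R :> R by rewrite xpair_eqE eqxx.
rewrite -(orth (Q, i) (Q, j) cQ cQ)/= pairingE//; last exact/bdd_meas_loc_int/haar_bdd_meas.
rewrite big_seq [RHS]big_seq; apply: eq_bigr => S Ss.
by rewrite int_haar_child//; ring.
Qed.

Lemma haar_mean0 Q j : cube Q -> \int[mu]_(x in Q) h Q j x = 0.
Proof.
move=> cQ; have [_ _ h1 _] := hh; rewrite -(h1 Q j cQ) (@int_setT Q)//.
by move=> x; exact: haar_out.
Qed.

Lemma haar_cancel Q j : cube Q -> \sum_(S <- desc 1 Q) w S * h Q j (pt S) = 0.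
Proof.
move=> cQ; rewrite -[RHS](haar_mean0 j cQ) (int_desc 1 cQ); last exact/bdd_meas_loc_int/haar_bdd_meas.
rewrite big_seq [RHS]big_seq; apply: eq_bigr => S Ss.
by rewrite int_haar_child// mulrC.
Qed.

Lemma int_haar_sup Q S j : cube Q -> cube S -> gen S <= gen Q ->
  \int[mu]_(x in S) h Q j x = 0.
Proof.
move=> cQ cS SQ; have [[x [Qx Sx]]|dj] := pselect (Q `&` S !=set0).
  have QS := cube_nested cQ cS Qx Sx SQ.
  rewrite -(haar_mean0 j cQ) -[RHS](@int_setT Q); last by move=> y; exact: haar_out.
  by rewrite (@int_setT S)// => y nSy; apply: haar_out => // /QS.
rewrite -[RHS](mul0r (w S)) -int_cst//; apply: int_eq => x Sx.
by apply: haar_out => // Qx; apply: dj; exists x.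
Qed.

Lemma haar_sub Q S j : cube Q -> cube S -> S `<=` Q -> gen Q < gen S ->
  exists c, forall x, S x -> h Q j x = c.
Proof.
move=> cQ cS SQ gQS.
have Qp : Q (pt S) by apply: SQ; exact: pt_mem.
have ds := desc_mem 1 cQ Qp.
exists (h Q j (pt (dcube (gen Q + 1%:Z) (pt S)))) => x Sx.
apply: pt_inj_child => //.
apply: (@cube_nested S _ (pt S)) => //; first exact: pt_mem.
by rewrite gen_dcube; lia.
Qed.

Lemma haar_L2 Q j : cube Q -> h Q j \in Lfun mu 2%:E.
Proof. by move=> cQ; have [_ _ _ [h2 _ _]] := hh; exact: (h2 (Q, j) cQ). Qed.

Lemma Lnorm2_sqr (g : Rn -> R) :
  ('N[mu]_2%:E[EFin \o g] `^ 2 = \int[mu]_x (`|g x| ^+ 2)%:E)%E.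
Proof.
rewrite poweR_Lnorm ?pnatr_eq0//; apply: eq_integral => x _ /=.
by rewrite powR_mulrn.
Qed.

Lemma Lnorm2_lt_int (g : Rn -> R) (e : R) : 0 <= e ->
  ('N[mu]_2%:E[EFin \o g] <= e%:E)%E -> (\int[mu]_x (`|g x| ^+ 2)%:E <= (e ^+ 2)%:E)%E.
Proof.
move=> e0 hle; rewrite -Lnorm2_sqr -[(e ^+ 2)%R]powR_mulrn// -poweR_EFin.
by apply: gt0_ler_poweR => //; rewrite in_itv/= leey andbT ?Lnorm_ge0 ?lee_fin.
Qed.

Lemma Lfun2P (f : Rn -> R) : f \in Lfun mu 2%:E <->
  measurable_fun setT f /\ (\int[mu]_x (`|f x| ^+ 2)%:E < +oo)%E.
Proof.
rewrite inE; split=> [/andP[/[!inE]/= mf lf]|[mf lf]].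
  by split => //; rewrite -Lnorm2_sqr; exact: poweR_lty.
apply/andP; split; rewrite inE//= /finite_norm.
by apply: (@lty_poweRy _ _ 2); rewrite ?pnatr_eq0// Lnorm2_sqr.
Qed.

Definition coef (f : Rn -> R) Q (j : J) : R := pairing mu f (h Q j).
Definition hsum (a : set Rn -> J -> R) Q (x : Rn) : R := \sum_j a Q j * h Q j x.

(** Cubes have positive measure, so an arbitrarily small L^2 norm forces a pointwise value; the
    threshold is half the mass that c would contribute on S. *)
Lemma Lnorm2_small_eq0 (g : Rn -> R) S (c : R) : cube S -> measurable_fun setT g ->
  (forall e : R, 0 < e -> ('N[mu]_2%:E[EFin \o g] < e%:E)%E) ->
  (forall x, S x -> g x = c) -> c = 0.
Proof.
move=> cS mg hg gc; apply/eqP; apply: contraT => c0.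
have e0 : 0 < `|c| * Num.sqrt (w S / 2).
  by rewrite mulr_gt0 ?normr_gt0// sqrtr_gt0 divr_gt0// w_gt0.
have := Lnorm2_lt_int (ltW e0) (ltW (hg _ e0)).
rewrite exprMn sqr_sqrtr ?divr_ge0//; last exact/ltW/w_gt0.
rewrite leNgt => /negP; case.
apply: (@lt_le_trans _ _ (\int[mu]_(x in S) (`|g x| ^+ 2)%:E)%E); last first.
  apply: ge0_subset_integral => //; first exact: cube_measurable.
  by apply/measurable_EFinP; apply: measurable_funX; exact: measurableT_comp.
have -> : (\int[mu]_(x in S) (`|g x| ^+ 2)%:E = \int[mu]_(x in S) (`|c| ^+ 2)%:E)%E.
  by apply: eq_integral => x /set_mem Sx; rewrite gc.
rewrite integral_cst; last exact: cube_measurable.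
rewrite -wE// -EFinM lte_fin ltr_pM2l ?exprn_gt0 ?normr_gt0//.
by have := w_gt0 cS; lra.
Qed.

(** Completeness of the Haar system enters here. The function [phi] = 1_S / mu(S) - 1_Q / mu(Q) is
    orthogonal to all Haar functions except those of Q, against which it gives the values on S. Its
    expansion is therefore a finite sum, and the identity is read off on S'. *)
Lemma haar_kernel Q S S' : cube Q -> S \in desc 1 Q -> S' \in desc 1 Q ->
  \sum_j h Q j (pt S) * h Q j (pt S') = (S == S')%:R / w S - (w Q)^-1.
Proof.
move=> cQ Ss S's; have /(mem_desc _ _ cQ)[cS gS SQ] := Ss.
have /(mem_desc _ _ cQ)[cS' gS' S'Q] := S's.
pose phi x : R := (w S)^-1 * \1_S x - (w Q)^-1 * \1_Q x.
have mS := cube_measurable cS; have mQ := cube_measurable cQ.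
have phiB : bdd_meas phi.
  rewrite /phi; apply: bdd_meas_add; first by apply: bdd_meas_mul; [exact: bdd_meas_cst|exact: bdd_meas_indic].
  under eq_fun do rewrite -mulNr.
  by apply: bdd_meas_mul; [exact: bdd_meas_cst|exact: bdd_meas_indic].
have phi0 x : ~ Q x -> phi x = 0.
  by move=> nQx; rewrite /phi !indicE !memNset ?mulr0 ?subr0// => /SQ.
have phi2 : phi \in Lfun mu 2%:E.
  have [mphi [C phiC]] := phiB; apply/Lfun2P; split => //.
  apply: (@le_lt_trans _ _ (\int[mu]_(x in Q) (C ^+ 2)%:E)%E); last first.
    by rewrite integral_cst// lte_mul_pinfty ?lee_fin ?exprn_even_ge0// mu_lty.
  rewrite [leRHS]integral_mkcond; apply: ge0_le_integral => //=.
  - by apply/measurable_EFinP; apply: measurable_funX; exact: measurableT_comp.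
  - by apply/(measurable_restrictT _ _).1 => //; exact: measurable_cst.
  move=> x _; rewrite patchE; case: ifPn => [_|/negP nQ].
    by rewrite lee_fin ler_pXn2r// ?nnegrE// (le_trans _ (phiC x)).
  by rewrite phi0 ?normr0 ?expr0n// => Qx; apply: nQ; exact: mem_set.
have pphi Q' j : cube Q' -> pairing mu phi (h Q' j) = 
   (w S)^-1 * \int[mu]_(x in S) h Q' j x - (w Q)^-1 * \int[mu]_(x in Q) h Q' j x.
  move=> cQ'; rewrite /pairing (@int_setT Q); last by move=> x nQx; rewrite phi0 ?mul0r.
  have hB := haar_bdd_meas j cQ'.
  have L1 : loc_int (fun x => \1_S x * h Q' j x).
    by apply: loc_int_mul => //; exact/bdd_meas_loc_int/bdd_meas_indic.
  transitivity (\int[mu]_(x in Q) ((w S)^-1 * (\1_S x * h Q' j x) - (w Q)^-1 * h Q' j x)).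
    apply: int_eq => x Qx; rewrite /phi [\1_Q x]indicE mem_set//=; ring.
  rewrite intB//; [|exact: loc_int_scale|exact/loc_int_scale/bdd_meas_loc_int].
  rewrite intZ// intZ//; last exact: bdd_meas_loc_int.
  congr (_ * _ - _).
  rewrite -(@int_setT Q); last by move=> x nQx; rewrite indicE memNset ?mul0r// => /SQ.
  rewrite (@int_setT S); last by move=> x nSx; rewrite indicE memNset ?mul0r.
  by apply: int_eq => x Sx; rewrite indicE mem_set// mul1r.
have pQ j : pairing mu phi (h Q j) = h Q j (pt S).
  rewrite pphi// haar_mean0// mulr0 subr0 int_haar_child// mulrC -mulrA divff ?mulr1//.
  by rewrite gt_eqF// w_gt0.
(* Finer Haar functions have integral zero over S and over Q, the others of the same generation
   vanish on Q, and coarser ones are constant on Q, where [phi] has mean zero. *)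
have pnQ Q' j : cube Q' -> Q' != Q -> pairing mu phi (h Q' j) = 0.
  move=> cQ' Q'Q; rewrite pphi//.
  have [gQ'|gQ'] := ltP (gen Q') (gen Q); last first.
    rewrite (int_haar_sup _ cQ' cQ)// mulr0 subr0.
    have [gQ''|gQ''] := ltP (gen Q) (gen Q').
      by rewrite int_haar_sup ?mulr0// gS; lia.
    rewrite -[RHS](mulr0 (w S)^-1); congr (_ * _).
    rewrite -[RHS](mul0r (w S)) -int_cst//; apply: int_eq => x Sx.
    apply: haar_out => // Q'x; move/eqP: Q'Q; apply.
    have ge : gen Q' = gen Q by lia.
    by apply: (@gen_inj (gen Q) _ _ x) => //; [rewrite -ge; exact: cube_gen|exact: cube_gen|exact: SQ].
  have [QQ'|dj] := pselect (exists2 x, Q x & Q' x).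
    have [x Qx Q'x] := QQ'.
    have QsQ' := cube_nested cQ cQ' Qx Q'x (ltW gQ').
    have [c hc] := haar_sub j cQ' cQ QsQ' gQ'.
    rewrite (@int_eq S _ (fun=> c)); last by move=> y /SQ; exact: hc.
    rewrite (@int_eq Q _ (fun=> c)) // !int_cst//.
    by rewrite mulrCA mulVf ?gt_eqF ?w_gt0// mulrCA mulVf ?gt_eqF ?w_gt0// subrr.
  have z P : cube P -> P `<=` Q -> \int[mu]_(x in P) h Q' j x = 0.
    move=> cP PQ; rewrite -[RHS](mul0r (w P)) -int_cst//; apply: int_eq => x Px.
    by apply: haar_out => // Q'x; apply: dj; exists x => //; exact: PQ.
  by rewrite !z// !mulr0 subr0.
pose psi x := phi x - \sum_j h Q j (pt S) * h Q j x.
have psiM : measurable_fun setT psi.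
  apply: measurable_funB; first by case: phiB.
  by apply: measurable_sum => j; apply: measurable_funM => //; case: (haar_bdd_meas j cQ).
have psie e : 0 < e -> ('N[mu]_2%:E[EFin \o psi] < e%:E)%E.
  move=> e0; have [_ _ _ [_ _ hx]] := hh; have [J0 [fJ0 sJ0 hJ0]] := hx phi phi2 e e0.
  (* With all indices over Q adjoined, the finite partial sum is already the whole expansion of
     [phi]. *)
  pose J1 := J0 `|` [set p : set Rn * J | p.1 = Q].
  have fJ1 : finite_set J1.
    rewrite finite_setU; split => //.
    apply: (@sub_finite_set _ _ ((fun j => (Q, j)) @` [set: J])).
      by move=> [Q' j] /= ->; exists j.
    exact/finite_image/finite_finset.
  have := hJ0 J1 fJ1 (@subsetUl _ _ _).
  have J1c : J1 `<=` [set p | cube p.1] by move=> p [/sJ0//|/= ->].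
  move=> /(_ J1c); congr (Lnorm mu 2%:E _ < _)%E; apply/funext => x /=; congr EFin.
  rewrite /psi; congr (_ - _).
  rewrite (fsbigID [set p : set Rn * J | p.1 = Q])//= [X in _ + X]fsbig1 ?addr0; last first.
    by move=> p [/J1c cp /eqP pQ']; rewrite pnQ ?mul0r.
  have -> : J1 `&` [set p | p.1 = Q] = (fun j => (Q, j)) @` [set: J].
    by apply/seteqP; split => [[Q' j] [_ /= ->]|_ [j _ <-]]; [exists j|split => //; right].
  rewrite (@reindex_fsbig _ _ _ _ _ (pair Q) setT)/=; last by apply: inj_bij => a b _ _ [].
  rewrite (_ : [set: J] = [set` index_enum J]); last first.
    by apply/seteqP; split => // j _ /=; rewrite mem_index_enum.
  rewrite -fsbig_seq ?index_enum_uniq//; apply: eq_bigr => j _; by rewrite pQ.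
have := @Lnorm2_small_eq0 psi S' ((S == S')%:R / w S - (w Q)^-1 - \sum_j h Q j (pt S) * h Q j (pt S')) cS' psiM psie.
move=> H; apply/eqP; rewrite eq_sym -subr_eq0; apply/eqP; apply: H => x S'x.
rewrite /psi /phi; congr (_ - _ - _).
- rewrite mulrC; congr (_ / _).
  rewrite indicE; congr (nat_of_bool _)%:R; apply/idP/eqP => [/set_mem h1|->].
    exact: (desc_disj cQ Ss S's h1 S'x).
  exact/mem_set.
- by rewrite indicE mem_set ?mulr1//; exact: S'Q.
- by apply: eq_bigr => j _; rewrite (pt_inj_child cQ S's S'x).
Qed.

Lemma hsum_child a Q S x : cube Q -> S \in desc 1 Q -> S x -> hsum a Q x = hsum a Q (pt S).
Proof.
by move=> cQ Ss Sx; apply: eq_bigr => j _; rewrite (pt_inj_child cQ Ss Sx).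
Qed.

Lemma hsum_out a Q x : cube Q -> ~ Q x -> hsum a Q x = 0.
Proof. by move=> cQ nQx; rewrite /hsum big1// => j _; rewrite haar_out ?mulr0. Qed.

Lemma hsum_bdd_meas a Q : cube Q -> bdd_meas (hsum a Q).
Proof.
move=> cQ; apply: bdd_meas_sum => j _; apply: bdd_meas_mul; [exact: bdd_meas_cst|exact: haar_bdd_meas].
Qed.

(** The kernel formula turns Haar terms into martingale differences, so their sum over j does not
    depend on the choice of the Haar functions on Q. *)
Lemma hsum_coef f Q S : cube Q -> loc_int f -> S \in desc 1 Q ->
  hsum (coef f) Q (pt S) = average mu f S - average mu f Q.
Proof.
move=> cQ fL Ss; rewrite /hsum.
under eq_bigr => j _ do rewrite /coef pairingE// mulr_suml.
rewrite exchange_big/=.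
rewrite (eq_big_seq (fun S' => (S' == S)%:R / w S * \int[mu]_(x in S') f x -
   (w Q)^-1 * \int[mu]_(x in S') f x)); last first.
  move=> S' S's; rewrite -mulrBl.
  have -> : (S' == S)%:R / w S = (S' == S)%:R / w S'.
    by case: eqVneq => [->//|_]; rewrite !mul0r.
  by rewrite -(haar_kernel cQ S's Ss) mulr_suml; apply: eq_bigr => j _; ring.
rewrite big_split/= sumrN -mulr_sumr -int_desc//; congr (_ - _).
rewrite (bigD1_seq _ Ss (desc_uniq _ _))/= eqxx mul1r big1 ?addr0//.
by move=> S' /negbTE ->; rewrite mul0r mul0r.
Qed.

Lemma avg_mul f Q : cube Q -> \int[mu]_(x in Q) f x = average mu f Q * w Q.
Proof. by move=> cQ; rewrite /average mulrAC mulVf ?mul1r// gt_eqF// w_gt0. Qed.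

Definition dot (a b : set Rn -> J -> R) Q : R := \sum_j a Q j * b Q j.

(** Parseval's identity on a single cube. *)
Lemma dot_hsum a b Q : cube Q ->
  dot a b Q = \sum_(S <- desc 1 Q) w S * (hsum a Q (pt S) * hsum b Q (pt S)).
Proof.
move=> cQ.
rewrite (eq_bigr (fun S => \sum_i \sum_j (a Q i * b Q j) * (w S * (h Q i (pt S) * h Q j (pt S))))); last first.
  move=> S _; rewrite /hsum mulr_suml mulr_sumr; apply: eq_bigr => i _.
  by rewrite mulr_sumr mulr_sumr; apply: eq_bigr => j _; ring.
rewrite exchange_big/=; apply: eq_bigr => i _.
rewrite exchange_big/= (bigD1 i)//= -mulr_sumr haar_orth// eqxx mulr1 big1 ?addr0//.
by move=> j ji; rewrite -mulr_sumr haar_orth// eq_sym (negbTE ji) mulr0.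
Qed.

Lemma hsum_mean0 a Q : cube Q -> \sum_(S <- desc 1 Q) w S * hsum a Q (pt S) = 0.
Proof.
move=> cQ; under eq_bigr do rewrite mulr_sumr.
rewrite exchange_big/= big1// => j _.
rewrite (eq_bigr (fun S => a Q j * (w S * h Q j (pt S)))); last by move=> S _; ring.
by rewrite -mulr_sumr haar_cancel// mulr0.
Qed.

(** Variance identity: the cross terms vanish because the martingale difference has mean zero. The
    arbitrary centre c is what the induction for [john_nirenberg] uses. *)
Lemma dot_coef f Q : cube Q -> loc_int f -> forall c : R,
  dot (coef f) (coef f) Q = \sum_(S <- desc 1 Q) w S * (average mu f S - c) ^+ 2
     - w Q * (average mu f Q - c) ^+ 2.
Proof.
move=> cQ fL c; rewrite dot_hsum//.
have h0 : \sum_(S <- desc 1 Q) w S * (average mu f S - average mu f Q) = 0.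
  rewrite -[RHS](hsum_mean0 (coef f) cQ); apply: eq_big_seq => S Ss.
  by rewrite hsum_coef.
rewrite (w_desc 1 cQ) mulr_suml -sumrB.
have {}h0 := congr1 (fun t => 2 * (average mu f Q - c) * t) h0.
rewrite mulr0 mulr_sumr in h0.
rewrite -[RHS]subr0 -[X in _ = _ - X]h0 -sumrB.
apply: eq_big_seq => S Ss; rewrite hsum_coef//; ring.
Qed.

(** * Fefferman's inequality *)

Fixpoint tree (m : nat) Q : seq (set Rn) :=
  if m is m'.+1 then Q :: flatten (map (tree m') (desc 1 Q)) else [::].

Lemma big_tree m Q (F : set Rn -> R) :
  \sum_(P <- tree m.+1 Q) F P = F Q + \sum_(S <- desc 1 Q) \sum_(P <- tree m S) F P.
Proof. by rewrite /= big_cons big_flatten big_map. Qed.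

Lemma mem_tree m Q P : cube Q ->
  P \in tree m Q <-> [/\ cube P, P `<=` Q & gen P < gen Q + m%:Z].
Proof.
elim: m Q => [|m ih] Q cQ /=.
  split=> [//|[cP PQ]]; have := cube_sub_genE cP cQ PQ; lia.
rewrite inE; split.
  case/orP => [/eqP ->|]; first by split => //; lia.
  move=> /flattenP[_ /mapP[S Ss ->]].
  have /(mem_desc _ _ cQ)[cS gS SQ] := Ss.
  by move=> /(ih _ cS)[cP PS gP]; split => //; [exact: subset_trans PS SQ|lia].
move=> [cP PQ gP]; have gQ := cube_sub_genE cP cQ PQ.
have [gE|gne] := eqVneq (gen P) (gen Q).
  have Pp := pt_mem cP.
  have -> : P = Q; last by rewrite eqxx.
  by apply: (@gen_inj (gen Q) P Q (pt P)); [rewrite -gE; exact: cube_gen|exact: cube_gen| |exact: PQ].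
apply/orP; right; apply/flattenP.
have Sd := desc_mem 1 cQ (PQ _ (pt_mem cP)).
exists (tree m (dcube (gen Q + 1%:Z) (pt P))); first by apply/mapP; eexists; first exact: Sd.
apply/ih => //; split => //; rewrite ?gen_dcube.
  apply: (@cube_nested _ _ (pt P)) => //; first exact: pt_mem.
  rewrite gen_dcube; lia.
lia.
Qed.

Lemma tree_uniq m Q : cube Q -> uniq (tree m Q).
Proof.
elim: m Q => [//|m ih] Q cQ /=; apply/andP; split.
  apply/negP => /flattenP[_ /mapP[S Ss ->]].
  have /(mem_desc _ _ cQ)[cS gS SQ] := Ss.
  by move=> /(mem_tree _ _ cS)[_ /(cube_sub_genE cQ cS)]; lia.
have : forall s, uniq s -> {subset s <= desc 1 Q} -> uniq (flatten (map (tree m) s)).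
  elim=> [//|S s ihs] /= /andP[Sns us] ss.
  have Ss : S \in desc 1 Q by apply: ss; rewrite mem_head.
  have /(mem_desc _ _ cQ)[cS gS SQ] := Ss.
  rewrite cat_uniq ih//= ihs ?andbT//; last by move=> P Ps; apply: ss; rewrite inE Ps orbT.
  apply/hasPn => P /flattenP[_ /mapP[S' S's ->]] Pt; apply/negP => Pt'.
  have S's2 : S' \in desc 1 Q by apply: ss; rewrite inE S's orbT.
  have /(mem_desc _ _ cQ)[cS' _ _] := S's2.
  have [cP PS' _] := (mem_tree _ _ cS').1 Pt.
  have [_ PS _] := (mem_tree _ _ cS).1 Pt'.
  move/negP: Sns; apply.
  by rewrite (desc_disj cQ Ss S's2 (PS _ (pt_mem cP)) (PS' _ (pt_mem cP))).
by apply => //; exact: desc_uniq.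
Qed.

Lemma sum_seq_le (T : eqType) (F : T -> R) (s s' : seq T) : uniq s -> uniq s' ->
  {subset s <= s'} -> (forall i, i \in s' -> 0 <= F i) ->
  \sum_(i <- s) F i <= \sum_(i <- s') F i.
Proof.
move=> us us' ss' F0.
rewrite [leRHS](bigID (mem s))/= [leRHS]addrC -[leLHS]add0r lerD//.
  by rewrite big_seq_cond; apply: sumr_ge0 => i /andP[/F0].
rewrite -[leRHS]big_filter (perm_big [seq x <- s' | x \in s])//.
apply: uniq_perm => //; first exact: filter_uniq.
by move=> i; rewrite mem_filter; case: (boolP (i \in s)) => //= /ss' ->.
Qed.

(** Let s and s' be the two square roots, x = M (s' - s) and z = s b^2 / M. Then (a b)^2 <= 2 x z +
    x^2, which is at most (3x/2 + z/2)^2. Stopping at 3/2 leaves, out of the constant 2 of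
    [fefferman_tree], the M/2 needed there for the Carleson condition. *)
Lemma amgm_sqrt (y a b M : R) : 0 <= y -> 0 < M -> `|b| <= M ->
  `|a * b| <= 3 / 2 * M * (Num.sqrt (y + a ^+ 2) - Num.sqrt y)
     + Num.sqrt y * b ^+ 2 / (2 * M).
Proof.
move=> y0 M0 bM; have ya0 : 0 <= y + a ^+ 2 by rewrite addr_ge0 ?sqr_ge0.
have := sqr_sqrtr y0; have := sqr_sqrtr ya0.
have := sqrtr_ge0 y; have : Num.sqrt y <= Num.sqrt (y + a ^+ 2).
  by rewrite ler_sqrt// lerDl sqr_ge0.
move: (Num.sqrt y) (Num.sqrt (y + a ^+ 2)) => s s' ss' s0 s'2 s2.
have -> : s * b ^+ 2 / (2 * M) = s * (b ^+ 2 / M) / 2 by field; rewrite gt_eqF.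
pose x := M * (s' - s); pose z := s * (b ^+ 2 / M).
have x0 : 0 <= x by rewrite mulr_ge0 ?subr_ge0// ltW.
have z0 : 0 <= z by rewrite mulr_ge0// divr_ge0 ?sqr_ge0// ltW.
have b2 : b ^+ 2 <= M ^+ 2 by rewrite -real_normK ?num_real// ler_pXn2r ?nnegrE// ltW.
have xz : x * z = (s' - s) * s * b ^+ 2 by rewrite /x /z; field; rewrite gt_eqF.
have key : (a * b) ^+ 2 <= 2 * (x * z) + x ^+ 2.
  rewrite exprMn xz /x.
  have -> : a ^+ 2 = (s' - s) * (2 * s) + (s' - s) ^+ 2.
    have -> : a ^+ 2 = s' ^+ 2 - s ^+ 2 by rewrite s'2 s2; ring.
    by ring.
  have : (s' - s) ^+ 2 * b ^+ 2 <= (s' - s) ^+ 2 * M ^+ 2 by rewrite ler_wpM2l ?sqr_ge0.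
  by rewrite exprMn; lra.
have -> : 3 / 2 * M * (s' - s) + z / 2 = 3 / 2 * x + z / 2 by rewrite /x; ring.
rewrite -(@ler_pXn2r _ 2) ?nnegrE//; last by lra.
rewrite real_normK ?num_real//; apply: le_trans key _.
have : 0 <= (x - z / 2) ^+ 2 by rewrite sqr_ge0.
have : 0 <= x ^+ 2 by rewrite sqr_ge0.
have : 0 <= x * z by rewrite mulr_ge0.
by nra.
Qed.

(** A recursive form of the integral in [sqI_int]; y is the square function energy collected on the
    ancestors, which is constant on Q. *)
Fixpoint sqI (a : set Rn -> J -> R) (m : nat) Q (y : R) : R :=
  if m is m'.+1 then \sum_(P <- desc 1 Q) sqI a m' P (y + hsum a Q (pt P) ^+ 2)
  else Num.sqrt y * w Q.

Definition carleson (M : R) (b : set Rn -> J -> R) : Prop :=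
  forall Q m, cube Q -> \sum_(P <- tree m Q) dot b b P <= M ^+ 2 * w Q.

Lemma dot_ge0 b Q : 0 <= dot b b Q.
Proof. by apply: sumr_ge0 => j _; rewrite -expr2 sqr_ge0. Qed.

(** Induction from the top cube down: passing to a child S raises y by the square of the Haar term
    of a on S. The last term remembers how much Carleson mass of b is still to be paired with the
    energy y. *)
Lemma fefferman_tree a b (M : R) : 0 < M -> (forall Q x, cube Q -> `|hsum b Q x| <= M) ->
  carleson M b -> forall m Q (y : R), cube Q -> 0 <= y ->
  \sum_(P <- tree m Q) `|dot a b P| <=
    2 * M * (sqI a m Q y - Num.sqrt y * w Q)
    + Num.sqrt y / (2 * M) * \sum_(P <- tree m Q) dot b b P.
Proof.
move=> M0 bM bC; elim=> [|m ih] Q y cQ y0.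
  by rewrite /= !big_nil subrr !mulr0 addr0.
rewrite !big_tree (dot_hsum _ _ cQ) (dot_hsum _ _ cQ).
apply: (@le_trans _ _ (\sum_(S <- desc 1 Q) (w S * `|hsum a Q (pt S) * hsum b Q (pt S)|
    + \sum_(P <- tree m S) `|dot a b P|))).
  rewrite big_split/= lerD2r; apply: le_trans (ler_norm_sum _ _ _) _.
  rewrite big_seq [leRHS]big_seq; apply: ler_sum => S /(mem_desc _ _ cQ)[cS _ _].
  by rewrite normrM ger0_norm// ltW// w_gt0.
rewrite [sqI a m.+1 Q y]/= (w_desc 1 cQ) mulr_sumr -sumrB mulr_sumr -big_split/= mulr_sumr -big_split/=.
rewrite big_seq [leRHS]big_seq; apply: ler_sum => S Ss.
have /(mem_desc _ _ cQ)[cS _ _] := Ss.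
have w0 := w_gt0 cS.
set aS := hsum a Q (pt S); set bS := hsum b Q (pt S).
have bSM : `|bS| <= M by exact: bM.
have y'0 : 0 <= y + aS ^+ 2 by rewrite addr_ge0 ?sqr_ge0.
have h1 := ih S (y + aS ^+ 2) cS y'0.
have h2 := amgm_sqrt aS y0 M0 bSM.
have h3 := bC S m cS.
have ss' : Num.sqrt y <= Num.sqrt (y + aS ^+ 2) by rewrite ler_sqrt// lerDl sqr_ge0.
move: h1 h3 h2; set tau := \sum_(P <- tree m S) dot b b P.
set X := \sum_(P <- tree m S) `|dot a b P|.
set s' := Num.sqrt (y + aS ^+ 2) in ss' *; set s := Num.sqrt y in ss' *.
set I := sqI _ _ _ _ => h1 h3 h2.
have h2' : w S * `|aS * bS| <= w S * (3 / 2 * M * (s' - s) + s * bS ^+ 2 / (2 * M)).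
  by rewrite ler_pM2l.
(* Replacing s by s' in front of the remaining Carleson mass costs (s' - s) M w(S) / 2 by the
   Carleson condition. Together with the 3/2 M (s' - s) w(S) of [amgm_sqrt] this is 2 M (s' - s)
   w(S), which moves the main term from s to s'. *)
have h3' : (s' - s) / (2 * M) * tau <= (s' - s) / (2 * M) * (M ^+ 2 * w S).
  by rewrite ler_wpM2l// divr_ge0 ?subr_ge0// mulr_ge0// ltW.
have e3 : (s' - s) / (2 * M) * (M ^+ 2 * w S) = (s' - s) * M * w S / 2.
  by field; rewrite gt_eqF.
rewrite e3 in h3'.
have e4 : s' / (2 * M) * tau = s / (2 * M) * tau + (s' - s) / (2 * M) * tau.
  by field; rewrite gt_eqF.
rewrite e4 in h1.
have -> : 2 * M * (I - s * w S) + s / (2 * M) * (w S * (bS * bS) + tau) =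
  w S * (3 / 2 * M * (s' - s) + s * bS ^+ 2 / (2 * M)) +
  (2 * M * (I - s' * w S) + (s / (2 * M) * tau + (s' - s) * M * w S / 2)).
  by field; rewrite gt_eqF.
by apply: lerD => //; apply: le_trans h1 _; rewrite !lerD2l.
Qed.

Definition sqa (a : set Rn -> J -> R) (A : seq (set Rn)) (x : Rn) : R :=
  Num.sqrt (\sum_(P <- A) hsum a P x ^+ 2).

Lemma sum_hsum2_ge0 a A x : 0 <= \sum_(P <- A) hsum a P x ^+ 2.
Proof. by apply: sumr_ge0 => P _; exact: sqr_ge0. Qed.

Lemma bdd_meas_sqrt f : bdd_meas f -> bdd_meas (fun x => Num.sqrt (f x)).
Proof.
move=> [mf [C fC]]; split.
  apply: (@measurableT_comp _ _ _ _ _ _ (@Num.sqrt R)) => //.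
  by apply: continuous_measurable_fun => x; exact: sqrt_continuous.
exists (C + 1) => x; rewrite ger0_norm ?sqrtr_ge0//.
have C0 : 0 <= C by exact: le_trans (fC x).
apply: (@le_trans _ _ (Num.sqrt C)).
  by rewrite ler_sqrt//; apply: le_trans (fC x); exact: ler_norm.
rewrite -(@ler_pXn2r _ 2) ?nnegrE ?sqrtr_ge0 ?addr_ge0// sqr_sqrtr//; nra.
Qed.

Lemma bdd_meas_sum_hsum2 a A (y : R) : (forall P, P \in A -> cube P) ->
  bdd_meas (fun x => y + \sum_(P <- A) hsum a P x ^+ 2).
Proof.
move=> cA; apply: bdd_meas_add; first exact: bdd_meas_cst.
by apply: bdd_meas_sum => P /cA cP; under eq_fun do rewrite expr2; apply: bdd_meas_mul; exact: hsum_bdd_meas.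
Qed.

Lemma sqa_bdd_meas a A : (forall P, P \in A -> cube P) -> bdd_meas (sqa a A).
Proof.
move=> cA; apply: bdd_meas_sqrt; have := bdd_meas_sum_hsum2 a 0 cA.
by under eq_fun do rewrite add0r.
Qed.

Lemma tree_cube m Q P : cube Q -> P \in tree m Q -> cube P.
Proof. by move=> cQ /(mem_tree _ _ cQ)[]. Qed.

Lemma sqI_int a m Q (y : R) : cube Q -> 0 <= y ->
  sqI a m Q y = \int[mu]_(x in Q) Num.sqrt (y + \sum_(P <- tree m Q) hsum a P x ^+ 2).
Proof.
elim: m Q y => [|m ih] Q y cQ y0 /=.
  rewrite -int_cst//; apply: int_eq => x _; by rewrite big_nil addr0.
rewrite (int_desc 1 cQ); last first.
  by apply/bdd_meas_loc_int/bdd_meas_sqrt/bdd_meas_sum_hsum2 => P; exact: (@tree_cube m.+1).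
apply: eq_big_seq => S Ss; have /(mem_desc _ _ cQ)[cS _ _] := Ss.
rewrite ih//; last by rewrite addr_ge0 ?sqr_ge0.
apply: int_eq => x Sx; congr Num.sqrt.
rewrite big_cons (hsum_child a cQ Ss Sx) addrA; congr (_ + _).
rewrite big_flatten big_map (bigD1_seq _ Ss (desc_uniq _ _))/= [X in _ + X]big1_seq ?addr0//.
move=> S' /andP[S'S S's]; have /(mem_desc _ _ cQ)[cS' _ _] := S's.
rewrite big1_seq// => P /andP[_ /(mem_tree _ _ cS')[cP PS' _]].
rewrite hsum_out ?expr0n// => /PS' S'x; move/eqP: S'S; apply.
exact: (desc_disj cQ S's Ss S'x Sx).
Qed.

(** Cubes from different quadrants have no common ancestor, so a finite family is covered by several
    disjoint trees whose tops share one generation. *)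
Lemma forest (A : seq (set Rn)) : (forall P, P \in A -> cube P) ->
  exists k m (tops : seq (set Rn)), [/\ uniq tops, forall Q, Q \in tops -> D k Q,
    uniq (flatten (map (tree m) tops)) &
    {subset A <= flatten (map (tree m) tops)}].
Proof.
move=> cA.
have [k kA] : exists k : int, forall P, P \in A -> k <= gen P.
  elim: A {cA} => [|P A [k ih]]; first by exists 0.
  exists (Num.min k (gen P)) => Q; rewrite inE => /orP[/eqP ->|/ih]; lia.
have [m mA] : exists m : nat, forall P, P \in A -> gen P < k + m%:Z.
  elim: A {cA kA} => [|P A [m ih]]; first by exists 0.
  exists (m + `|gen P - k|.+1)%N => Q; rewrite inE => /orP[/eqP ->|/ih]; lia.
pose tops := undup [seq dcube k (pt P) | P <- A].
have tD Q : Q \in tops -> D k Q by rewrite mem_undup => /mapP[P _ ->].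
exists k, m, tops; split=> //; first exact: undup_uniq.
  have : forall s, uniq s -> {subset s <= tops} -> uniq (flatten (map (tree m) s)).
    elim=> [//|S s ihs] /= /andP[Sns us] ss.
    have Ss : S \in tops by apply: ss; rewrite mem_head.
    have cS := cubeP (tD _ Ss).
    rewrite cat_uniq tree_uniq//= ihs ?andbT//; last by move=> P Ps; apply: ss; rewrite inE Ps orbT.
    apply/hasPn => P /flattenP[_ /mapP[S' S's ->]] Pt; apply/negP => Pt'.
    have S's2 : S' \in tops by apply: ss; rewrite inE S's orbT.
    have cS' := cubeP (tD _ S's2).
    have [cP PS' _] := (mem_tree _ _ cS').1 Pt.
    have [_ PS _] := (mem_tree _ _ cS).1 Pt'.
    move/negP: Sns; apply.
    by rewrite (gen_inj (tD _ Ss) (tD _ S's2) (PS _ (pt_mem cP)) (PS' _ (pt_mem cP))).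
  by apply => //; exact: undup_uniq.
move=> P PA; apply/flattenP; exists (tree m (dcube k (pt P))).
  by apply: map_f; rewrite mem_undup; apply: map_f.
apply/mem_tree => //; split; [exact: cA| |by rewrite gen_dcube; exact: mA].
apply: (@cube_nested _ _ (pt P)) => //; [exact: cA|exact: pt_mem (cA _ PA)|].
by rewrite gen_dcube; exact: kA.
Qed.

Lemma int_tops k (tops : seq (set Rn)) f : uniq tops -> (forall Q, Q \in tops -> D k Q) ->
  loc_int f -> (forall x, (forall Q, Q \in tops -> ~ Q x) -> f x = 0) ->
  mu.-integrable setT (EFin \o f) /\
  \int[mu]_x f x = \sum_(Q <- tops) \int[mu]_(x in Q) f x.
Proof.
move=> ut tD fL f0.
pose U : set Rn := [set x | exists2 Q, Q \in tops & Q x].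
have f0U x : ~ U x -> f x = 0.
  by move=> nU; apply: f0 => Q Qt Qx; apply: nU; exists Q.
split; last first.
  rewrite (@int_setT U)//; apply: int_cubes => //.
  - by move=> Q Qt; split; [exact: cubeP (tD _ Qt)|move=> x Qx; exists Q].
  - by move=> S S' x St S't; exact: gen_inj (tD _ St) (tD _ S't).
have fE : f = fun x => \sum_(Q <- tops) f x * \1_Q x.
  apply/funext => x; have [[Q Qt Qx]|nU] := pselect (U x); last first.
    by rewrite f0U// big1// => Q _; rewrite mul0r.
  rewrite (bigD1_seq _ Qt ut)/= indicE mem_set// mulr1 big1_seq ?addr0// => Q' /andP[Q'Q Q't].
  rewrite indicE memNset ?mulr0// => Q'x; move/eqP: Q'Q; apply.
  exact: gen_inj (tD _ Q't) (tD _ Qt) Q'x Qx.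
rewrite fE.
have -> : EFin \o (fun x => \sum_(Q <- tops) f x * \1_Q x) =
   (fun x => \sum_(Q <- tops) (if Q \in tops then f x * \1_Q x else 0)%:E)%E.
  apply/funext => x /=; rewrite sumEFin; congr EFin.
  by apply: eq_big_seq => Q ->.
apply: integrable_sum => // Q _; have [Qt|_] := boolP (Q \in tops); last exact: integrable0.
have cQ := cubeP (tD _ Qt); have mQ := cube_measurable cQ.
have /(integrable_mkcond _ mQ).1 := fL.2 Q cQ.
apply: eq_integrable => // x _; rewrite patchE indicE.
by case: (x \in Q); rewrite /= ?mulr1 ?mulr0.
Qed.

Definition terms_bounded (M : R) (b : set Rn -> J -> R) : Prop :=
  forall Q x, cube Q -> `|hsum b Q x| <= M.

Lemma sqa_out a A x : (forall P, P \in A -> cube P) ->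
  (forall P, P \in A -> ~ P x) -> sqa a A x = 0.
Proof.
move=> cA nA; rewrite /sqa big1_seq ?sqrtr0// => P /andP[_ PA].
by rewrite hsum_out ?expr0n//; [exact: cA|exact: nA].
Qed.

Lemma fefferman a b (M : R) A : 0 < M -> terms_bounded M b -> carleson M b ->
  uniq A -> (forall P, P \in A -> cube P) ->
  mu.-integrable setT (EFin \o sqa a A) /\
  `|\sum_(P <- A) dot a b P| <= 2 * M * \int[mu]_x sqa a A x.
Proof.
move=> M0 lb cb uA cA; have [k [m [tops [ut tD uF AF]]]] := forest cA.
have sq0 x : (forall Q, Q \in tops -> ~ Q x) -> sqa a A x = 0.
  move=> nt; apply: sqa_out => // P /AF/flattenP[_ /mapP[Q Qt ->]].
  by move=> /(mem_tree _ _ (cubeP (tD _ Qt)))[_ + _]; move=> /(_ x) PQ /PQ; exact: nt.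
have [sI sE] := int_tops ut tD (bdd_meas_loc_int (sqa_bdd_meas a cA)) sq0.
split => //; rewrite sE.
(* Setting a to zero off A allows sums over whole trees; on each top cube the induction starts with
   y = 0, which removes the Carleson term. *)
pose a' P j := if P \in A then a P j else 0.
have da' P : `|dot a' b P| = if P \in A then `|dot a b P| else 0.
  rewrite /dot /a'; case: ifP => // _; rewrite big1 ?normr0// => j _; by rewrite mul0r.
have hs' P x : hsum a' P x = if P \in A then hsum a P x else 0.
  rewrite /hsum /a'; case: ifP => // _; rewrite big1// => j _; by rewrite mul0r.
apply: le_trans (ler_norm_sum _ _ _) _.
have -> : \sum_(P <- A) `|dot a b P| = \sum_(P <- flatten (map (tree m) tops)) `|dot a' b P|.
  rewrite [RHS](eq_bigr (fun P => if P \in A then `|dot a b P| else 0)); last by move=> P _; exact: da'.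
  rewrite -big_mkcond/= -[RHS]big_filter; apply: perm_big; apply: uniq_perm => //.
    exact: filter_uniq.
  by move=> P; rewrite mem_filter; case: (boolP (P \in A)) => //= /AF ->.
rewrite big_flatten big_map mulr_sumr big_seq [leRHS]big_seq; apply: ler_sum => Q Qt.
have cQ := cubeP (tD _ Qt).
apply: le_trans (fefferman_tree a' M0 lb cb m cQ (lexx 0)) _.
rewrite sqrtr0 !mul0r addr0 subr0 sqI_int//.
rewrite ler_pM2l ?mulr_gt0//; apply: int_le => //.
- by apply/bdd_meas_loc_int/bdd_meas_sqrt/bdd_meas_sum_hsum2 => P; exact: tree_cube.
- exact/bdd_meas_loc_int/sqa_bdd_meas.
move=> x Qx; rewrite add0r ler_sqrt ?sum_hsum2_ge0//.
rewrite [leLHS](eq_bigr (fun P => if P \in A then hsum a P x ^+ 2 else 0)); last first.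
  by move=> P _; rewrite hs'; case: ifP => // _; rewrite expr0n.
rewrite -big_mkcond/= -[leLHS]big_filter; apply: sum_seq_le => //.
- by apply: filter_uniq; exact: tree_uniq.
- by move=> P; rewrite mem_filter => /andP[].
- by move=> P _; exact: sqr_ge0.
Qed.

(** The essential supremum sees every value taken on a whole cube, because cubes are not null
    sets. *)
Lemma Lnorm_ge_at (f : Rn -> R) S c : cube S -> (forall x, S x -> f x = c) ->
  (`|c|%:E <= 'N[mu]_+oo%E[EFin \o f])%E.
Proof.
move=> cS fc; rewrite unlock.
have muS : (0 < mu setT)%E.
  apply: lt_le_trans (mu_gt0 cS) _; apply: le_measure; rewrite ?inE//; exact: cube_measurable.
rewrite muS leNgt; apply/negP => lt.
have [N [mN N0 sN]] := ess_sup_ge mu (abse \o (EFin \o f)).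
have : (mu S <= mu N)%E.
  apply: le_measure; rewrite ?inE//; first exact: cube_measurable.
  move=> x Sx; apply: sN => /= H; move: lt; rewrite ltNge => /negP; apply.
  by move: H; rewrite fc.
by rewrite N0 leNgt mu_gt0.
Qed.

Lemma haar_L1 Q j : cube Q ->
  ('N[mu]_1%:E[EFin \o h Q j] = (\int[mu]_(x in Q) `|h Q j x|)%:E)%E.
Proof.
move=> cQ; rewrite Lnorm1 -(@int_setT Q); last by move=> x nQ; rewrite haar_out ?normr0.
rewrite /Rintegral fineK//; apply: integrable_fin_num => //.
have := fun H => (@int_tops (gen Q) [:: Q] (fun x => `|h Q j x|) isT H (loc_int_norm (bdd_meas_loc_int (haar_bdd_meas j cQ)))).
case=> //.
- by move=> P; rewrite inE => /eqP ->; exact: cube_gen.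
- by move=> x /(_ Q (mem_head _ _)) nQ; rewrite haar_out ?normr0.
Qed.

Lemma haar_L1E Q j : cube Q ->
  \int[mu]_(x in Q) `|h Q j x| = \sum_(S <- desc 1 Q) w S * `|h Q j (pt S)|.
Proof.
move=> cQ; rewrite (int_desc 1 cQ); last exact/loc_int_norm/bdd_meas_loc_int/haar_bdd_meas.
apply: eq_big_seq => S Ss; have /(mem_desc _ _ cQ)[cS _ _] := Ss.
rewrite mulrC -int_cst//; apply: int_eq => x Sx; by rewrite (pt_inj_child cQ Ss Sx).
Qed.

(** Since the L^2 norm is 1, the L^1 norm times the supremum is at least 1. If N |h| < 1 everywhere,
    with N the L^1 norm, then |h| (1 - N |h|) is nonnegative with integral N - N = 0, so h vanishes,
    a contradiction. *)
Lemma haar_L1_peak Q j : cube Q -> exists x0, 1 <= \int[mu]_(x in Q) `|h Q j x| * `|h Q j x0|.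
Proof.
move=> cQ; apply: contrapT => /forallNP H.
set N := \int[mu]_(x in Q) `|h Q j x| in H *.
have t0 S : S \in desc 1 Q -> 0 <= w S * `|h Q j (pt S)| * (1 - N * `|h Q j (pt S)|).
  move=> Ss; have /(mem_desc _ _ cQ)[cS _ _] := Ss.
  rewrite mulr_ge0// ?mulr_ge0 ?subr_ge0//; first exact/ltW/w_gt0.
  have /negP := H (pt S); rewrite -ltNge; exact: ltW.
have o := haar_orth j j cQ.
have s0 : \sum_(S <- desc 1 Q) w S * `|h Q j (pt S)| * (1 - N * `|h Q j (pt S)|) = 0.
  rewrite (eq_bigr (fun S => w S * `|h Q j (pt S)| - N * (w S * (h Q j (pt S) * h Q j (pt S))))).
    by rewrite sumrB -mulr_sumr o eqxx mulr1 -haar_L1E// subrr.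
  move=> S _; have -> : h Q j (pt S) * h Q j (pt S) = `|h Q j (pt S)| ^+ 2.
    by rewrite real_normK ?num_real// expr2.
  ring.
move: s0; rewrite big_seq => /eqP; rewrite psumr_eq0 => [/allP al|S Ss]; last exact: t0.
move: o; rewrite eqxx big1_seq => [/eqP|S /andP[_ Ss]]; first by rewrite eq_sym oner_eq0.
have /(mem_desc _ _ cQ)[cS _ _] := Ss.
have := al S Ss; rewrite Ss/= !mulf_eq0 gt_eqF ?w_gt0//= normr_eq0.
case/orP => [/eqP ->|]; first by rewrite !mulr0.
have /negP := H (pt S); rewrite -ltNge subr_eq0 => lt1 /eqP e1.
by move: lt1; rewrite -e1 ltxx.
Qed.

(** * Balance and shifted coefficients *)

Context (hbal : balanced D mu h).

Lemma balanced_bound : exists2 C : R, 0 < C & forall Q S j j' x, cube Q -> S \in desc 1 Q ->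
  \int[mu]_(x in Q) `|h Q j x| * `|h S j' x| <= C /\
  `|h Q j x| * \int[mu]_(x in S) `|h S j' x| <= C.
Proof.
move: hbal; rewrite /balanced; set B := ereal_sup _ => Blt.
exists (Num.max 1 (fine B)) => [|Q S j j' x cQ Ss]; first by rewrite lt_max ltr01.
have /(mem_desc _ _ cQ)[cS _ _] := Ss.
have N0 P i : 0 <= \int[mu]_(x in P) `|h P i x| by apply: Rintegral_ge0.
have tB : ('N[mu]_1%:E[EFin \o h Q j] * 'N[mu]_+oo%E[EFin \o h S j'] +
   'N[mu]_+oo%E[EFin \o h Q j] * 'N[mu]_1%:E[EFin \o h S j'] <= B)%E.
  apply: ereal_sup_ubound; exists Q, S, j, j'; split => //.
  by apply/(descendantsP _ _ cQ); apply/(mem_desc _ _ cQ).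
have lei P i y : cube P -> (`|h P i y|%:E <= 'N[mu]_+oo%E[EFin \o h P i])%E.
  move=> cP; have [Py|nPy] := pselect (P y); last first.
    by rewrite haar_out// normr0 Lnorm_ge0.
  have ds := desc_mem 1 cP Py.
  apply: (@Lnorm_ge_at _ (dcube (gen P + 1%:Z) y)) => // z hz.
  by rewrite (pt_inj_child cP ds hz) (pt_inj_child cP ds (dcube_mem _ _)).
have fB c : (0 <= c%:E)%E -> (c%:E <= B)%E -> c <= Num.max 1 (fine B).
  move=> c0 cB; rewrite le_max; apply/orP; right.
  by rewrite -lee_fin fineK// ge0_fin_numE// (le_trans c0 cB).
split; apply: fB; rewrite ?lee_fin ?mulr_ge0//; apply: le_trans tB.
- rewrite -[leLHS]adde0 leeD// ?mule_ge0 ?Lnorm_ge0//.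
  rewrite haar_L1// EFinM; apply: lee_wpmul2l; [by rewrite lee_fin N0|exact: lei].
- rewrite -[leLHS]add0e leeD// ?mule_ge0 ?Lnorm_ge0//.
  rewrite haar_L1// EFinM; apply: lee_wpmul2r; [by rewrite lee_fin N0|exact: lei].
Qed.

Lemma J_gt0 : (0 < (2 ^ n).-1)%N.
Proof. by rewrite -subn1 subn_gt0 -{1}(expn0 2) ltn_exp2l. Qed.

(* sigma Q = ||h_Q||_1 is comparable to ||h_Q^j||_1 and to 1 / ||h_Q^j||_oo
   for every j. *)
Definition sigma Q : R := \int[mu]_(x in Q) `|h Q (Ordinal J_gt0) x|.

Lemma desc_neq0 i Q : cube Q -> exists S, S \in desc i Q.
Proof. by move=> cQ; eexists; exact: desc_mem cQ (pt_mem cQ). Qed.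

Lemma sigma_gt0 Q : cube Q -> 0 < sigma Q.
Proof.
move=> cQ; rewrite lt0r Rintegral_ge0// andbT; apply/eqP => s0.
by have [x] := haar_L1_peak (Ordinal J_gt0) cQ; rewrite -/(sigma Q) s0 mul0r; lra.
Qed.

(** Cauchy-Schwarz with the normalization of h_Q in L^2, written as nonnegativity of the variance of
    |h_Q|. *)
Lemma sigma_sqr Q : cube Q -> sigma Q ^+ 2 <= w Q.
Proof.
move=> cQ; have o := haar_orth (Ordinal J_gt0) (Ordinal J_gt0) cQ.
have w0 := w_gt0 cQ.
have : 0 <= \sum_(S <- desc 1 Q) w S * (`|h Q (Ordinal J_gt0) (pt S)| - sigma Q / w Q) ^+ 2.
  rewrite big_seq; apply: sumr_ge0 => S /(mem_desc _ _ cQ)[cS _ _].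
  by rewrite mulr_ge0 ?sqr_ge0// ltW// w_gt0.
have -> : \sum_(S <- desc 1 Q) w S * (`|h Q (Ordinal J_gt0) (pt S)| - sigma Q / w Q) ^+ 2 =
  1 - 2 * (sigma Q / w Q) * sigma Q + (sigma Q / w Q) ^+ 2 * w Q.
  rewrite (eq_bigr (fun S => w S * (h Q (Ordinal J_gt0) (pt S) * h Q (Ordinal J_gt0) (pt S))
     - 2 * (sigma Q / w Q) * (w S * `|h Q (Ordinal J_gt0) (pt S)|) + (sigma Q / w Q) ^+ 2 * w S)).
    by rewrite big_split/= sumrB -!mulr_sumr o eqxx -haar_L1E// -w_desc.
  move=> S _; have -> : h Q (Ordinal J_gt0) (pt S) * h Q (Ordinal J_gt0) (pt S) = `|h Q (Ordinal J_gt0) (pt S)| ^+ 2.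
    by rewrite real_normK ?num_real// expr2.
  ring.
have -> : 1 - 2 * (sigma Q / w Q) * sigma Q + (sigma Q / w Q) ^+ 2 * w Q =
  (w Q - sigma Q ^+ 2) / w Q by field; rewrite gt_eqF.
by rewrite pmulr_lge0 ?invr_gt0// subr_ge0.
Qed.

(** Each bound combines [balanced_bound] with [haar_L1_peak]. For two Haar functions of the same
    cube Q a child S mediates: |h_Q^j| sigma(S) and sigma(Q) |h_S| are at most C while sigma(S)
    |h_S| reaches 1, whence C^2. The constant 1 + C + C^2 covers all cases. *)
Lemma sigma_facts : exists2 K : R, 1 <= K & forall Q, cube Q ->
  [/\ forall j x, `|h Q j x| * sigma Q <= K,
      forall j, \int[mu]_(x in Q) `|h Q j x| <= K * sigma Q &
      forall S, S \in desc 1 Q -> sigma Q <= K * sigma S /\ sigma S <= K * sigma Q].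
Proof.
have [C C0 hC] := balanced_bound.
exists (1 + C + C ^+ 2) => [|Q cQ]; first by rewrite -addrA lerDl addr_ge0 ?sqr_ge0// ltW.
have C2 : 0 <= C ^+ 2 by exact: sqr_ge0.
pose j0 := Ordinal J_gt0.
have sQ := sigma_gt0 cQ.
have [x1 hx1] := haar_L1_peak j0 cQ; rewrite -/(sigma Q) in hx1.
have [S Ss] := desc_neq0 1 cQ.
have /(mem_desc _ _ cQ)[cS _ _] := Ss.
have sS := sigma_gt0 cS.
have [x0 hx0] := haar_L1_peak j0 cS; rewrite -/(sigma S) in hx0.
split.
- move=> j x; apply: (@le_trans _ _ (C * C)); last by rewrite -expr2; lra.
  have [_ h1] := hC Q S j j0 x cQ Ss; have [h2 _] := hC Q S j0 j0 x0 cQ Ss.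
  rewrite -/(sigma S) in h1; rewrite -/(sigma Q) in h2.
  apply: (@le_trans _ _ ((`|h Q j x| * sigma S) * (sigma Q * `|h S j0 x0|))).
    have -> : (`|h Q j x| * sigma S) * (sigma Q * `|h S j0 x0|) =
       (`|h Q j x| * sigma Q) * (sigma S * `|h S j0 x0|) by ring.
    by rewrite ler_peMr// mulr_ge0// ltW.
  by apply: ler_pM => //; rewrite mulr_ge0// ltW.
- move=> j.
  have [h1 _] := hC Q S j j0 x0 cQ Ss; have [_ h2] := hC Q S j0 j0 x1 cQ Ss.
  rewrite -/(sigma S) in h2.
  have N0 : 0 <= \int[mu]_(x in Q) `|h Q j x| by apply: Rintegral_ge0.
  set N := \int[mu]_(x in Q) `|h Q j x| in N0 h1 *.
  apply: (@le_trans _ _ ((C * C) * sigma Q)); last by rewrite -expr2 ler_pM2r//; lra.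
  apply: (@le_trans _ _ (((N * `|h S j0 x0|) * (`|h Q j0 x1| * sigma S)) * sigma Q)).
    have -> : ((N * `|h S j0 x0|) * (`|h Q j0 x1| * sigma S)) * sigma Q =
      N * ((sigma S * `|h S j0 x0|) * (sigma Q * `|h Q j0 x1|)) by ring.
    by rewrite ler_peMr// -[1]mulr1 ler_pM.
  by rewrite ler_pM2r//; apply: ler_pM => //; rewrite mulr_ge0// ltW.
move=> P Ps; have /(mem_desc _ _ cQ)[cP _ _] := Ps.
have sP := sigma_gt0 cP.
have [x2 hx2] := haar_L1_peak j0 cP; rewrite -/(sigma P) in hx2.
split.
- have [h1 _] := hC Q P j0 j0 x2 cQ Ps; rewrite -/(sigma Q) in h1.
  apply: (@le_trans _ _ (C * sigma P)); last by rewrite ler_pM2r//; lra.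
  apply: (@le_trans _ _ ((sigma Q * `|h P j0 x2|) * sigma P)); last by rewrite ler_pM2r.
  by rewrite -mulrA [_ * sigma P]mulrC ler_peMr// ltW.
- have [_ h1] := hC Q P j0 j0 x1 cQ Ps; rewrite -/(sigma P) in h1.
  apply: (@le_trans _ _ (C * sigma Q)); last by rewrite ler_pM2r//; lra.
  apply: (@le_trans _ _ ((`|h Q j0 x1| * sigma P) * sigma Q)); last by rewrite ler_pM2r.
  have -> : (`|h Q j0 x1| * sigma P) * sigma Q = sigma P * (sigma Q * `|h Q j0 x1|) by ring.
  by rewrite ler_peMr// ltW.
Qed.

Definition nbr (i j : nat) P : seq (set Rn) := desc j (ancestor D i P).

Lemma nbrP i j P S : cube P -> S \in nbr i j P <-> cube S /\ ancestor D j S = ancestor D i P.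
Proof.
move=> cP; have cA := ancestor_cube i cP; split.
  move=> /(mem_desc _ _ cA)Sd; split; first by case: Sd.
  by apply: ancestor_desc => //; apply/descendantsP.
move=> [cS e]; apply/(mem_desc _ _ cA)/(descendantsP _ _ cA); rewrite -e; exact: desc_ancestor.
Qed.

Lemma nbr_sym i j P S : cube P -> S \in nbr i j P -> P \in nbr j i S.
Proof. by move=> cP /(nbrP _ _ _ cP)[cS e]; apply/nbrP. Qed.

Lemma nbr_cube i j P S : cube P -> S \in nbr i j P -> cube S.
Proof. by move=> cP /(nbrP _ _ _ cP)[]. Qed.

Lemma gen_nbr i j P S : cube P -> S \in nbr i j P -> gen S = gen P - i%:Z + j%:Z.
Proof.
by move=> cP /(mem_desc _ _ (ancestor_cube i cP))[_ -> _]; rewrite gen_ancestor.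
Qed.

Lemma ancestor0 P : cube P -> ancestor D 0 P = P.
Proof. by move=> cP; rewrite (ancestorE 0 cP (pt_mem cP)) subr0 dcube_gen//; exact: pt_mem. Qed.

Lemma ancestorS i P : cube P -> ancestor D i.+1 P = ancestor D 1 (ancestor D i P).
Proof.
move=> cP; have cA := ancestor_cube i cP.
rewrite (ancestorE 1 cA (sub_ancestor i cP (pt_mem cP))) gen_ancestor//.
by rewrite (ancestorE _ cP (pt_mem cP)); congr dcube; lia.
Qed.

Lemma sigma_ancestor K : 1 <= K ->
  (forall Q, cube Q -> forall S, S \in desc 1 Q -> sigma Q <= K * sigma S /\ sigma S <= K * sigma Q) ->
  forall i P, cube P -> sigma (ancestor D i P) <= K ^+ i * sigma P /\
    sigma P <= K ^+ i * sigma (ancestor D i P).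
Proof.
move=> K1 hK; elim=> [|i ih] P cP; first by rewrite ancestor0// expr0 mul1r.
have [h1 h2] := ih P cP; rewrite ancestorS//.
have cA := ancestor_cube i cP; have cA1 := ancestor_cube 1 cA.
have Ad : ancestor D i P \in desc 1 (ancestor D 1 (ancestor D i P)).
  by apply/mem_desc => //; apply/(descendantsP _ _ cA1); exact: desc_ancestor.
have [h3 h4] := hK _ cA1 _ Ad.
have K0 : 0 <= K by lra.
split.
- apply: le_trans h3 _; rewrite exprS -mulrA; exact: ler_wpM2l.
- apply: le_trans h2 _; rewrite exprSr -mulrA; apply: ler_wpM2l => //; exact: exprn_ge0.
Qed.

(** The coefficients of a Haar shift do not depend on the indices j and j', hence the unweighted sum
    over k' and a value independent of k. *)
Definition shift (beta : set Rn -> set Rn -> R) i j (g : set Rn -> J -> R) P (k : J) : R :=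
  \sum_(S <- nbr i j P) beta P S * \sum_k' g S k'.

Definition sigma_bounded (M : R) (b : set Rn -> J -> R) : Prop :=
  forall Q j, cube Q -> `|b Q j| <= M * sigma Q.

Lemma sqr_sum_le (T : Type) (s : seq T) (F : T -> R) :
  (\sum_(i <- s) F i) ^+ 2 <= (size s)%:R * \sum_(i <- s) F i ^+ 2.
Proof.
elim: s => [|t s ih]; first by rewrite !big_nil expr0n mulr0.
rewrite !big_cons /= -natr1; move: ih.
set X := \sum_(i <- s) F i; set Y := \sum_(i <- s) F i ^+ 2; set m := (size s)%:R.
have m0 : 0 <= m :> R by [].
have Y0 : 0 <= Y by apply: sumr_ge0 => i _; exact: sqr_ge0.
move=> XY; have [m00|mp] := eqVneq m 0.
  have X0 : X = 0 by apply/eqP; rewrite -sqrf_eq0 eq_le sqr_ge0 andbT; move: XY; rewrite m00 mul0r.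
  by rewrite X0 m00 addr0 add0r mul1r lerDl.
have : 0 <= (m * F t - X) ^+ 2 / m by rewrite divr_ge0 ?sqr_ge0.
have -> : (m * F t - X) ^+ 2 / m = m * F t ^+ 2 - 2 * F t * X + X ^+ 2 / m by field.
have : X ^+ 2 / m <= Y by rewrite ler_pdivrMr 1?mulrC// lt0r mp m0.
nra.
Qed.

Lemma sum_if_mem (T : eqType) (s t : seq T) (F : T -> R) : uniq s -> uniq t ->
  {subset s <= t} -> \sum_(i <- s) F i = \sum_(i <- t) (if i \in s then F i else 0).
Proof.
move=> us ut st; rewrite -big_mkcond/= -[RHS]big_filter; apply: perm_big.
apply: uniq_perm => //; first exact: filter_uniq.
by move=> x; rewrite mem_filter; case: (boolP (x \in s)) => //= /st ->.
Qed.

Lemma sum_tree_w m Q : cube Q -> \sum_(P <- tree m Q) w P = m%:R * w Q.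
Proof.
elim: m Q => [|m ih] Q cQ; first by rewrite /= big_nil mul0r.
rewrite big_tree -natr1 mulrDl mul1r addrC; congr (_ + _).
rewrite (w_desc 1 cQ) mulr_sumr; apply: eq_big_seq => S /(mem_desc _ _ cQ)[cS _ _].
exact: ih.
Qed.

Lemma sqr_sum_dot (g : set Rn -> J -> R) S : (\sum_k g S k) ^+ 2 <= (2 ^ n).-1%:R * dot g g S.
Proof.
apply: le_trans (sqr_sum_le _ _) _.
have -> : size (index_enum J) = (2 ^ n).-1.
  by rewrite /index_enum -enumT size_enum_ord.
by rewrite ler_wpM2l// /dot; under [leRHS]eq_bigr do rewrite -expr2.
Qed.

(** The constant L is found before beta, M and g: besides n and mu it depends only on A0, i and j.
    The sigma bound holds because the number of neighbours is bounded and sigma changes by at most K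
    per generation. *)
Lemma shift_bound (A0 : R) i j : 0 <= A0 -> exists2 L : R, 0 < L &
  forall beta, (forall P S, cube P -> S \in nbr i j P -> `|beta P S| <= A0) ->
  forall M g, 0 <= M -> sigma_bounded M g -> carleson M g ->
    sigma_bounded (L * M) (shift beta i j g) /\ carleson (L * M) (shift beta i j g).
Proof.
move=> A00; have [K K1 hK] := sigma_facts.
have K0 : 0 <= K by lra.
have hK' Q : cube Q -> forall S, S \in desc 1 Q -> sigma Q <= K * sigma S /\ sigma S <= K * sigma Q.
  by move=> /hK[].
pose Nj : R := ((2 ^ j).+1 ^ n)%:R; pose Ni : R := ((2 ^ i).+1 ^ n)%:R; pose NJ : R := (2 ^ n).-1%:R.
have Nj0 : 0 <= Nj by []. have Ni0 : 0 <= Ni by []. have NJ0 : 0 <= NJ by [].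
(* [L1] is the constant of the sigma bound. [L2] adds up the squared constants of the two parts of
   the Carleson sum, and the square of 1 + L1 + L2 exceeds it. *)
pose L1 := Nj * (A0 * (NJ * K ^+ (i + j))).
have L10 : 0 <= L1 by rewrite !mulr_ge0// exprn_ge0.
pose L2 := NJ * L1 ^+ 2 * i%:R + NJ * (Nj * NJ * A0 ^+ 2) * Ni.
have L20 : 0 <= L2 by rewrite /L2; apply: addr_ge0; do !apply: mulr_ge0 => //.
exists (1 + L1 + L2) => [|beta hb M g M0 gl gc]; first lra.
have sz P : cube P -> (size (nbr i j P))%:R <= Nj.
  by move=> cP; rewrite ler_nat; apply: size_desc; exact: ancestor_cube.
have sz' P : cube P -> (size (nbr j i P))%:R <= Ni.
  by move=> cP; rewrite ler_nat; apply: size_desc; exact: ancestor_cube.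
have sb P S : cube P -> S \in nbr i j P -> sigma S <= K ^+ (i + j) * sigma P.
  move=> cP Sn; have /(nbrP _ _ _ cP)[cS e] := Sn.
  have [_ h1] := sigma_ancestor K1 hK' j cS; have [h2 _] := sigma_ancestor K1 hK' i cP.
  apply: le_trans h1 _; rewrite e addnC exprD -mulrA; apply: ler_wpM2l => //; exact: exprn_ge0.
have sl P k : cube P -> `|shift beta i j g P k| <= L1 * M * sigma P.
  move=> cP; apply: le_trans (ler_norm_sum _ _ _) _.
  apply: (@le_trans _ _ (\sum_(S <- nbr i j P) A0 * (NJ * (M * (K ^+ (i + j) * sigma P))))).
    rewrite big_seq [leRHS]big_seq; apply: ler_sum => S Sn.
    have cS := nbr_cube cP Sn.
    rewrite normrM ler_pM//; first exact: hb.
    apply: le_trans (ler_norm_sum _ _ _) _.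
    apply: (@le_trans _ _ (\sum_(k' : J) M * (K ^+ (i + j) * sigma P))).
      apply: ler_sum => k' _; apply: le_trans (gl S k' cS) _; apply: ler_wpM2l => //; exact: sb.
    by rewrite sumr_const card_ord -mulr_natl.
  rewrite big_const_seq count_predT iter_addr_0 -[leLHS]mulr_natl.
  have -> : L1 * M * sigma P = Nj * (A0 * (NJ * (M * (K ^+ (i + j) * sigma P)))) by rewrite /L1; ring.
  apply: ler_wpM2r; last exact: sz.
  by rewrite !mulr_ge0// ?exprn_ge0// ltW// sigma_gt0.
split.
  move=> P k cP; apply: le_trans (sl P k cP) _.
  rewrite ler_pM2r ?sigma_gt0//; apply: ler_wpM2r => //; lra.
move=> Q m cQ; pose b := shift beta i j g.
have dotb P : dot b b P = NJ * (\sum_(S <- nbr i j P) beta P S * \sum_k' g S k') ^+ 2.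
  by rewrite /dot /b /shift sumr_const card_ord -mulr_natl expr2.
(* In the top i generations the neighbours of P may leave Q; there the sigma bound and [sigma_sqr]
   give at most w(Q) per generation, up to a constant. Further down the i-th ancestor of P, and so
   every neighbour, lies in Q. *)
rewrite (bigID (fun P => gen P < gen Q + i%:Z))/=.
have E1 : \sum_(P <- tree m Q | gen P < gen Q + i%:Z) dot b b P <= NJ * L1 ^+ 2 * i%:R * M ^+ 2 * w Q.
  apply: (@le_trans _ _ (\sum_(P <- tree i Q) NJ * (L1 * M) ^+ 2 * w P)); last first.
    rewrite -mulr_sumr sum_tree_w//.
    by rewrite exprMn le_eqVlt; apply/orP; left; apply/eqP; ring.
  rewrite -big_filter; apply: (@le_trans _ _ (\sum_(P <- [seq P <- tree m Q | gen P < gen Q + i%:Z]) NJ * (L1 * M) ^+ 2 * w P)).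
    rewrite big_seq [leRHS]big_seq; apply: ler_sum => P.
    rewrite mem_filter => /andP[_ /(tree_cube cQ) cP].
    apply: (@le_trans _ _ (\sum_(k : J) (L1 * M * sigma P) ^+ 2)).
      apply: ler_sum => k _; rewrite -expr2 -[leLHS]real_normK ?num_real// ler_pXn2r ?nnegrE//.
        exact: sl.
      by apply: mulr_ge0; [exact: mulr_ge0|apply: ltW; exact: sigma_gt0].
    rewrite sumr_const card_ord -[leLHS]mulr_natl exprMn mulrA; apply: ler_wpM2l; last exact: sigma_sqr.
    by rewrite mulr_ge0// sqr_ge0.
  apply: sum_seq_le.
  - by apply: filter_uniq; exact: tree_uniq.
  - exact: tree_uniq.
  - move=> P; rewrite mem_filter => /andP[gP /(mem_tree _ _ cQ)[cP PQ _]].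
    by apply/mem_tree.
  - move=> P /(tree_cube cQ) cP; apply: mulr_ge0; last by apply: ltW; exact: w_gt0.
    by apply: mulr_ge0 => //; exact: sqr_ge0.
have E2 : \sum_(P <- tree m Q | ~~ (gen P < gen Q + i%:Z)) dot b b P <=
    NJ * (Nj * NJ * A0 ^+ 2) * Ni * M ^+ 2 * w Q.
  apply: (@le_trans _ _ (\sum_(P <- tree m Q | ~~ (gen P < gen Q + i%:Z))
      NJ * (Nj * NJ * A0 ^+ 2) * \sum_(S <- nbr i j P) dot g g S)).
    rewrite big_seq_cond [leRHS]big_seq_cond; apply: ler_sum => P /andP[/(tree_cube cQ) cP _].
    rewrite dotb -mulrA; apply: ler_wpM2l => //.
    apply: le_trans (sqr_sum_le _ _) _.
    rewrite -!mulrA; apply: ler_pM => //; [|exact: sz|].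
      by apply: sumr_ge0 => S _; exact: sqr_ge0.
    rewrite !mulr_sumr big_seq [leRHS]big_seq; apply: ler_sum => S Sn.
    have -> : NJ * (A0 * (A0 * dot g g S)) = A0 ^+ 2 * (NJ * dot g g S) by ring.
    rewrite exprMn; apply: ler_pM; rewrite ?sqr_ge0//.
      by rewrite -real_normK ?num_real// ler_pXn2r ?nnegrE//; exact: hb.
    exact: sqr_sum_dot.
  rewrite -mulr_sumr -!mulrA; do !apply: ler_wpM2l => //; rewrite ?sqr_ge0//.
  apply: (@le_trans _ _ (\sum_(P <- tree m Q | ~~ (gen P < gen Q + i%:Z))
     \sum_(S <- tree (m + j) Q) (if P \in nbr j i S then dot g g S else 0))).
    rewrite big_seq_cond [leRHS]big_seq_cond; apply: ler_sum => P /andP[/[dup] Pt /(mem_tree _ _ cQ)[cP PQ gP] gP2].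
    rewrite (@sum_if_mem _ (nbr i j P) (tree (m + j) Q)).
    - rewrite big_seq [leRHS]big_seq; apply: ler_sum => S /(tree_cube cQ) cS.
      case: ifPn => [/(nbr_sym cP) ->//|_]; case: ifP => // _; exact: dot_ge0.
    - exact: desc_uniq.
    - exact: tree_uniq.
    - move=> S Sn; have cA := ancestor_cube i cP.
      have /(mem_desc _ _ cA)[cS gS SA] := Sn.
      apply/mem_tree => //; split => //; last first.
        by rewrite (gen_nbr cP Sn); move: (gen P) (gen Q) gP gP2; clear; lia.
      apply: (subset_trans SA).
      apply: (@cube_nested _ _ (pt P)) => //.
      + exact: sub_ancestor (pt_mem cP).
      + exact: PQ (pt_mem cP).
      + by rewrite gen_ancestor//; move: (gen P) (gen Q) gP gP2; clear; lia.
  (* By symmetry of the neighbour relation each S is counted at most [Ni] times, after which the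
     Carleson condition for g on a tree deeper by j applies. *)
  rewrite exchange_big/=.
  apply: (@le_trans _ _ (\sum_(S <- tree (m + j) Q) Ni * dot g g S)).
    rewrite big_seq [leRHS]big_seq; apply: ler_sum => S /(tree_cube cQ) cS.
    rewrite -big_mkcondr/= big_const_seq iter_addr_0 -[leLHS]mulr_natl.
    apply: ler_wpM2r; first exact: dot_ge0.
    apply: le_trans (sz' S cS); rewrite ler_nat -size_filter.
    apply: uniq_leq_size; first by apply: filter_uniq; exact: tree_uniq.
    by move=> P; rewrite mem_filter => /andP[/andP[]].
  rewrite -mulr_sumr [M * (M * _)]mulrA -expr2; apply: ler_wpM2l => //; exact: gc.
apply: le_trans (lerD E1 E2) _.
have -> : NJ * L1 ^+ 2 * i%:R * M ^+ 2 * w Q + NJ * (Nj * NJ * A0 ^+ 2) * Ni * M ^+ 2 * w Q = L2 * M ^+ 2 * w Q.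
  by rewrite /L2; ring.
rewrite ler_pM2r ?w_gt0// exprMn ler_wpM2r ?sqr_ge0//.
by nra.
Qed.

(** * Davis' inequality and square functions of shifts *)

Lemma coef_dot c u S : cube S -> loc_int u -> dot c (coef u) S = \int[mu]_(x in S) (u x * hsum c S x).
Proof.
move=> cS uL; rewrite /dot.
transitivity (\int[mu]_(x in S) \sum_(j : J) (c S j * (u x * h S j x))).
  rewrite int_sum//; last by move=> j _; apply/loc_int_scale/loc_int_mul => //; exact: haar_bdd_meas.
  apply: eq_bigr => j _; rewrite intZ//; last by apply: loc_int_mul => //; exact: haar_bdd_meas.
  by rewrite /coef pairing_int.
by apply: int_eq => x _; rewrite /hsum mulr_sumr; apply: eq_bigr => j _; ring.
Qed.

Lemma coef_sigma_bounded u Q j (K : R) : cube Q -> bdd_meas u -> (forall x, `|u x| <= 1) ->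
  \int[mu]_(x in Q) `|h Q j x| <= K * sigma Q -> `|coef u Q j| <= K * sigma Q.
Proof.
move=> cQ uB u1; apply: le_trans; rewrite /coef pairing_int//.
have hB := haar_bdd_meas j cQ.
apply: le_trans (int_norm cQ (bdd_meas_loc_int (bdd_meas_mul uB hB))) _.
apply: int_le => //; [exact/loc_int_norm/bdd_meas_loc_int/bdd_meas_mul|exact/loc_int_norm/bdd_meas_loc_int|].
by move=> x _; rewrite normrM ler_piMl.
Qed.

Lemma jensen Q u : cube Q -> bdd_meas u ->
  w Q * average mu u Q ^+ 2 <= \int[mu]_(x in Q) u x ^+ 2.
Proof.
move=> cQ uB; set a := average mu u Q.
have uL := bdd_meas_loc_int uB.
have u2L : loc_int (fun x => u x ^+ 2).
  by apply: bdd_meas_loc_int; under eq_fun do rewrite expr2; exact: bdd_meas_mul.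
have : 0 <= \int[mu]_(x in Q) (u x - a) ^+ 2 by apply: Rintegral_ge0 => x _; exact: sqr_ge0.
have -> : \int[mu]_(x in Q) (u x - a) ^+ 2 =
   \int[mu]_(x in Q) (u x ^+ 2 - (2 * a * u x - a ^+ 2)).
  by apply: int_eq => x _; ring.
have L2 : loc_int (fun x => 2 * a * u x) by exact: loc_int_scale.
rewrite intB//; last by apply: loc_int_sub => //; exact: loc_int_cst.
rewrite intB//; last exact: loc_int_cst.
rewrite intZ// int_cst// (avg_mul u cQ) -/a.
by move=> H; rewrite -subr_ge0; apply: le_trans H _; rewrite le_eqVlt; apply/orP; left; apply/eqP; ring.
Qed.

(** The energies telescope to the difference between the mean square of the finest averages, at most
    1, and the square of the average over the top cube. *)
Lemma carleson_coef_bounded v : bdd_meas v -> (forall x, `|v x| <= 1) -> carleson 1 (coef v).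
Proof.
move=> vB v1 Q m cQ; rewrite expr1n mul1r.
have vL := bdd_meas_loc_int vB.
suff H P : cube P -> \sum_(S <- tree m P) dot (coef v) (coef v) S <= w P - w P * average mu v P ^+ 2.
  apply: le_trans (H Q cQ) _; rewrite gerBl mulr_ge0 ?sqr_ge0//; apply: ltW; exact: w_gt0.
elim: m P => [|m ih] P cP.
  rewrite /= big_nil subr_ge0 -[leRHS]mulr1; apply: ler_wpM2l; first by apply: ltW; exact: w_gt0.
  rewrite -real_normK ?num_real// exprn_ile1//.
  rewrite -(@ler_pM2r _ (w P)) ?w_gt0// mul1r -[w P in leLHS]gtr0_norm ?w_gt0// -normrM -avg_mul//.
  apply: le_trans (int_norm cP vL) _; rewrite -[leRHS]mul1r -int_cst//.
  apply: int_le => //; [exact: loc_int_norm|exact: loc_int_cst].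
rewrite big_tree (dot_coef cP vL 0) !subr0 (eq_bigr (fun S => w S * average mu v S ^+ 2)); last by move=> S _; rewrite subr0.
rewrite addrAC -big_split/= lerD2r [leRHS](w_desc 1 cP).
rewrite big_seq [leRHS]big_seq; apply: ler_sum => S /(mem_desc _ _ cP)[cS _ _].
by rewrite addrC -lerBrDr; exact: ih.
Qed.

(** For each S Bessel and Jensen bound the energy of the S-th coefficients by the integral of u_S^2
    over S; summing over the S in Q leaves the integral over Q of a function that is at most 1. *)
Lemma carleson_coef_family (A : seq (set Rn)) (u : set Rn -> Rn -> R) : uniq A ->
  (forall S, S \in A -> cube S /\ bdd_meas (u S)) ->
  (forall x, \sum_(S <- A) u S x ^+ 2 <= 1) ->
  carleson 1 (fun S j => if S \in A then coef (u S) S j else 0).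
Proof.
move=> uA hA u1 Q m cQ; rewrite expr1n mul1r.
pose g := fun (S : set Rn) (j : J) => if S \in A then coef (u S) S j else 0; rewrite -/g.
have g0 S : S \notin A -> dot g g S = 0.
  by move=> SA; rewrite /dot /g (negbTE SA) big1// => j _; rewrite mul0r.
have gA S : S \in A -> dot g g S <= \int[mu]_(x in S) u S x ^+ 2.
  move=> SA; have [cS uB] := hA S SA.
  have -> : dot g g S = dot (coef (u S)) (coef (u S)) S.
    by apply: eq_bigr => j _; rewrite /g SA.
  have u2L : loc_int (fun x => u S x ^+ 2).
    by apply: bdd_meas_loc_int; under eq_fun do rewrite expr2; exact: bdd_meas_mul.
  rewrite (dot_coef cS (bdd_meas_loc_int uB) 0) (int_desc 1 cS u2L) subr0.
  apply: (@le_trans _ _ (\sum_(P <- desc 1 S) w P * (average mu (u S) P - 0) ^+ 2)).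
    by rewrite gerBl mulr_ge0 ?sqr_ge0//; apply: ltW; exact: w_gt0.
  rewrite big_seq [leRHS]big_seq; apply: ler_sum => P /(mem_desc _ _ cS)[cP _ _].
  by rewrite subr0; exact: jensen.
have u2B S : S \in A -> bdd_meas (fun x => u S x ^+ 2 * \1_S x).
  move=> /hA[cS uB]; apply: bdd_meas_mul; last by apply: bdd_meas_indic; exact: cube_measurable.
  by under eq_fun do rewrite expr2; exact: bdd_meas_mul.
have st : {subset [seq S <- tree m Q | S \in A] <= A} by move=> S; rewrite mem_filter => /andP[].
rewrite (bigID (mem A))/= [X in _ + X]big1 ?addr0; last by move=> S; exact: g0.
rewrite -big_filter.
apply: (@le_trans _ _ (\sum_(S <- [seq S <- tree m Q | S \in A]) \int[mu]_(x in Q) (u S x ^+ 2 * \1_S x))).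
  rewrite big_seq [leRHS]big_seq; apply: ler_sum => S.
  rewrite mem_filter => /andP[SA /(mem_tree _ _ cQ)[cS SQ _]].
  apply: le_trans (gA S SA) _.
  have z x : ~ S x -> u S x ^+ 2 * \1_S x = 0 by move=> nS; rewrite indicE memNset// mulr0.
  rewrite -(@int_setT Q); last by move=> x nQ; apply: z => /SQ.
  rewrite (@int_setT S)// le_eqVlt; apply/orP; left; apply/eqP.
  by apply: int_eq => x Sx; rewrite indicE mem_set// mulr1.
rewrite -int_sum//; last by move=> S /st SA; exact/bdd_meas_loc_int/u2B.
rewrite -[leRHS]mul1r -int_cst//; apply: int_le => //; [|exact: loc_int_cst|].
  by apply: loc_int_sum => S /st SA; exact/bdd_meas_loc_int/u2B.
move=> x _; apply: le_trans (u1 x).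
apply: (@le_trans _ _ (\sum_(S <- [seq S <- tree m Q | S \in A]) u S x ^+ 2)).
  apply: ler_sum => S _; rewrite ler_piMr ?sqr_ge0// indicE; by case: (_ \in _).
apply: sum_seq_le => //; first by apply: filter_uniq; exact: tree_uniq.
by move=> S _; exact: sqr_ge0.
Qed.

(** The power -1 gives a reciprocal equal to 0 at 0, so the quotients used as dual functions are
    defined and measurable everywhere. *)
Lemma measurable_inv (f : Rn -> R) : measurable_fun setT f ->
  measurable_fun setT (fun x => f x `^ (-1)).
Proof. by move=> mf; apply: (measurableT_comp (measurable_powR (-1))). Qed.

Lemma normM_powRN1 (t : R) : `|t| * `|t| `^ (-1) = (t != 0)%:R.
Proof.
rewrite powR_inv1//; have [->|t0] := eqVneq t 0; first by rewrite normr0 mul0r.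
by rewrite divff// normr_eq0.
Qed.

Lemma sigma_bounded_terms (K : R) b (M : R) : 0 <= M -> 0 <= K ->
  (forall Q j x, cube Q -> `|h Q j x| * sigma Q <= K) -> sigma_bounded M b ->
  terms_bounded ((2 ^ n).-1%:R * (M * K)) b.
Proof.
move=> M0 K0 hK bl Q x cQ; apply: le_trans (ler_norm_sum _ _ _) _.
apply: (@le_trans _ _ (\sum_(j : J) M * K)); last by rewrite sumr_const card_ord -[leLHS]mulr_natl.
apply: ler_sum => j _; rewrite normrM.
apply: (@le_trans _ _ (M * sigma Q * `|h Q j x|)); first by apply: ler_wpM2r => //; exact: bl.
rewrite -mulrA; apply: ler_wpM2l => //; rewrite mulrC; exact: hK.
Qed.

Definition Fsum (c : set Rn -> J -> R) (A : seq (set Rn)) x : R := \sum_(P <- A) hsum c P x.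

Lemma Fsum_bdd_meas c A : (forall P, P \in A -> cube P) -> bdd_meas (Fsum c A).
Proof. by move=> cA; apply: bdd_meas_sum => P /cA; exact: hsum_bdd_meas. Qed.

Lemma int_setT_cubes (A : seq (set Rn)) (F : Rn -> R) : (forall P, P \in A -> cube P) -> bdd_meas F ->
  (forall x, (forall P, P \in A -> ~ P x) -> F x = 0) ->
  mu.-integrable setT (EFin \o F).
Proof.
move=> cA FB F0; have [k [m [tops [ut tD uF AF]]]] := forest cA.
have [] // := int_tops ut tD (bdd_meas_loc_int FB) _.
move=> x nt; apply: F0 => P /AF/flattenP[_ /mapP[Q Qt ->]].
by move=> /(mem_tree _ _ (cubeP (tD _ Qt)))[_ + _]; move=> /(_ x) PQ /PQ; exact: nt.
Qed.

Lemma int_hsum_mul c A u : (forall P, P \in A -> cube P /\ bdd_meas (u P)) ->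
  \int[mu]_x (\sum_(P <- A) u P x * hsum c P x) = \sum_(P <- A) dot c (coef (u P)) P.
Proof.
move=> hA.
have iP P : P \in A -> mu.-integrable setT (EFin \o (fun x => u P x * hsum c P x)).
  move=> /hA[cP uB]; apply: (@int_setT_cubes [:: P]).
  - by move=> Q; rewrite inE => /eqP ->.
  - by apply: bdd_meas_mul => //; exact: hsum_bdd_meas.
  - by move=> x /(_ P (mem_head _ _)) nP; rewrite hsum_out ?mulr0.
elim: A hA iP => [|P A ih] hA iP.
  by rewrite big_nil; under eq_Rintegral do rewrite big_nil; rewrite /Rintegral integral0.
have sA Q : Q \in A -> Q \in P :: A by rewrite inE orbC => ->.
have PA := mem_head P A; have [cP uB] := hA P PA.
rewrite big_cons; under eq_Rintegral do rewrite big_cons.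
rewrite RintegralD//; last 2 first.
- exact: iP.
- have -> : EFin \o (fun x => \sum_(Q <- A) u Q x * hsum c Q x) =
     (fun x => \sum_(Q <- A) (if Q \in A then u Q x * hsum c Q x else 0)%:E)%E.
    by apply/funext => x /=; rewrite sumEFin; congr EFin; apply: eq_big_seq => Q ->.
  apply: integrable_sum => // Q _; have [QA|_] := boolP (Q \in A); last exact: integrable0.
  by apply: iP; exact: sA.
rewrite ih//; [|by move=> Q /sA; exact: hA|by move=> Q /sA; exact: iP].
congr (_ + _); rewrite (@int_setT P) ?coef_dot//; first exact: bdd_meas_loc_int.
by move=> x nP; rewrite hsum_out ?mulr0.
Qed.

(* Duality with the sign of the sum, whose Haar coefficients satisfy the
   hypotheses of Fefferman's inequality. *)
Lemma davis : exists2 C : R, 0 < C & forall c A, uniq A -> (forall P, P \in A -> cube P) ->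
  \int[mu]_x `|Fsum c A x| <= C * \int[mu]_x sqa c A x.
Proof.
have [K K1 hK] := sigma_facts; have K0 : 0 <= K by lra.
pose M := (2 ^ n).-1%:R * (K * K) + 1 : R.
have M0 : 0 < M by rewrite ltr_wpDl// !mulr_ge0.
exists (2 * M) => [|c A uA cA]; first by rewrite mulr_gt0.
pose v x := Fsum c A x * `|Fsum c A x| `^ (-1).
have FB := Fsum_bdd_meas c cA.
have v1 x : `|v x| <= 1.
  by rewrite /v normrM [X in _ * X]ger0_norm ?powR_ge0// normM_powRN1; case: (_ != _).
have vB : bdd_meas v.
  split; last by exists 1.
  apply: measurable_funM; first by case: FB.
  by apply: measurable_inv; apply: measurableT_comp => //; case: FB.
have vs : sigma_bounded K (coef v).
  by move=> Q j cQ; apply: coef_sigma_bounded => //; have [] := hK Q cQ.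
have vl : terms_bounded M (coef v).
  move=> Q x cQ; apply: (@le_trans _ _ ((2 ^ n).-1%:R * (K * K))); last by rewrite /M; lra.
  by apply: sigma_bounded_terms => // P j y cP; have [] := hK P cP.
have vc : carleson M (coef v).
  move=> Q m cQ; apply: le_trans (carleson_coef_bounded vB v1 m cQ) _.
  rewrite ler_pM2r ?w_gt0// expr1n exprn_ege1// /M lerDr !mulr_ge0//.
have [_ H] := @fefferman c (coef v) M A M0 vl vc uA cA.
apply: le_trans H.
have -> : \int[mu]_x `|Fsum c A x| = \int[mu]_x (\sum_(P <- A) v x * hsum c P x).
  apply: eq_Rintegral => x _; rewrite -mulr_sumr -/(Fsum c A x) /v mulrAC -expr2.
  rewrite -[Fsum c A x ^+ 2]real_normK ?num_real// expr2 -mulrA normM_powRN1.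
  by have [->|] := eqVneq (Fsum c A x) 0; rewrite ?normr0 ?mul0r ?mulr1.
rewrite (@int_hsum_mul c A (fun=> v)); last by move=> P /cA.
exact: ler_norm.
Qed.

(** The adjoint of a shift is a shift with the kernel transposed and i, j exchanged. Restricting g
    to A makes both sides finite double sums over the same pairs. *)
Lemma shift_dual beta i j a g (A : seq (set Rn)) : uniq A -> (forall P, P \in A -> cube P) ->
  \sum_(S <- A) dot (shift beta i j a) g S =
  \sum_(P <- undup (flatten (map (nbr i j) A)))
    dot a (shift (fun P S => beta S P) j i (fun S k => if S \in A then g S k else 0)) P.
Proof.
move=> uA cA; set A2 := undup _.
have A2P P : P \in A2 -> cube P.
  by rewrite mem_undup => /flattenP[_ /mapP[S SA ->]]; apply: nbr_cube; exact: cA.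
pose X S P := beta S P * (\sum_k a P k) * (\sum_k g S k).
transitivity (\sum_(S <- A) \sum_(P <- A2) if P \in nbr i j S then X S P else 0).
  apply: eq_big_seq => S SA.
  rewrite -(@sum_if_mem _ (nbr i j S) A2 (X S)); first last.
  - by move=> P Pn; rewrite mem_undup; apply/flattenP; exists (nbr i j S) => //; exact: map_f.
  - exact: undup_uniq.
  - exact: desc_uniq.
  by rewrite /dot /shift -mulr_sumr mulr_suml.
rewrite exchange_big/=; apply: eq_big_seq => P PA2.
have cP := A2P _ PA2.
rewrite /dot /shift -mulr_suml mulr_sumr.
rewrite [RHS](eq_big_seq (fun S => if S \in A then X S P else 0)); last first.
  move=> S Sn; rewrite /X; case: ifP => _; first by ring.
  by rewrite [X in _ * (_ * X)]big1 ?mulr0.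
rewrite -[LHS]big_mkcond -[RHS]big_mkcond/= -[LHS]big_filter -[RHS]big_filter.
apply: perm_big; apply: uniq_perm; [exact: filter_uniq|by apply: filter_uniq; exact: desc_uniq|].
move=> S; rewrite !mem_filter; case SA : (S \in A); rewrite ?andbF//= andbT.
by apply/idP/idP => /nbr_sym; apply => //; exact: cA.
Qed.

(* Duality with the functions c_S / S_A(c), where c_S is the S-th Haar term of
   the shifted coefficients and S_A(c) their square function over A. *)
Lemma h1_shift (A0 : R) i j : 0 <= A0 -> exists2 C : R, 0 < C & forall beta,
  (forall P S, cube P -> S \in nbr j i P -> `|beta S P| <= A0) ->
  forall a A, uniq A -> (forall P, P \in A -> cube P) ->
  \int[mu]_x sqa (shift beta i j a) A x <=
    C * \int[mu]_x sqa a (undup (flatten (map (nbr i j) A))) x.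
Proof.
move=> A00; have [K K1 hK] := sigma_facts; have K0 : 0 <= K by lra.
have [L L0 hL] := shift_bound j i A00.
(* [M] dominates both constants required by Fefferman's inequality for the transposed shift of g:
   the bound for its Haar terms and its Carleson constant L K. *)
pose M := (2 ^ n).-1%:R * (L * K * K) + L * K : R.
have LK : 0 < L * K by apply: mulr_gt0 => //; lra.
have LKK : 0 <= (2 ^ n).-1%:R * (L * K * K) by apply: mulr_ge0 => //; apply: mulr_ge0 => //; exact: ltW.
have M0 : 0 < M by rewrite /M; lra.
exists (2 * M) => [|beta hb a A uA cA]; first by rewrite mulr_gt0.
set A2 := undup _.
have A2P P : P \in A2 -> cube P.
  by rewrite mem_undup => /flattenP[_ /mapP[S SA ->]]; apply: nbr_cube; exact: cA.
pose c := shift beta i j a; rewrite -/c.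
pose u S x := hsum c S x * `|sqa c A x| `^ (-1).
have sqB := sqa_bdd_meas c cA.
have sq0 x : 0 <= sqa c A x by exact: sqrtr_ge0.
have u2 x : \sum_(S <- A) u S x ^+ 2 <= 1.
  rewrite (eq_bigr (fun S => hsum c S x ^+ 2 * (`|sqa c A x| `^ (-1)) ^+ 2)); last first.
    by move=> S _; rewrite /u exprMn.
  rewrite -mulr_suml.
  have -> : \sum_(S <- A) hsum c S x ^+ 2 = `|sqa c A x| ^+ 2.
    by rewrite ger0_norm// sqr_sqrtr// sum_hsum2_ge0.
  by rewrite -exprMn normM_powRN1; case: (_ != _); rewrite ?expr1n// expr0n.
have u1 S x : S \in A -> `|u S x| <= 1.
  move=> SA; rewrite -(@ler_pXn2r _ 2) ?nnegrE// real_normK ?num_real// expr1n.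
  apply: le_trans (u2 x); rewrite (bigD1_seq S)//= lerDl; apply: sumr_ge0 => P _; exact: sqr_ge0.
have uB S : S \in A -> bdd_meas (u S).
  move=> SA; split; last by exists 1 => x; exact: u1.
  apply: measurable_funM; first by case: (hsum_bdd_meas c (cA _ SA)).
  by apply: measurable_inv; apply: measurableT_comp => //; case: sqB.
pose g S k : R := if S \in A then coef (u S) S k else 0.
have -> : \int[mu]_x sqa c A x = \sum_(S <- A) dot c g S.
  transitivity (\int[mu]_x (\sum_(S <- A) u S x * hsum c S x)).
    apply: eq_Rintegral => x _.
    rewrite (eq_bigr (fun S => hsum c S x ^+ 2 * `|sqa c A x| `^ (-1))); last first.
      by move=> S _; rewrite /u mulrAC -expr2.
    rewrite -mulr_suml.
    have -> : \sum_(S <- A) hsum c S x ^+ 2 = `|sqa c A x| ^+ 2.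
      by rewrite ger0_norm// sqr_sqrtr// sum_hsum2_ge0.
    rewrite expr2 -mulrA normM_powRN1.
    by have [->|] := eqVneq (sqa c A x) 0; rewrite ?normr0 ?mul0r ?mulr1// ger0_norm.
  rewrite int_hsum_mul; last by move=> S SA; split; [exact: cA|exact: uB].
  apply: eq_big_seq => S SA; apply: eq_bigr => k _; by rewrite /g SA.
rewrite shift_dual//.
have gE : (fun S k => if S \in A then g S k else 0) = g.
  by apply/funext => S; apply/funext => k; rewrite /g; case: (S \in A).
rewrite gE.
have gs : sigma_bounded K g.
  move=> S k cS; rewrite /g; case: ifPn => SA.
    apply: coef_sigma_bounded => //; [exact: uB|by move=> x; exact: u1|].
    by have [] := hK S cS.
  by rewrite normr0 mulr_ge0//; apply: ltW; exact: sigma_gt0.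
have gc : carleson K g.
  move=> Q m cQ; have := carleson_coef_family uA _ u2 m cQ; rewrite -/g => h1.
  apply: le_trans (h1 _) _; first by move=> S SA; split; [exact: cA|exact: uB].
  by rewrite ler_pM2r ?w_gt0// expr1n exprn_ege1.
have [bs bc] := hL (fun P S => beta S P) hb K g K0 gs gc.
have LK0 : 0 <= L * K by rewrite mulr_ge0// ltW.
have bl : terms_bounded M (shift (fun P S => beta S P) j i g).
  move=> Q x cQ; apply: (@le_trans _ _ ((2 ^ n).-1%:R * (L * K * K))); last first.
    by rewrite /M lerDl.
  by apply: sigma_bounded_terms => // P k y cP; have [] := hK P cP.
have bc' : carleson M (shift (fun P S => beta S P) j i g).
  move=> Q m cQ; apply: le_trans (bc Q m cQ) _; rewrite ler_pM2r ?w_gt0//.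
  have LM : L * K <= M by rewrite /M; lra.
  by rewrite ler_pXn2r ?nnegrE//; exact: ltW.
have [_ H] := @fefferman a _ M A2 M0 bl bc' (undup_uniq _) A2P.
by apply: le_trans H; exact: ler_norm.
Qed.

(** * The John-Nirenberg inequality *)

(** The BMO norm cube by cube. Subtracting the average over the parent controls at once the
    oscillation on Q and the jump of averages between Q and its parent. *)
Definition bmo_bound (B : R) (g : Rn -> R) : Prop := forall Q, cube Q ->
  \int[mu]_(x in Q) `|g x - average mu g (ancestor D 1 Q)| <= B * w Q.

Lemma loc_int_osc g c : loc_int g -> loc_int (fun x => `|g x - c|).
Proof. by move=> gL; apply: loc_int_norm; apply: loc_int_sub => //; exact: loc_int_cst. Qed.

Lemma avg_osc g c Q : cube Q -> loc_int g ->
  w Q * `|average mu g Q - c| <= \int[mu]_(x in Q) `|g x - c|.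
Proof.
move=> cQ gL; apply: le_trans (int_norm cQ (loc_int_sub gL (loc_int_cst c))).
rewrite intB//; last exact: loc_int_cst.
rewrite (avg_mul g cQ) int_cst// -mulrBl normrM [ `|w Q| ]gtr0_norm ?w_gt0//.
by rewrite mulrC.
Qed.

Lemma desc1_ancestor Q S : cube Q -> S \in desc 1 Q -> ancestor D 1 S = Q.
Proof. by move=> cQ Ss; apply: ancestor_desc => //; apply/(descendantsP _ _ cQ); apply/mem_desc. Qed.

Lemma bmo_avg B g Q : loc_int g -> bmo_bound B g -> cube Q ->
  `|average mu g Q - average mu g (ancestor D 1 Q)| <= B.
Proof.
move=> gL gB cQ; rewrite -(@ler_pM2l _ (w Q)) ?w_gt0// [leRHS]mulrC.
exact: le_trans (avg_osc _ cQ gL) (gB Q cQ).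
Qed.

Lemma bmo_osc B g Q : loc_int g -> bmo_bound B g -> cube Q ->
  \int[mu]_(x in Q) `|g x - average mu g Q| <= 2 * B * w Q.
Proof.
move=> gL gB cQ; set p := average mu g (ancestor D 1 Q).
apply: (@le_trans _ _ (\int[mu]_(x in Q) (`|g x - p| + `|average mu g Q - p|))).
  apply: int_le => //; [exact: loc_int_osc|apply: loc_int_add; [exact: loc_int_osc|exact: loc_int_cst]|].
  move=> x _; have -> : g x - average mu g Q = (g x - p) - (average mu g Q - p) by ring.
  exact: ler_normB.
rewrite intD//; [|exact: loc_int_osc|exact: loc_int_cst].
rewrite int_cst//; have := gB Q cQ; rewrite -/p.
have := bmo_avg gL gB cQ; rewrite -/p.
have := w_gt0 cQ; move: (w Q) => W W0 h1 h2.
have : `|average mu g Q - p| * W <= B * W by rewrite ler_pM2r.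
lra.
Qed.

(* John-Nirenberg in the form of a Bellman induction: for a reference value c,
   the energy of the subcubes of Q is compared with the L^2 energy of the averages stopped
   when they are at distance more than 4B of c; the measure of the stopping
   cubes is controlled by the last term. *)
Lemma john_nirenberg (B : R) g : 0 < B -> loc_int g -> bmo_bound B g -> carleson (8 * B) (coef g).
Proof.
move=> B0 gL gB.
pose E m Q := \sum_(P <- tree m Q) dot (coef g) (coef g) P.
(* With the average over Q as reference value the bound is 25 B^2 + (25/2) B * 2 B = 50 B^2 per unit
   of measure; the 8 in the statement satisfies 50 <= 64. *)
have step m : (forall Q (c : R), cube Q -> `|average mu g Q - c| <= 4 * B ->
  E m Q <= 25 * B ^+ 2 * w Q - (average mu g Q - c) ^+ 2 * w Q
     + 25 / 2 * B * \int[mu]_(x in Q) `|g x - c|) -> forall Q, cube Q -> E m Q <= 50 * B ^+ 2 * w Q.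
  move=> H Q cQ; have := H Q (average mu g Q) cQ; rewrite subrr normr0 expr0n mul0r subr0.
  move=> /(_ _)/le_trans; apply; first by lra.
  have : 25 / 2 * B * \int[mu]_(x in Q) `|g x - average mu g Q| <= 25 / 2 * B * (2 * B * w Q).
    by apply: ler_wpM2l; [lra|exact: bmo_osc].
  have -> : 25 / 2 * B * (2 * B * w Q) = 25 * B ^+ 2 * w Q by field.
  by move=> ?; lra.
suff main m : forall Q (c : R), cube Q -> `|average mu g Q - c| <= 4 * B ->
  E m Q <= 25 * B ^+ 2 * w Q - (average mu g Q - c) ^+ 2 * w Q
     + 25 / 2 * B * \int[mu]_(x in Q) `|g x - c|.
  move=> Q m cQ; apply: le_trans (step m (main m) Q cQ) _.
  rewrite ler_pM2r ?w_gt0// exprMn; have : 0 <= B ^+ 2 by exact: sqr_ge0.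
  lra.
elim: m => [|m ih] Q c cQ Qc.
  rewrite /E big_nil.
  have i0 : 0 <= \int[mu]_(x in Q) `|g x - c| by apply: Rintegral_ge0.
  have : (average mu g Q - c) ^+ 2 <= 16 * B ^+ 2.
    rewrite -real_normK ?num_real// (_ : 16 * B ^+ 2 = (4 * B) ^+ 2); last by ring.
    by rewrite ler_pXn2r ?nnegrE//; lra.
  have := w_gt0 cQ; move=> W0 h1.
  have : (average mu g Q - c) ^+ 2 * w Q <= 16 * B ^+ 2 * w Q by rewrite ler_pM2r.
  have : 0 <= B ^+ 2 * w Q by rewrite mulr_ge0 ?sqr_ge0// ltW.
  have : 0 <= B * \int[mu]_(x in Q) `|g x - c| by rewrite mulr_ge0// ltW.
  by nra.
(* The square term of the parent in the variance identity is exactly the one in the claim, so it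
   cancels and the claim splits over the children. *)
rewrite /E big_tree (dot_coef cQ gL c) (int_desc 1 cQ (loc_int_osc c gL)).
rewrite {2}(w_desc 1 cQ) addrAC -big_split/=.
rewrite [X in _ <= X](_ : _ = (\sum_(S <- desc 1 Q) (25 * B ^+ 2 * w S + 25 / 2 * B * \int[mu]_(x in S) `|g x - c|)) - w Q * (average mu g Q - c) ^+ 2); last first.
  rewrite big_split/= -!mulr_sumr; ring.
rewrite lerD2r big_seq [leRHS]big_seq; apply: ler_sum => S Ss.
have /(mem_desc _ _ cQ)[cS _ _] := Ss.
have W0 := w_gt0 cS.
(* On a stopping cube the distance of the average to c lies between 4B and 5B, as one jump is at
   most B. Then 25 B^2 absorbs the squared distance, and (25/2) B times the integral, itself at
   least 4 B w(S), absorbs the energy 50 B^2 w(S) of the induction restarted with the average over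
   S. *)
have [small|large] := leP `|average mu g S - c| (4 * B).
  by have := ih S c cS small; rewrite /E; lra.
have E1 := step m ih S cS; rewrite /E in E1.
have d1 := bmo_avg gL gB cS; rewrite (desc1_ancestor cQ Ss) in d1.
have d2 : `|average mu g S - c| <= 5 * B.
  have -> : average mu g S - c = (average mu g S - average mu g Q) + (average mu g Q - c) by ring.
  by apply: le_trans (ler_normD _ _) _; lra.
have d3 : (average mu g S - c) ^+ 2 <= 25 * B ^+ 2.
  rewrite -real_normK ?num_real// (_ : 25 * B ^+ 2 = (5 * B) ^+ 2); last by ring.
  by rewrite ler_pXn2r ?nnegrE//; lra.
have d4 := avg_osc c cS gL.
have d5 : w S * (4 * B) <= \int[mu]_(x in S) `|g x - c|.
  by apply: le_trans d4; rewrite ler_pM2l// ltW.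
have d6 : w S * (average mu g S - c) ^+ 2 <= w S * (25 * B ^+ 2) by rewrite ler_pM2l.
have d7 : 25 / 2 * B * (w S * (4 * B)) <= 25 / 2 * B * \int[mu]_(x in S) `|g x - c|.
  by apply: ler_wpM2l => //; lra.
have e7 : 25 / 2 * B * (w S * (4 * B)) = 50 * B ^+ 2 * w S by field.
lra.
Qed.

(** The coefficient is the integral of h_Q^j against the differences between the averages over the
    children and over Q, each of size at most B. *)
Lemma bmo_sigma_bounded (B K : R) g : 0 < B -> loc_int g -> bmo_bound B g ->
  (forall Q j, cube Q -> \int[mu]_(x in Q) `|h Q j x| <= K * sigma Q) ->
  sigma_bounded (B * K) (coef g).
Proof.
move=> B0 gL gB hK Q j cQ.
have -> : coef g Q j = \sum_(S <- desc 1 Q) w S * (hsum (coef g) Q (pt S) * h Q j (pt S)).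
  have := dot_hsum (coef g) (fun _ i => (i == j)%:R) cQ.
  rewrite /dot (bigD1 j)//= eqxx mulr1 big1 ?addr0 => [->|i /negbTE ->]; last by rewrite mulr0.
  apply: eq_bigr => S _; congr (_ * (_ * _)).
  by rewrite /hsum (bigD1 j)//= eqxx mul1r big1 ?addr0// => i /negbTE ->; rewrite mul0r.
apply: le_trans (ler_norm_sum _ _ _) _.
rewrite -mulrA; apply: (@le_trans _ _ (B * \int[mu]_(x in Q) `|h Q j x|)); last first.
  by rewrite ler_pM2l//; exact: hK.
rewrite haar_L1E// mulr_sumr big_seq [leRHS]big_seq; apply: ler_sum => S Ss.
have /(mem_desc _ _ cQ)[cS _ _] := Ss.
rewrite !normrM [ `|w S| ]gtr0_norm ?w_gt0// mulrCA; apply: ler_wpM2r.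
  by rewrite mulr_ge0//; apply: ltW; exact: w_gt0.
rewrite hsum_coef//; have := bmo_avg gL gB cS; by rewrite (desc1_ancestor cQ Ss).
Qed.

(** * Uniqueness and synthesis *)

Lemma ae_cvgn (d : measure_display) (T : measurableType d) (nu : {measure set T -> \bar R})
    (E : set T) (f : nat -> T -> R) : measurable E -> (forall j, measurable_fun setT (f j)) ->
  (forall j, (\int[nu]_(t in E) `|f j.+1 t - f j t|%:E <= (1 / (2 ^ (j + 1))%:R)%:E)%E) ->
  \forall t \ae nu, E t -> cvgn (f ^~ t).
Proof.
move=> mE mf hf.
pose dd j (t : T) : \bar R := `|f j.+1 t - f j t|%:E.
have md j : measurable_fun E (dd j).
  by apply/measurable_EFinP; apply: measurableT_comp => //; apply: measurable_funB; apply: measurable_funTS.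
have d0 j t : E t -> (0 <= dd j t)%E by move=> _; rewrite lee_fin.
pose s (t : T) : \bar R := (\sum_(0 <= j <oo) dd j t)%E.
have ms : measurable_fun E s by apply: ge0_emeasurable_sum => // j t /d0; exact.
have s0 t : E t -> (0 <= s t)%E by move=> Ex; apply: nneseries_ge0 => j _ _; exact: d0.
have si : nu.-integrable E s.
  apply/integrableP; split => //; apply: (@le_lt_trans _ _ 1%E); last exact: ltry.
  rewrite (eq_integral s); last by move=> t /set_mem/s0 ?; rewrite gee0_abs.
  rewrite /s integral_nneseries//.
  have := @cvg_geometric_eseries_half R 1 0; rewrite expr0 divr1 => /cvg_lim <-//.
  apply: lee_nneseries => [j _ _|j _]; first by apply: integral_ge0 => t; exact: d0.
  exact: hf.
have := integrable_ae mE si; apply: filterS => t H Ex; have {H}fs := H Ex.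
have bd N : \sum_(0 <= j < N) `|f j.+1 t - f j t| <= fine (s t).
  rewrite -lee_fin fineK// -sumEFin; apply: nneseries_lim_ge => j _ _; exact: d0.
have c1 : cvgn [normed series (telescope (f ^~ t))].
  apply: nondecreasing_is_cvgn; first by apply: nondecreasing_series => m _ _; exact: normr_ge0.
  by exists (fine (s t)) => _ [N _ <-]; exact: bd.
have := normed_cvg c1; rewrite telescopeK => c2.
have -> : f ^~ t = (fun j => (f j t - f 0%N t) + f 0%N t) by apply/funext => j; rewrite subrK.
exact: is_cvgD c2 (is_cvg_cst _).
Qed.

(** One limit serves all sets E i at once, although the rate of convergence may depend on i. The
    renormalized series for BMO need this, since they are controlled only on cubes. *)
Lemma L1_complete (d : measure_display) (T : measurableType d) (nu : {measure set T -> \bar R})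
    (E : nat -> set T) (F : nat -> T -> R) :
  (forall i, measurable (E i)) -> (forall N, measurable_fun setT (F N)) ->
  (forall i N, nu.-integrable (E i) (EFin \o F N)) ->
  (forall i (e : R), 0 < e -> exists N0, forall N M, (N0 <= N)%N -> (N0 <= M)%N ->
     (\int[nu]_(t in E i) `|F N t - F M t|%:E <= e%:E)%E) ->
  exists G : T -> R, [/\ measurable_fun setT G, forall i, nu.-integrable (E i) (EFin \o G) &
    forall i (e : R), 0 < e -> exists N0, forall N, (N0 <= N)%N ->
     (\int[nu]_(t in E i) `|F N t - G t|%:E <= e%:E)%E].
Proof.
move=> mE mF iF CF.
have eps j : 0 < 1 / (2 ^ (j + 1))%:R :> R by rewrite divr_gt0// ltr0n expn_gt0.
have [phi hphi] : exists phi : nat -> nat, forall j i N M, (i <= j)%N ->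
    (phi j <= N)%N -> (phi j <= M)%N ->
    (\int[nu]_(t in E i) `|F N t - F M t|%:E <= (1 / (2 ^ (j + 1))%:R)%:E)%E.
  have H j : exists p, forall i N M, (i <= j)%N -> (p <= N)%N -> (p <= M)%N ->
    (\int[nu]_(t in E i) `|F N t - F M t|%:E <= (1 / (2 ^ (j + 1))%:R)%:E)%E.
    have [q hq] := choice (fun i => CF i _ (eps j)).
    exists (\max_(i < j.+1) q i) => i N M ij pN pM.
    have qi : (q i <= \max_(i < j.+1) q i)%N by exact: (@leq_bigmax _ (fun i : 'I_j.+1 => q i) (Ordinal (ij : (i < j.+1)%N))).
    by apply: hq; exact: leq_trans qi _.
  by have [phi hphi] := choice H; exists phi.
(* A nondecreasing sequence above [phi]: along it the increments on E i are geometrically small as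
   soon as the index exceeds i. *)
pose psi := fix psi j := if j is j'.+1 then maxn (phi j'.+1) (psi j') else phi 0%N.
have psi_phi j : (phi j <= psi j)%N by case: j => //= j; exact: leq_maxl.
have psiS j : (psi j <= psi j.+1)%N by exact: leq_maxr.
have psi_mono j k : (j <= k)%N -> (psi j <= psi k)%N.
  by elim: k => [|k ih]; rewrite leq_eqVlt => /predU1P[->//|//]; rewrite ltnS => /ih/leq_trans; apply.
have aec i : \forall t \ae nu, E i t -> cvgn (fun j => F (psi j) t).
  have H := @ae_cvgn _ _ nu (E i) (fun j => F (psi (j + i)%N)) (mE i) (fun j => mF _).
  have : \forall t \ae nu, E i t -> cvgn (fun j => F (psi (j + i)%N) t).
    apply: H => j; rewrite addSn.
    apply: (@le_trans _ _ (1 / (2 ^ (j + i + 1))%:R)%:E).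
      apply: hphi; [exact: leq_addl| |exact: psi_phi].
      exact: leq_trans (psi_phi _) (psiS _).
    rewrite lee_fin ler_pM2l// lef_pV2 ?posrE ?ltr0n ?expn_gt0// ler_nat leq_exp2l//.
    by rewrite leq_add2r leq_addr.
  apply: filterS => t hx /hx/cvg_ex[l hl]; apply/cvg_ex; exists l.
  by rewrite -(cvg_shiftn i).
(* The upper limit is measurable on the whole space; where the subsequence diverges, a null set
   within each E i, its value is irrelevant. *)
pose G (t : T) := fine (limn_esup (fun j => (F (psi j) t)%:E)).
have GE t : cvgn (fun j => F (psi j) t) -> F (psi j) t @[j --> \oo] --> G t.
  move=> c; suff -> : G t = limn (fun j => F (psi j) t) by [].
  have cE : (F (psi j) t)%:E @[j --> \oo] --> (limn (fun j => F (psi j) t))%:E.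
    by apply: cvg_EFin; first exact: nearW.
  by rewrite /G is_cvg_limn_esupE; [rewrite (cvg_lim _ cE)|apply/cvg_ex; eexists; exact: cE].
have mG : measurable_fun setT G.
  apply: measurableT_comp => //; apply: measurable_fun_limn_esup => j.
  exact/measurable_EFinP.
have close i (e : R) : 0 < e -> exists N0, forall N, (N0 <= N)%N ->
     (\int[nu]_(t in E i) `|F N t - G t|%:E <= e%:E)%E.
  move=> e0; have [j0 ij0 je] : exists2 j0, (i <= j0)%N & 1 / (2 ^ (j0 + 1))%:R < e :> R.
    have [k ke] := pow_small e0; exists (maxn i k); first exact: leq_maxl.
    apply: le_lt_trans ke; rewrite mul1r natrX -invr_expz lef_pV2 ?posrE ?exprn_gt0// ?exprz_gt0//.
    by rewrite -exprnP ler_eXn2l ?ltr1n// addn1 ltnW// ltnS leq_maxr.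
  exists (psi j0) => N N0N.
  pose g j (t : T) : \bar R := `|F N t - F (psi j) t|%:E.
  have mg j : measurable_fun (E i) (g j).
    by apply/measurable_EFinP; apply: measurableT_comp => //; apply: measurable_funB; apply: measurable_funTS.
  have g0 j t : E i t -> (0 <= g j t)%E by move=> _; rewrite lee_fin.
  apply: (@le_trans _ _ (\int[nu]_(t in E i) limn_einf (g ^~ t))%E).
    apply: ae_ge0_le_integral => //.
    - by apply/measurable_EFinP; apply: measurableT_comp => //; apply: measurable_funB; apply: measurable_funTS.
    - move=> t Ex; rewrite limn_einf_lim; apply: lime_ge; first exact: is_cvg_einfs.
      by apply: nearW => m; apply: le_ereal_inf_tmp => _ [k _ <-]; exact: g0.
    - under eq_fun do rewrite limn_einf_lim.
      apply: (emeasurable_fun_cvg (fun m t => einfs (g ^~ t) m)) => [m|t Ex]; last exact: is_cvg_einfs.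
      exact: measurable_fun_einfs.
    have := aec i; apply: filterS => t hx Ex; have cG := GE t (hx Ex).
    have cg : g j t @[j --> \oo] --> (`|F N t - G t|%:E).
      apply: cvg_EFin; first exact: nearW.
      by apply: cvg_norm; apply: cvgB => //; exact: cvg_cst.
    by rewrite is_cvg_limn_einfE; [rewrite (cvg_lim _ cg)|apply/cvg_ex; eexists; exact: cg].
  apply: le_trans (fatou nu (mE i) mg g0) _.
  rewrite limn_einf_lim; apply: lime_le; first exact: is_cvg_einfs.
  apply: nearW => m; apply: (@le_trans _ _ (\int[nu]_(t in E i) g (maxn m j0) t)%E).
    by apply: ereal_inf_lbound; exists (maxn m j0) => //; exact: leq_maxl.
  apply: le_trans (hphi j0 i N (psi (maxn m j0)) ij0 _ _) _.
  - exact: leq_trans (psi_phi _) N0N.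
  - by apply: leq_trans (psi_phi _) _; apply: psi_mono; exact: leq_maxr.
  by rewrite lee_fin; exact: ltW.
exists G; split => // i.
have [N0 hN0] := close i 1 ltr01.
have iD : nu.-integrable (E i) (EFin \o (fun t => F N0 t - G t)).
  apply/integrableP; split; last exact: le_lt_trans (hN0 N0 (leqnn _)) (ltry _).
  by apply/measurable_EFinP; apply: measurable_funB; apply: measurable_funTS.
have := integrableB (mE i) (iF i N0) iD; apply: eq_integrable => // t _ /=.
by rewrite -EFinB; congr EFin; ring.
Qed.

(** With all martingale differences equal to zero the averages cannot change along the chain of
    ancestors. *)
Lemma average_ancestor F i S : loc_int F -> (forall Q j, cube Q -> coef F Q j = 0) -> cube S ->
  average mu F (ancestor D i S) = average mu F S.
Proof.
move=> FL F0 cS; elim: i => [|i ih]; first by rewrite ancestor0.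
rewrite ancestorS// -ih; have cA := ancestor_cube i cS; have cA1 := ancestor_cube 1 cA.
have Ad : ancestor D i S \in desc 1 (ancestor D 1 (ancestor D i S)).
  by apply/mem_desc => //; apply/(descendantsP _ _ cA1); exact: desc_ancestor.
have := hsum_coef cA1 FL Ad; rewrite /hsum big1 => [/eqP|j _]; last by rewrite F0// mul0r.
by rewrite eq_sym subr_eq0 => /eqP.
Qed.

Lemma sub_is_ancestor Q S : cube Q -> cube S -> S `<=` Q -> Q = ancestor D `|gen S - gen Q|%N S.
Proof.
move=> cQ cS SQ; rewrite (ancestorE _ cS (pt_mem cS)); have := cube_sub_genE cS cQ SQ => gSQ.
have -> : gen S - `|gen S - gen Q|%N%:Z = gen Q by move: (gen S) (gen Q) gSQ => a b; lia.
by rewrite dcube_gen//; exact: SQ (pt_mem cS).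
Qed.

Lemma zero_coef_const F Q : loc_int F -> (forall Q j, cube Q -> coef F Q j = 0) -> cube Q ->
  \forall x \ae mu, Q x -> F x = average mu F Q.
Proof.
move=> FL F0 cQ; have L := loc_int_sub FL (loc_int_cst (average mu F Q)).
have := @cube_integral_eq0 Q (fun x => F x - average mu F Q) cQ (L.2 Q cQ).
move=> H; have {}H := H _; have : \forall x \ae mu, Q x -> (F x - average mu F Q)%:E = 0%E.
  apply: H => S cS SQ; rewrite intB//; last exact: loc_int_cst.
  rewrite int_cst// (avg_mul F cS) {1}(sub_is_ancestor cQ cS SQ) average_ancestor//.
  exact: subrr.
by apply: filterS => x /[apply] -[] /eqP; rewrite subr_eq0 => /eqP.
Qed.

Lemma cover_cubes (P : Rn -> Prop) : (forall Q, cube Q -> \forall x \ae mu, Q x -> P x) ->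
  \forall x \ae mu, P x.
Proof.
move=> H; have : \forall x \ae mu, forall i : nat, cenum i x -> P x.
  apply: ae_foralln => i; case: (cenumP i) => [/H//|->]; exact: aeW.
apply: filterS => x /(_ (cidx (dcube 0 x))); apply; rewrite cenumE//; exact: dcube_mem.
Qed.

(** Such an F is constant on each quadrant. A nonzero constant a would give integrals of size |a| mu
    over the ancestors of a cube, whose measures tend to infinity, against growth of order the
    square root of mu. *)
Lemma zero_coef_ae0 F (C1 C2 : R) : loc_int F -> (forall Q j, cube Q -> coef F Q j = 0) ->
  (forall Q, cube Q -> `|\int[mu]_(x in Q) F x| <= C1 + C2 * Num.sqrt (w Q)) ->
  \forall x \ae mu, F x = 0.
Proof.
move=> FL F0 FC; apply: cover_cubes => Q cQ.
suff aQ : average mu F Q = 0 by have := zero_coef_const FL F0 cQ; rewrite aQ.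
apply/eqP; apply: contraT => a0.
pose a := `|average mu F Q|; have ap : 0 < a by rewrite normr_gt0.
pose C := `|C1| + `|C2| + 1; have C0 : 0 < C by rewrite ltr_wpDl// addr_ge0.
pose A := (C / a) ^+ 2 + 1.
have [_ /(_ Q cQ)/cvgeyPge/(_ A)[N _ hN]] := hmu.
have := hN N (leqnn N); have cA := ancestor_cube N cQ.
rewrite /= -(wE cA) lee_fin; set W := w _ => AW.
have W0 : 0 < W by exact: w_gt0.
have s1 : 1 <= Num.sqrt W.
  rewrite -(@ler_pXn2r _ 2) ?nnegrE ?sqrtr_ge0// expr1n sqr_sqrtr ?(ltW W0)//.
  by apply: le_trans AW; rewrite /A lerDr sqr_ge0.
have sC : C / a < Num.sqrt W.
  rewrite -(@ltr_pXn2r _ 2) ?nnegrE ?sqrtr_ge0//; last by rewrite divr_ge0// ltW.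
  by rewrite sqr_sqrtr ?(ltW W0)//; apply: lt_le_trans AW; rewrite /A ltrDl.
have := FC _ cA; rewrite (avg_mul F cA) -/W average_ancestor// normrM -/a [ `|W| ]gtr0_norm//.
have -> : a * W = a * Num.sqrt W * Num.sqrt W by rewrite -mulrA -expr2 sqr_sqrtr// ltW.
rewrite leNgt => /negP; case.
have : C1 + C2 * Num.sqrt W <= (C - 1) * Num.sqrt W.
  have h1 : C1 <= `|C1| * Num.sqrt W by apply: le_trans (ler_norm _) _; rewrite ler_peMr.
  have h2 : C2 * Num.sqrt W <= `|C2| * Num.sqrt W by rewrite ler_wpM2r ?ler_norm// sqrtr_ge0.
  rewrite /C addrK mulrDl; lra.
have : C < a * Num.sqrt W by rewrite mulrC -ltr_pdivrMr.
have : 0 < Num.sqrt W by lra.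
move: (Num.sqrt W) => t t0 h1 h2.
have : C * t < a * t * t by rewrite ltr_pM2r.
lra.
Qed.

(** * Square functions along the enumeration of cubes *)

Definition cube_range (m k : nat) : seq (set Rn) := [seq cenum i | i <- iota m k & `[< cube (cenum i) >] ].

Lemma mem_cube_range m k P : P \in cube_range m k <-> cube P /\ (m <= cidx P < m + k)%N.
Proof.
split=> [/mapP[i]|[cP mP]].
  rewrite mem_filter mem_iota => /andP[/asboolP ci mi] ->; split => //.
  by rewrite cube_cenum.
apply/mapP; exists (cidx P); last by rewrite cenumE.
by rewrite mem_filter mem_iota cenumE// mP andbT; apply/asboolP.
Qed.

Lemma cube_range_uniq m k : uniq (cube_range m k).
Proof.
rewrite map_inj_in_uniq ?filter_uniq ?iota_uniq// => i i'.
rewrite !mem_filter => /andP[/asboolP ci _] /andP[/asboolP ci' _] e.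
by rewrite -(cube_cenum ci) e cube_cenum.
Qed.

Lemma cube_range_cat m k : cube_range 0 (m + k) = cube_range 0 m ++ cube_range m k.
Proof. by rewrite /cube_range iotaD add0n filter_cat map_cat. Qed.

Lemma cube_range_cube m k P : P \in cube_range m k -> cube P.
Proof. by move=> /mem_cube_range[]. Qed.

Lemma condexpE k f x : condexp D mu k f x = average mu f (dcube k x).
Proof.
rewrite /condexp -(fsbig_widen [set dcube k x]).
- by rewrite fsbig_set1 indicE mem_set ?mulr1//; exact: dcube_mem.
- by move=> _ ->.
move=> Q [kQ Qne] /=; rewrite indicE memNset ?mulr0// => Qx; apply: Qne.
by rewrite /= (dcube_eq kQ Qx).
Qed.

Lemma dcube_child k x : dcube k x \in desc 1 (dcube (k - 1) x).
Proof.
have := desc_mem 1 (dcube_cube (k - 1) x) (dcube_mem _ _).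
by rewrite gen_dcube subrK.
Qed.

Lemma martingale_diffE k f x : loc_int f ->
  martingale_diff D mu k f x = hsum (coef f) (dcube (k - 1) x) x.
Proof.
move=> fL; rewrite /martingale_diff/= !condexpE.
have c := dcube_cube (k - 1) x; have d := dcube_child k x.
by rewrite (hsum_child _ c d (dcube_mem _ _)) hsum_coef.
Qed.

Definition square_fun (a : set Rn -> J -> R) x : \bar R := ereal_sup (range (fun N => (sqa a (cube_range 0 N) x)%:E)).

Lemma sqa_mono a x : {homo (fun N => (sqa a (cube_range 0 N) x)%:E) : m k / (m <= k)%N >-> (m <= k)%E}.
Proof.
move=> m k mk; rewrite lee_fin ler_sqrt ?sum_hsum2_ge0// -(subnKC mk) cube_range_cat big_cat/=.
by rewrite lerDl sum_hsum2_ge0.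
Qed.

Lemma square_fun_ge0 a x : (0 <= square_fun a x)%E.
Proof.
apply: (@le_trans _ _ (sqa a (cube_range 0 0) x)%:E); first by rewrite lee_fin sqrtr_ge0.
by apply: ereal_sup_ubound; exists 0%N.
Qed.

(** At a given x only one cube per generation contributes, so sums over generations and over
    enumerated cubes have the same suprema. The generation shifts by one because the k-th martingale
    difference is a Haar term on a cube of generation k - 1. *)
Lemma square_functionE f x : loc_int f -> square_function D mu f x = square_fun (coef f) x.
Proof.
move=> fL; rewrite /square_function; set e := esum _ _.
pose a := coef f.
have eE : e = (\esum_(k in [set: int]) (hsum a (dcube (k - 1) x) x ^+ 2)%:E)%E.
  by congr esum; apply/funext => k; rewrite martingale_diffE// real_normK ?num_real.
have e0 : (0 <= e)%E by apply: esum_ge0 => k _; rewrite lee_fin exprn_ge0.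
have tE N : ((\sum_(P <- cube_range 0 N) hsum a P x ^+ 2)%:E = (sqa a (cube_range 0 N) x)%:E `^ 2)%E.
  by rewrite poweR_EFin powR_mulrn ?sqrtr_ge0// sqr_sqrtr// sum_hsum2_ge0.
have in0y (z : \bar R) : (0 <= z)%E -> z \in `[0%E, +oo%E] by move=> z0; rewrite in_itv/= z0 leey.
apply/eqP; rewrite eq_le; apply/andP; split.
- have g1 : square_fun a x = ((square_fun a x `^ 2) `^ 2^-1)%E.
    by rewrite -poweRrM divff ?pnatr_eq0// poweRe1// square_fun_ge0.
  rewrite g1; apply: gt0_ler_poweR; rewrite ?invr_ge0//; [exact: in0y|apply: in0y; exact: poweR_ge0|].
  rewrite eE; apply: ge_ereal_sup => _ [K [fK _] <-].
  rewrite fsbig_finite//=.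
  pose N := (\max_(k <- fset_set K) (cidx (dcube (k - 1)%R x)).+1)%N.
  apply: (@le_trans _ _ ((sqa a (cube_range 0 N) x)%:E `^ 2)%E); last first.
    apply: gt0_ler_poweR; rewrite ?ler0n//; [by apply: in0y; rewrite lee_fin sqrtr_ge0|by apply: in0y; exact: square_fun_ge0|].
    by apply: ereal_sup_ubound; exists N.
  rewrite -tE sumEFin lee_fin.
  rewrite -(big_map (fun k : int => dcube (k - 1) x) predT (fun P => hsum a P x ^+ 2)).
  apply: sum_seq_le.
  + rewrite map_inj_uniq ?fset_uniq// => k k' /(congr1 gen); rewrite !gen_dcube; lia.
  + exact: cube_range_uniq.
  + move=> P /mapP[k kK ->]; apply/mem_cube_range; split => //; rewrite add0n leq0n/=.
    by rewrite /N (big_rem k)//= leq_max ltnSn.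
  + by move=> P _; exact: sqr_ge0.
- apply: ge_ereal_sup => _ [N _ <-].
  have -> : (sqa a (cube_range 0 N) x)%:E = (((sqa a (cube_range 0 N) x)%:E `^ 2) `^ 2^-1)%E.
    by rewrite -poweRrM divff ?pnatr_eq0// poweRe1// lee_fin sqrtr_ge0.
  apply: gt0_ler_poweR; rewrite ?invr_ge0//; [apply: in0y; exact: poweR_ge0|exact: in0y|].
  rewrite -tE eE; apply: esum_ge.
  pose s := [seq gen P + 1 | P <- cube_range 0 N & `[< P x >] ].
  have us : uniq s.
    rewrite map_inj_in_uniq ?filter_uniq ?cube_range_uniq// => P P'.
    rewrite !mem_filter => /andP[/asboolP Px /cube_range_cube cP] /andP[/asboolP P'x /cube_range_cube cP'] gE.
    by rewrite -(dcube_gen cP Px) -(dcube_gen cP' P'x); congr dcube; lia.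
  exists [set` s]; first by split => //; exact: finite_seq.
  rewrite -fsbig_seq// sumEFin lee_fin [leRHS]big_map [leRHS]big_filter.
  rewrite [leLHS](bigID (fun P => `[< P x >]))/= [X in _ + X]big1_seq ?addr0; last first.
    by move=> P /andP[/asboolP nPx /cube_range_cube cP]; rewrite hsum_out ?expr0n.
  rewrite big_seq_cond [leRHS]big_seq_cond; apply: ler_sum => P /andP[/cube_range_cube cP /asboolP Px].
  by rewrite addrK dcube_gen.
Qed.

Lemma sqa_integral a A : (forall P, P \in A -> cube P) ->
  (\int[mu]_x (sqa a A x)%:E = (\int[mu]_x sqa a A x)%:E)%E.
Proof.
move=> cA; rewrite /Rintegral fineK//; apply: integrable_fin_num => //.
by apply: (int_setT_cubes cA (sqa_bdd_meas a cA)) => x nA; exact: sqa_out.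
Qed.

Lemma sqa_measurable a A : (forall P, P \in A -> cube P) ->
  measurable_fun setT (fun x => (sqa a A x)%:E).
Proof. by move=> cA; apply/measurable_EFinP; case: (sqa_bdd_meas a cA). Qed.

Lemma square_fun_lim a x : square_fun a x = limn (fun N => (sqa a (cube_range 0 N) x)%:E).
Proof. by rewrite (cvg_lim _ (ereal_nondecreasing_cvgn (@sqa_mono a x))). Qed.

Lemma H1_normE f : loc_int f -> H1_norm D mu f = (\int[mu]_x square_fun (coef f) x)%E.
Proof.
move=> fL; rewrite /H1_norm Lnorm1; apply: eq_integral => x _.
by rewrite square_functionE// gee0_abs// square_fun_ge0.
Qed.

Lemma measurable_square_fun a : measurable_fun setT (square_fun a).
Proof.
apply: (emeasurable_fun_cvg (fun N x => (sqa a (cube_range 0 N) x)%:E)) => [N|x _].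
  by apply: sqa_measurable => P; exact: cube_range_cube.
exact: ereal_nondecreasing_cvgn (@sqa_mono a x).
Qed.

Lemma H1_norm_ge f A : loc_int f -> uniq A -> (forall P, P \in A -> cube P) ->
  ((\int[mu]_x sqa (coef f) A x)%:E <= H1_norm D mu f)%E.
Proof.
move=> fL uA cA; rewrite H1_normE// -sqa_integral//; apply: ge0_le_integral => //.
- by move=> x _; rewrite lee_fin sqrtr_ge0.
- exact: sqa_measurable.
- exact: measurable_square_fun.
move=> x _; pose N := (\max_(P <- A) (cidx P).+1)%N.
apply: (@le_trans _ _ (sqa (coef f) (cube_range 0 N) x)%:E); last by apply: ereal_sup_ubound; exists N.
rewrite lee_fin ler_sqrt ?sum_hsum2_ge0//; apply: sum_seq_le => //.
- exact: cube_range_uniq.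
- move=> P PA; apply/mem_cube_range; split; first exact: cA.
  by rewrite add0n leq0n/= /N (big_rem P)//= leq_max ltnSn.
- by move=> P _; exact: sqr_ge0.
Qed.

Lemma H1_norm_le f (B : R) : loc_int f -> (forall N, \int[mu]_x sqa (coef f) (cube_range 0 N) x <= B) ->
  (H1_norm D mu f <= B%:E)%E.
Proof.
move=> fL hB; rewrite H1_normE//.
have mc := @cvg_monotone_convergence _ _ _ mu setT measurableT (fun N x => (sqa (coef f) (cube_range 0 N) x)%:E).
have {}mc := mc (fun N => sqa_measurable _ (@cube_range_cube 0 N)) (fun N x _ => _) (fun x _ => @sqa_mono _ x).
have cv : (\int[mu]_x (sqa (coef f) (cube_range 0 N) x)%:E @[N --> \oo] --> \int[mu]_x square_fun (coef f) x)%E.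
  under [X in _ --> X]eq_integral do rewrite square_fun_lim.
  by apply: mc => N x; rewrite lee_fin sqrtr_ge0.
rewrite -(cvg_lim _ cv)//; apply: lime_le; first by apply/cvg_ex; eexists; exact: cv.
apply: nearW => N; rewrite sqa_integral ?lee_fin//; exact: cube_range_cube.
Qed.

Lemma haar_orthonormal Q S i j : cube Q -> cube S ->
  \int[mu]_(x in S) (h Q i x * h S j x) = ((Q == S) && (i == j))%:R.
Proof.
move=> cQ cS; have [_ _ _ [_ orth _]] := hh.
by rewrite -pairing_int// (orth (Q, i) (S, j) cQ cS) xpair_eqE.
Qed.

Lemma loc_int_haar Q j : cube Q -> loc_int (h Q j).
Proof. by move=> cQ; exact/bdd_meas_loc_int/haar_bdd_meas. Qed.

Lemma coef_hsum c Q P j : cube Q -> cube P -> coef (hsum c Q) P j = if Q == P then c P j else 0.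
Proof.
move=> cQ cP; rewrite /coef pairing_int//.
transitivity (\int[mu]_(x in P) \sum_(k : J) (c Q k * (h Q k x * h P j x))).
  by apply: int_eq => x _; rewrite /hsum mulr_suml; apply: eq_bigr => k _; rewrite mulrA.
have L k : loc_int (fun x => h Q k x * h P j x) by apply: loc_int_mul; [exact: loc_int_haar|exact: haar_bdd_meas].
rewrite int_sum//; last by move=> k _; exact: loc_int_scale.
under eq_bigr do rewrite intZ// haar_orthonormal//.
have [->|QP] := eqVneq Q P; last by rewrite big1// => k _; rewrite mulr0.
rewrite (bigD1 j)//= eqxx mulr1 big1 ?addr0// => k kj.
by rewrite (negbTE kj) mulr0.
Qed.

Lemma coefD f g Q j : cube Q -> loc_int f -> loc_int g ->
  coef (fun x => f x + g x) Q j = coef f Q j + coef g Q j.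
Proof.
move=> cQ fL gL; rewrite /coef !pairing_int// -intD//; [|exact/loc_int_mul/haar_bdd_meas..].
by apply: int_eq => x _; rewrite mulrDl.
Qed.

Lemma coefZ c f Q j : cube Q -> loc_int f -> coef (fun x => c * f x) Q j = c * coef f Q j.
Proof.
move=> cQ fL; rewrite /coef !pairing_int// -intZ//; last exact/loc_int_mul/haar_bdd_meas.
by apply: int_eq => x _; rewrite mulrA.
Qed.

Lemma coefB f g Q j : cube Q -> loc_int f -> loc_int g ->
  coef (fun x => f x - g x) Q j = coef f Q j - coef g Q j.
Proof.
move=> cQ fL gL; rewrite /coef !pairing_int// -intB//; [|exact/loc_int_mul/haar_bdd_meas..].
by apply: int_eq => x _; rewrite mulrBl.
Qed.

Lemma coef_Fsum c A P j : uniq A -> (forall Q, Q \in A -> cube Q) -> cube P ->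
  coef (Fsum c A) P j = if P \in A then c P j else 0.
Proof.
move=> uA cA cP; elim: A uA cA => [_ _|Q A ih /=/andP[QA uA] cA].
  rewrite in_nil /coef pairing_int//; transitivity (\int[mu]_(x in P) (0 : R)).
    by apply: int_eq => x _; rewrite /Fsum big_nil mul0r.
  by rewrite int_cst// mul0r.
have cQ := cA Q (mem_head _ _).
have sA S : S \in A -> S \in Q :: A by rewrite inE orbC => ->.
have -> : Fsum c (Q :: A) = fun x => hsum c Q x + Fsum c A x.
  by apply/funext => x; rewrite /Fsum big_cons.
rewrite coefD//; [|exact/bdd_meas_loc_int/hsum_bdd_meas|by apply/bdd_meas_loc_int/Fsum_bdd_meas => S /sA; exact: cA].
rewrite ih//; last by move=> S /sA; exact: cA.
rewrite coef_hsum// inE eq_sym; have [->|_] := eqVneq P Q; last by rewrite add0r.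
by rewrite (negbTE QA) addr0.
Qed.

Lemma coef_close f g P j C : cube P -> loc_int f -> loc_int g -> (forall x, `|h P j x| <= C) ->
  `|coef f P j - coef g P j| <= C * \int[mu]_(x in P) `|f x - g x|.
Proof.
move=> cP fL gL hC; rewrite -coefB// /coef pairing_int//; have L := loc_int_sub fL gL.
have Lh : loc_int (fun x => (f x - g x) * h P j x) by exact/loc_int_mul/haar_bdd_meas.
apply: le_trans (int_norm cP Lh) _; rewrite -intZ//; last exact: loc_int_norm.
apply: int_le => //; [exact: loc_int_norm|by apply: loc_int_scale; exact: loc_int_norm|].
by move=> x _; rewrite normrM mulrC ler_wpM2r.
Qed.

Lemma coef_lim F (FN : nat -> Rn -> R) P j c : cube P -> loc_int F -> (forall N, loc_int (FN N)) ->
  (forall e, 0 < e -> exists N0, forall N, (N0 <= N)%N -> \int[mu]_(x in P) `|FN N x - F x| <= e) ->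
  (exists N1, forall N, (N1 <= N)%N -> coef (FN N) P j = c) -> coef F P j = c.
Proof.
move=> cP FL NL lim [N1 hN1]; have [_ [C hC]] := haar_bdd_meas j cP.
have C0 : 0 <= C by apply: le_trans (hC (pt P)).
apply/eqP; rewrite eq_sym -subr_eq0 -normr_le0; apply/ler_addgt0Pr => e e0; rewrite add0r.
have e1 : 0 < e / (C + 1) by rewrite divr_gt0// ltr_wpDl.
have [N0 hN0] := lim _ e1.
rewrite -(hN1 (maxn N0 N1)) ?leq_maxr//; apply: le_trans (coef_close cP (NL _) FL hC) _.
apply: (@le_trans _ _ (C * (e / (C + 1)))); first by apply: ler_wpM2l => //; apply: hN0; exact: leq_maxl.
rewrite mulrA ler_pdivrMr ?ltr_wpDl// mulrC; apply: ler_wpM2l; first exact: ltW.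
by rewrite lerDl.
Qed.

Lemma mono_cauchy (u : nat -> R) B e : {homo u : m k / (m <= k)%N >-> m <= k} ->
  (forall N, u N <= B) -> 0 < e -> exists N0, forall m k, (N0 <= m)%N -> (m <= k)%N -> u k - u m <= e.
Proof.
move=> um uB e0; have hs : has_sup (range u).
  by split; [exists (u 0%N), 0%N|exists B => _ [N _ <-]].
have [_ [N0 _ <-] hN0] := sup_adherent e0 hs.
exists N0 => m k N0m mk; have := um _ _ N0m; have : u k <= sup (range u).
  by apply: sup_upper_bound => //; exists k.
lra.
Qed.

(** * Synthesis of integrable functions from coefficients *)

Lemma Fsum_integrable c A : (forall P, P \in A -> cube P) -> mu.-integrable setT (EFin \o Fsum c A).
Proof.
move=> cA; apply: (int_setT_cubes cA (Fsum_bdd_meas c cA)) => x nA.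
by rewrite /Fsum big1_seq// => P /andP[_ PA]; rewrite hsum_out//; [exact: cA|exact: nA].
Qed.

Lemma sqa_integrable a A : (forall P, P \in A -> cube P) -> mu.-integrable setT (EFin \o sqa a A).
Proof. by move=> cA; apply: (int_setT_cubes cA (sqa_bdd_meas a cA)) => x nA; exact: sqa_out. Qed.

(** Pointwise, with a and b the square functions over the longer and the shorter range, the square
    function of the tail is the root of (a - b)(a + b) <= 2 (a - b) a. The weighted mean inequality
    with parameter e bounds it by e a + (a - b) / (2 e), whose last term is small once the integrals
    have nearly converged. *)
Lemma sqa_int_cat c m k (e : R) : 0 < e ->
  \int[mu]_x sqa c (cube_range m k) x <= e * (\int[mu]_x sqa c (cube_range 0 (m + k)) x) +
   (\int[mu]_x sqa c (cube_range 0 (m + k)) x - \int[mu]_x sqa c (cube_range 0 m) x) / (2 * e).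
Proof.
move=> e0; have I N l := sqa_integrable c (@cube_range_cube N l).
have i1 := integrableZl measurableT e (I 0%N (m + k)%N).
have i2 := integrableB measurableT (I 0%N (m + k)%N) (I 0%N m).
have i3 := integrableZl measurableT (2 * e)^-1 i2.
have i4 := integrableD measurableT i1 i3.
rewrite -RintegralB//; [|exact: I..].
rewrite [X in _ + X]mulrC.
have -> := esym (RintegralZl e measurableT (I 0%N (m + k)%N)).
have -> := esym (RintegralZl (2 * e)^-1 measurableT i2).
rewrite -RintegralD//.
apply: le_Rintegral => //.
move=> x _; rewrite /sqa cube_range_cat big_cat/=.
have := sum_hsum2_ge0 c (cube_range 0 m) x; have := sum_hsum2_ge0 c (cube_range m k) x.
move: (\sum_(P <- cube_range m k) _) (\sum_(P <- cube_range 0 m) _) => z y z0 y0.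
have := sqr_sqrtr z0; have := sqr_sqrtr (addr_ge0 y0 z0); have := sqr_sqrtr y0.
have : Num.sqrt y <= Num.sqrt (y + z) by rewrite ler_sqrt ?addr_ge0// lerDl.
have := sqrtr_ge0 z; have := sqrtr_ge0 y; have := sqrtr_ge0 (y + z).
move: (Num.sqrt z) (Num.sqrt y) (Num.sqrt (y + z)) => c' b a a0 b0 c0 ba b2 a2 c2.
have E : c' ^+ 2 = (a - b) * (a + b) by rewrite c2 mulrDr !mulrBl; lra.
have d0 : 0 <= (a - b) / (2 * e) by rewrite divr_ge0 ?mulr_ge0 ?(ltW e0)// subr_ge0.
rewrite [_^-1 * _]mulrC -(@ler_pXn2r _ 2) ?nnegrE//; last first.
  by apply: addr_ge0 => //; apply: mulr_ge0 => //; exact: ltW.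
rewrite E.
have -> : (a - b) * (a + b) = ((a - b) / (2 * e)) * (2 * e * (a + b)).
  by rewrite mulrA -[_ / _ * _]mulrA mulVf ?mulr1// mulf_neq0 ?pnatr_eq0 ?gt_eqF.
move: ((a - b) / (2 * e)) d0 => d d0.
have : d * (2 * e * (a + b)) <= d * (2 * e * (a + a)).
  apply: ler_wpM2l => //; apply: ler_wpM2l; first by rewrite mulr_ge0// ltW.
  by rewrite lerD2l.
have := sqr_ge0 (e * a - d).
rewrite !expr2; nra.
Qed.

Lemma loc_int_integrable f : mu.-integrable setT (EFin \o f) -> loc_int f.
Proof.
move=> fi; split; first by have /integrableP[/measurable_EFinP] := fi.
move=> Q cQ; apply: integrableS fi => //; exact: cube_measurable.
Qed.

Lemma sub_setT_int Q f : cube Q -> mu.-integrable setT (EFin \o f) ->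
  \int[mu]_(x in Q) `|f x| <= \int[mu]_x `|f x|.
Proof.
move=> cQ fi; have mQ := cube_measurable cQ.
have /integrableP[mf _] := fi.
have iN : mu.-integrable setT (EFin \o (fun x => `|f x|)) by exact: (integrable_norm fi).
rewrite -lee_fin /Rintegral !fineK; [|exact: integrable_fin_num|].
- apply: ge0_subset_integral => //.
  by apply/measurable_EFinP; apply: measurableT_comp => //; exact/measurable_EFinP.
- by apply: integrable_fin_num => //; exact: integrableS iN.
Qed.

(** The integrals of the partial square functions increase to a finite limit, so [sqa_int_cat] makes
    the tails small and Davis' inequality turns this into a Cauchy condition in L^1. *)
Lemma hardy_synthesis c (B : R) : (forall A, uniq A -> (forall P, P \in A -> cube P) ->
    \int[mu]_x sqa c A x <= B) ->
  exists F, mu.-integrable setT (EFin \o F) /\ forall P j, cube P -> coef F P j = c P j.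
Proof.
move=> hB; have [C C0 hC] := davis.
pose FN N := Fsum c (cube_range 0 N); pose I N := \int[mu]_x sqa c (cube_range 0 N) x.
have FI N : mu.-integrable setT (EFin \o FN N) by apply: Fsum_integrable => P; exact: cube_range_cube.
have IB N : I N <= B by apply: hB; [exact: cube_range_uniq|move=> P; exact: cube_range_cube].
have Imono : {homo I : m k / (m <= k)%N >-> m <= k}.
  move=> m k mk; apply: le_Rintegral => //; [by apply: sqa_integrable => P; exact: cube_range_cube..|].
  by move=> x _; have := sqa_mono c x mk; rewrite lee_fin.
have B0 : 0 <= B by apply: le_trans (IB 0%N); apply: Rintegral_ge0 => x _; exact: sqrtr_ge0.
have NE N M : (\int[mu]_x `|FN N x - FN M x|%:E = (\int[mu]_x `|FN N x - FN M x|)%:E)%E.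
  rewrite /Rintegral fineK//; apply: integrable_fin_num => //.
  exact: integrable_norm (integrableB measurableT (FI N) (FI M)).
have cauchy (e : R) : 0 < e -> exists N0, forall N M, (N0 <= N)%N -> (N0 <= M)%N ->
     (\int[mu]_x `|FN N x - FN M x|%:E <= e%:E)%E.
  (* For this t the tail costs C (t B + t) = e / 2; the tolerance 2 t^2 for the increments of I
     becomes t after division by 2 t. *)
  move=> e0; have [t t0 tE] : exists2 t, 0 < t & t * (2 * C * (B + 1)) = e.
    have d0 : 0 < 2 * C * (B + 1) by rewrite !mulr_gt0// ltr_wpDl.
    by exists (e / (2 * C * (B + 1))); rewrite ?divr_gt0// divfK// gt_eqF.
  have t2 : 0 < t * (2 * t) by rewrite !mulr_gt0.
  have [N0 hN0] := mono_cauchy Imono IB t2.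
  have main m k : (N0 <= m)%N -> (m <= k)%N -> \int[mu]_x `|FN k x - FN m x| <= e.
    move=> N0m mk; rewrite -(subnKC mk).
    have FE x : FN (m + (k - m))%N x - FN m x = Fsum c (cube_range m (k - m)) x.
      by rewrite /FN /Fsum cube_range_cat big_cat/= addrAC subrr add0r.
    under eq_Rintegral do rewrite FE.
    apply: le_trans (hC _ _ (cube_range_uniq _ _) (@cube_range_cube _ _)) _.
    have := sqa_int_cat c m (k - m) t0; rewrite subnKC// -/(I k) -/(I m) => h1.
    apply: (@le_trans _ _ (C * (t * B + t))).
      apply: ler_wpM2l; first exact: ltW.
      apply: le_trans h1 _; apply: lerD; first by apply: ler_wpM2l (IB k); exact: ltW.
      by rewrite ler_pdivrMr ?mulr_gt0//; exact: hN0.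
    have -> : C * (t * B + t) = t * (2 * C * (B + 1)) / 2 by field.
    by rewrite tE; lra.
  exists N0 => N M N0N N0M; rewrite NE lee_fin; case: (leqP M N) => [|/ltnW] NM; first exact: main.
  by under eq_Rintegral do rewrite distrC; exact: main.
have [||||F [mF Fi Flim]] := @L1_complete _ _ mu (fun=> setT) FN.
- by [].
- by move=> N; apply/measurable_EFinP; have /integrableP[] := FI N.
- by [].
- by move=> _; exact: cauchy.
have FT := Fi 0%N; exists F; split => // P j cP.
apply: (coef_lim cP (loc_int_integrable FT) (fun N => loc_int_integrable (FI N))).
  move=> e e0; have [N0 hN0] := Flim 0%N e e0; exists N0 => N /hN0 h1.
  have DI : mu.-integrable setT (EFin \o (fun x => FN N x - F x)).
    exact: (integrableB measurableT (FI N) FT).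
  apply: le_trans (sub_setT_int cP DI) _; rewrite -lee_fin; apply: le_trans h1.
  rewrite /Rintegral fineK//; apply: integrable_fin_num => //; exact: (integrable_norm DI).
exists (cidx P).+1 => N PN; rewrite coef_Fsum ?cube_range_uniq//; last by move=> Q; exact: cube_range_cube.
by have -> : P \in cube_range 0 N by apply/mem_cube_range; rewrite add0n.
Qed.

(** * Square integrable functions and the coefficients of T *)

Lemma L2_sqr f : f \in Lfun mu 2%:E -> mu.-integrable setT (EFin \o (fun x => f x ^+ 2)).
Proof.
move=> /Lfun2P[mf fi]; apply/integrableP; split.
  by apply/measurable_EFinP; exact: measurable_funX.
by under eq_integral do rewrite abse_EFin normrX.
Qed.

Lemma L2_loc_int f : f \in Lfun mu 2%:E -> loc_int f.
Proof.
move=> f2; have f2i := loc_int_integrable (L2_sqr f2); have /Lfun2P[mf _] := f2.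
split => // Q cQ; have LS := loc_int_add (loc_int_cst 1) f2i.
apply: (le_integrable _ _ _ (LS.2 Q cQ)); first exact: cube_measurable.
- by apply/measurable_EFinP; exact: measurable_funTS.
move=> x _ /=; rewrite lee_fin [leRHS]ger0_norm ?addr_ge0 ?sqr_ge0//.
rewrite -real_normK ?num_real//; have := sqr_ge0 (`|f x| - 1).
rewrite sqrrB1 -mulr_natl; have := normr_ge0 (f x); lra.
Qed.

(** Cauchy-Schwarz in additive form, 2 sqrt(w) |f| <= 1 + w f^2 integrated over Q; the size of the
    constant does not matter. *)
Lemma L2_cube_bound f : f \in Lfun mu 2%:E ->
  exists C : R, forall Q, cube Q -> `|\int[mu]_(x in Q) f x| <= C * Num.sqrt (w Q).
Proof.
move=> f2; have fL := L2_loc_int f2; have fi := L2_sqr f2; have sL := loc_int_integrable fi.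
exists (1 + \int[mu]_x (`|f x ^+ 2|)) => Q cQ; have w0 := w_gt0 cQ.
have t0 : 0 < Num.sqrt (w Q) by rewrite sqrtr_gt0.
apply: le_trans (int_norm cQ fL) _.
rewrite -(ler_pM2l t0); rewrite -intZ//; last exact: loc_int_norm.
apply: (@le_trans _ _ (\int[mu]_(x in Q) (1 + w Q * f x ^+ 2))).
  apply: int_le => //; [by apply: loc_int_scale; exact: loc_int_norm| |].
    by apply: loc_int_add; [exact: loc_int_cst|exact: loc_int_scale].
  move=> x _; rewrite -{2}(sqr_sqrtr (ltW w0)) -(@real_normK _ (f x)) ?num_real//.
  have := sqr_ge0 (Num.sqrt (w Q) * `|f x| - 1); rewrite !expr2; have := normr_ge0 (f x); nra.
rewrite intD//; [|exact: loc_int_cst|exact: loc_int_scale].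
rewrite int_cst// intZ// mulrCA -expr2 sqr_sqrtr ?(ltW w0)// mulrDl mul1r lerD2l.
rewrite mulrC ler_pM2r//.
apply: le_trans (sub_setT_int cQ fi); apply: int_le => //; first exact: loc_int_norm.
by move=> x _; exact: ler_norm.
Qed.

Lemma coef_L2_small f P j (e : R) : cube P -> f \in Lfun mu 2%:E -> 0 < e ->
  ('N[mu]_2%:E[EFin \o f] <= e%:E)%E -> `|coef f P j| <= e.
Proof.
move=> cP f2 e0 fe; have := Lnorm2_lt_int (ltW e0) fe => {}fe.
have fL := L2_loc_int f2; have fi := L2_sqr f2; have sL := loc_int_integrable fi.
have hB := haar_bdd_meas j cP; have hL := loc_int_haar j cP.
have fhL := loc_int_mul fL hB; have h2L := loc_int_mul hL hB.
rewrite /coef pairing_int//; apply: le_trans (int_norm cP fhL) _.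
rewrite -(ler_pM2l e0) -intZ//; last exact: loc_int_norm.
apply: (@le_trans _ _ (\int[mu]_(x in P) (2^-1 * f x ^+ 2 + e ^+ 2 / 2 * (h P j x * h P j x)))).
  apply: int_le => //; [by apply: loc_int_scale; exact: loc_int_norm| |].
    by apply: loc_int_add; exact: loc_int_scale.
  move=> x _; rewrite normrM -(@real_normK _ (f x)) ?num_real//.
  rewrite -[h P j x * h P j x]expr2 -(@real_normK _ (h P j x)) ?num_real//.
  have := sqr_ge0 (e * `|h P j x| - `|f x|); rewrite !expr2.
  move: `|h P j x| `|f x| => u v; lra.
rewrite intD//; [|exact: loc_int_scale|exact: loc_int_scale].
rewrite !intZ// haar_orthonormal// !eqxx/= mulr1.
suff : \int[mu]_(x in P) (f x ^+ 2) <= e ^+ 2 by rewrite !expr2; lra.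
apply: (@le_trans _ _ (\int[mu]_x (`|f x ^+ 2|))).
  apply: le_trans (sub_setT_int cP fi); apply: int_le => //; first exact: loc_int_norm.
  by move=> x _; exact: ler_norm.
rewrite -lee_fin; apply: le_trans fe; rewrite /Rintegral fineK.
  by under eq_integral do rewrite normrX.
by apply: integrable_fin_num => //; exact: (integrable_norm fi).
Qed.

Lemma coef_sum (I : eqType) (s : seq I) (F : I -> Rn -> R) P j : cube P ->
  (forall i, i \in s -> loc_int (F i)) ->
  coef (fun x => \sum_(i <- s) F i x) P j = \sum_(i <- s) coef (F i) P j.
Proof.
move=> cP FL; rewrite /coef pairing_int//.
transitivity (\int[mu]_(x in P) (\sum_(i <- s) F i x * h P j x)).
  by apply: int_eq => x _; rewrite mulr_suml.
rewrite (int_sum (F := fun i x => F i x * h P j x))//; last by move=> i /FL L; apply: loc_int_mul => //; exact: haar_bdd_meas.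
by apply: eq_bigr => i _; rewrite pairing_int.
Qed.

Lemma haar_norm2 Q j : cube Q -> ('N[mu]_2%:E[EFin \o h Q j] <= 1)%E.
Proof.
move=> cQ; have N0 := Lnorm_ge0 mu 2%:E (EFin \o h Q j).
have : ('N[mu]_2%:E[EFin \o h Q j] `^ 2 = 1)%E.
  rewrite Lnorm2_sqr -[RHS]/((1%:R)%:E) -[1%N]/(nat_of_bool true).
  have := haar_orthonormal j j cQ cQ; rewrite !eqxx/= => <-.
  rewrite -(@int_setT Q (fun x => h Q j x * h Q j x)); last by move=> x nQ; rewrite haar_out// mul0r.
  rewrite /Rintegral fineK; last first.
    have := integrable_fin_num measurableT (L2_sqr (haar_L2 j cQ)).
    by congr (_ \is a fin_num); apply: eq_integral => x _ /=; rewrite expr2.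
  by apply: eq_integral => x _; rewrite real_normK ?num_real// expr2.
move: N0; case: ('N[mu]_2%:E[_])%E => [t||]//=.
  rewrite lee_fin => t0; rewrite powR_mulrn// => -[] t2.
  by rewrite lee_fin -(@ler_pXn2r _ 2) ?nnegrE// t2 expr1n.
by rewrite pnatr_eq0.
Qed.

(** Coefficients are continuous on L^2, so they may be computed from finite partial sums of the
    defining series. The coefficient at S receives a contribution only from the cube Q that is the
    s-th ancestor of S. Testing T on a single Haar function h_P isolates one entry of beta and
    bounds it by the operator norm. *)
Lemma shift_coefs r s T : haar_shift D mu h r s T -> bounded_operator (L2 mu) T ->
  exists2 A0 : R, 0 <= A0 & exists beta,
    (forall S P, cube S -> P \in nbr s r S -> `|beta S P| <= A0) /\
    forall f, f \in Lfun mu 2%:E -> forall S j, cube S ->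
      coef (T f) S j = shift beta s r (coef f) S j.
Proof.
move=> [alpha hT] [T2 _ _ [C hC]].
pose beta S P := alpha (ancestor D s S) P S.
have TE f : f \in Lfun mu 2%:E -> forall S j, cube S -> coef (T f) S j = shift beta s r (coef f) S j.
  move=> f2 S j cS; have Tf2 : T f \in Lfun mu 2%:E by exact: (T2 f f2).
  pose Qs := ancestor D s S; have cQs : cube Qs := ancestor_cube s cS.
  pose c Q (P : set Rn) (k : J) := \sum_(P' <- desc r Q) alpha Q P' P * \sum_k' coef f P' k'.
  have termE Q : cube Q -> (fun x => \sum_(P \in descendants D r Q)
                    \sum_(S \in descendants D s Q)
                    \sum_(j : J) \sum_(j' : J)
                      alpha Q P S * pairing mu f (h P j) * h S j' x) = Fsum (c Q) (desc s Q).
    move=> cQ; apply/funext => x; have [fr _] := desc_fin r cQ; have [fs _] := desc_fin s cQ.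
    rewrite fsbig_finite//=; under eq_bigr do rewrite fsbig_finite//=.
    rewrite exchange_big/= /Fsum; apply: eq_bigr => P _.
    rewrite /hsum /c.
    under [RHS]eq_bigr do rewrite mulr_suml.
    rewrite [RHS]exchange_big/=; apply: eq_bigr => P' _.
    rewrite exchange_big/=; apply: eq_bigr => k _.
    by rewrite mulr_sumr mulr_suml; apply: eq_bigr => k' _.
  apply/eqP; rewrite -subr_eq0 -normr_le0; apply/ler_addgt0Pr => e e0; rewrite add0r.
  have [J0 [fJ0 J0c hJ]] := hT f f2 e e0.
  (* Adjoining the s-th ancestor of S to the finite set ensures that the only relevant term is
     present. *)
  have /= := hJ (J0 `|` [set Qs]); rewrite finite_setU => /(_ (conj fJ0 (finite_set1 _)) (@subsetUl _ _ _)).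
  set K := J0 `|` _ => hK.
  have cK Q : K Q -> cube Q by case => [/J0c//|->].
  have fK : finite_set K by rewrite finite_setU.
  have {}hK := hK cK.
  pose F Q := Fsum (c Q) (desc s Q).
  have cK' Q : Q \in (fset_set K : seq _) -> cube Q by rewrite in_fset_set// inE; exact: cK.
  have FB Q : Q \in (fset_set K : seq _) -> bdd_meas (F Q).
    by move=> /cK' cQ; apply: Fsum_bdd_meas => P /(mem_desc _ _ cQ)[].
  pose g x := T f x - \sum_(Q <- fset_set K) F Q x.
  have gE : (fun x => T f x - \sum_(Q \in K) \sum_(P \in descendants D r Q)
                    \sum_(S \in descendants D s Q)
                    \sum_(j : J) \sum_(j' : J)
                      alpha Q P S * pairing mu f (h P j) * h S j' x) = g.
    apply/funext => x; rewrite fsbig_finite//=; congr (_ - _).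
    by apply: eq_big_seq => Q /cK' cQ; rewrite /F -termE.
  rewrite gE in hK.
  have TL := L2_loc_int Tf2; have SL := loc_int_sum (fun Q h => bdd_meas_loc_int (FB Q h)).
  have mg : measurable_fun setT g by case: (loc_int_sub TL SL).
  have g2 : g \in Lfun mu 2%:E.
    apply/Lfun2P; split => //; apply: le_lt_trans (Lnorm2_lt_int (ltW e0) (ltW hK)) (ltry _).
  have := coef_L2_small j cS g2 e0 (ltW hK); rewrite /g coefB// coef_sum//; last by move=> Q /FB/bdd_meas_loc_int.
  suff -> : \sum_(Q <- fset_set K) coef (F Q) S j = shift beta s r (coef f) S j by [].
  have QsK : Qs \in (fset_set K : seq _) by rewrite in_fset_set// inE; right.
  have FE Q : cube Q -> coef (F Q) S j = if S \in desc s Q then c Q S j else 0.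
    by move=> cQ; rewrite /F coef_Fsum ?desc_uniq// => P /(mem_desc _ _ cQ)[].
  rewrite (bigD1_seq Qs QsK (fset_uniq _))/= big1_seq ?addr0 => [|Q /andP[QQs /cK' cQ]].
    rewrite FE//; have -> : S \in desc s Qs; last by [].
    by apply/(mem_desc _ _ cQs)/(descendantsP _ _ cQs); exact: desc_ancestor.
  rewrite FE//; case: ifP => // /(mem_desc _ _ cQ)/(descendantsP _ _ cQ)/(ancestor_desc cQ) E.
  by rewrite -E eqxx in QQs.
(* [C] comes without a sign, and [coef_L2_small] asks for a positive bound. *)
exists (`|C| + 1); first by rewrite addr_ge0.
exists beta; split=> // S P cS PS; have cP := nbr_cube cS PS.
pose j := Ordinal J_gt0.
have := TE _ (haar_L2 j cP) S j cS; rewrite /shift.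
rewrite (bigD1_seq P PS (desc_uniq _ _))/= [X in _ + X]big1_seq ?addr0 => [|P' /andP[PP' P'S]].
  rewrite (bigD1 j)//= big1 => [|k kj]; last first.
    by rewrite /coef pairing_int// haar_orthonormal// eqxx eq_sym (negbTE kj).
  rewrite addr0 [coef (h P j) P j]/coef (pairing_int _ _ cP) haar_orthonormal// !eqxx mulr1 => <-.
  have C0 : 0 < `|C| + 1 by rewrite ltr_wpDl.
  apply: (coef_L2_small j cS (T2 _ (haar_L2 j cP)) C0).
  apply: le_trans (hC _ (haar_L2 j cP)) _ => /=.
  apply: (@le_trans _ _ (`|C|%:E * 'N[mu]_2%:E[EFin \o h P j])%E).
    by apply: lee_wpmul2r; [exact: Lnorm_ge0|rewrite lee_fin ler_norm].
  apply: (@le_trans _ _ (`|C|%:E * 1)%E).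
    by apply: lee_wpmul2l; [rewrite lee_fin|exact: haar_norm2].
  by rewrite mule1 lee_fin lerDl.
rewrite big1 ?mulr0// => k _; have cP' := nbr_cube cS P'S.
by rewrite /coef pairing_int// haar_orthonormal// eq_sym (negbTE PP').
Qed.

Lemma coef_ae f g Q j : cube Q -> loc_int f -> loc_int g -> f = g %[ae mu] -> coef f Q j = coef g Q j.
Proof.
move=> cQ fL gL fg; rewrite /coef !pairing_int//; congr fine.
have hB := haar_bdd_meas j cQ.
apply: ae_eq_integral; first exact: cube_measurable.
- by apply/measurable_EFinP/measurable_funTS; case: (loc_int_mul fL hB).
- by apply/measurable_EFinP/measurable_funTS; case: (loc_int_mul gL hB).
by apply: filterS fg => x /= e _; rewrite e.
Qed.

(** A growth condition common to integrable functions, with C2 = 0, and square integrable ones, with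
    C1 = 0. It is what allows T' f and T f to be compared although they lie in different spaces. *)
Definition tame f := exists C1 C2 : R, forall Q, cube Q ->
  `|\int[mu]_(x in Q) f x| <= C1 + C2 * Num.sqrt (w Q).

Lemma coef_inj F G : loc_int F -> loc_int G -> tame F -> tame G ->
  (forall Q j, cube Q -> coef F Q j = coef G Q j) -> F = G %[ae mu].
Proof.
move=> FL GL [A1 [A2 hA]] [B1 [B2 hB]] E.
have : \forall x \ae mu, F x - G x = 0.
  apply: (@zero_coef_ae0 _ (A1 + B1) (A2 + B2)); first exact: loc_int_sub.
    by move=> Q j cQ; rewrite coefB// E// subrr.
  move=> Q cQ; rewrite intB//; apply: le_trans (ler_normB _ _) _.
  have := hA _ cQ; have := hB _ cQ; lra.
by apply: filterS => x /eqP; rewrite subr_eq0 => /eqP.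
Qed.

Lemma tame_L1 f : mu.-integrable setT (EFin \o f) -> tame f.
Proof.
move=> fi; exists (\int[mu]_x `|f x|), 0 => Q cQ; rewrite mul0r addr0.
exact: le_trans (int_norm cQ (loc_int_integrable fi)) (sub_setT_int cQ fi).
Qed.

Lemma tame_L2 f : f \in Lfun mu 2%:E -> tame f.
Proof. by move=> /L2_cube_bound[C hC]; exists 0, C => Q /hC; rewrite add0r. Qed.

Lemma shift_linear beta i j (a : R) (f g u : set Rn -> J -> R) P k : cube P ->
  (forall Q l, cube Q -> u Q l = a * f Q l + g Q l) ->
  shift beta i j u P k = a * shift beta i j f P k + shift beta i j g P k.
Proof.
move=> cP E; rewrite /shift mulr_sumr -big_split/=; apply: eq_big_seq => S /(nbr_cube cP) cS.
under eq_bigr do rewrite E//.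
by rewrite big_split/= -mulr_sumr; ring.
Qed.

Lemma eq_shift beta i j (f g : set Rn -> J -> R) P k : cube P ->
  (forall Q l, cube Q -> f Q l = g Q l) -> shift beta i j f P k = shift beta i j g P k.
Proof.
move=> cP E; apply: eq_big_seq => S /(nbr_cube cP) cS; congr (_ * _).
by apply: eq_bigr => l _; rewrite E.
Qed.

Lemma sqa_add (a : R) f g u A x : (forall P j, P \in A -> u P j = a * f P j + g P j) ->
  sqa u A x <= 2 * `|a| * sqa f A x + 2 * sqa g A x.
Proof.
move=> E.
rewrite {1}/sqa.
have -> : \sum_(P <- A) hsum u P x ^+ 2 = \sum_(P <- A) (a * hsum f P x + hsum g P x) ^+ 2.
  apply: eq_big_seq => P PA; congr (_ ^+ 2); rewrite /hsum mulr_sumr -big_split/=.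
  by apply: eq_bigr => j _; rewrite E//; ring.
have h1 : \sum_(P <- A) (a * hsum f P x + hsum g P x) ^+ 2 <=
    2 * a ^+ 2 * sqa f A x ^+ 2 + 2 * sqa g A x ^+ 2.
  rewrite !sqr_sqrtr ?sum_hsum2_ge0// !mulr_sumr -big_split/=; apply: ler_sum => P _.
  have := sqr_ge0 (a * hsum f P x - hsum g P x); rewrite sqrrB sqrrD exprMn; lra.
have g0 := sqrtr_ge0 (\sum_(P <- A) hsum g P x ^+ 2).
have f0 := sqrtr_ge0 (\sum_(P <- A) hsum f P x ^+ 2).
rewrite -/(sqa f A x) in f0 *; rewrite -/(sqa g A x) in g0 *.
have t0 : 0 <= 2 * `|a| * sqa f A x + 2 * sqa g A x by rewrite addr_ge0 ?mulr_ge0.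
rewrite -(ger0_norm t0) -sqrtr_sqr ler_sqrt ?sqr_ge0//; apply: le_trans h1 _.
rewrite -(real_normK (num_real a)); move: `|a| (normr_ge0 a) => b b0.
have : 0 <= b * sqa f A x * sqa g A x by rewrite !mulr_ge0.
have := sqr_ge0 (b * sqa f A x); have := sqr_ge0 (sqa g A x).
rewrite !expr2; lra.
Qed.

(** * The extension to H^1 *)

Lemma H1_extension r s T : haar_shift D mu h r s T -> bounded_operator (L2 mu) T ->
  extends_boundedly mu (H1 D mu) T.
Proof.
move=> hT hTL2; have [A0 A00 [beta [hb TE]]] := shift_coefs hT hTL2.
have [C C0 hC] := h1_shift s r A00.
have hb' P S : cube P -> S \in nbr r s P -> `|beta S P| <= A0.
  by move=> cP SP; apply: hb; [exact: nbr_cube SP|exact: nbr_sym].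
have {hC}hC := hC beta hb'.
have memP f : fs_mem (H1 D mu) f -> [/\ mu.-integrable setT (EFin \o f), loc_int f & (H1_norm D mu f < +oo)%E].
  by move=> [/Lfun1_integrable fi fn]; split => //; exact: loc_int_integrable.
have nm0 f : (0 <= H1_norm D mu f)%E by exact: Lnorm_ge0.
have fnum f : fs_mem (H1 D mu) f -> H1_norm D mu f \is a fin_num.
  by move=> /memP[_ _]; rewrite ge0_fin_numE.
have bnd f : fs_mem (H1 D mu) f -> forall A, uniq A -> (forall P, P \in A -> cube P) ->
    \int[mu]_x sqa (shift beta s r (coef f)) A x <= C * fine (H1_norm D mu f).
  move=> fm; have [fi fL fn] := memP f fm => A uA cA; apply: le_trans (hC _ _ uA cA) _; apply: ler_wpM2l; first exact: ltW.
  rewrite -lee_fin [leRHS]fineK; last exact: fnum.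
  apply: H1_norm_ge => //; first exact: undup_uniq.
  by move=> P; rewrite mem_undup => /flattenP[_ /mapP[Q /cA cQ ->] /(nbr_cube cQ)].
(* The operator is obtained by choosing one function per f; outside H^1 the choice is arbitrary. All
   algebraic properties are then recovered up to null sets from [coef_inj]. *)
have ex f : exists F, fs_mem (H1 D mu) f ->
    mu.-integrable setT (EFin \o F) /\ forall P j, cube P -> coef F P j = shift beta s r (coef f) P j.
  have [fm|nf] := pselect (fs_mem (H1 D mu) f); last by exists f.
  by have [F hF] := hardy_synthesis (bnd f fm); exists F.
have [T' hT'] := choice ex.
have T'b f : fs_mem (H1 D mu) f -> (H1_norm D mu (T' f) <= C%:E * H1_norm D mu f)%E.
  move=> fm; have [Fi Fc] := hT' f fm; have [fi fL fn] := memP f fm.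
  have -> : (C%:E * H1_norm D mu f = (C * fine (H1_norm D mu f))%:E)%E.
    by rewrite EFinM fineK//; exact: fnum.
  apply: H1_norm_le; first exact: loc_int_integrable.
  move=> N; apply: le_trans (bnd f fm (cube_range 0 N) (cube_range_uniq _ _) (@cube_range_cube _ _)).
  rewrite le_eqVlt; apply/predU1P; left; congr fine; apply: eq_integral => x _; congr EFin.
  congr Num.sqrt; apply: eq_big_seq => P /cube_range_cube cP; congr (_ ^+ 2).
  by apply: eq_bigr => j _; rewrite Fc.
have T'm f : fs_mem (H1 D mu) f -> fs_mem (H1 D mu) (T' f).
  move=> fm; have [Fi Fc] := hT' f fm; have [fi fL fn] := memP f fm.
  split; first exact/Lfun1_integrable.
  apply: le_lt_trans (T'b f fm) _; rewrite lte_mul_pinfty ?lee_fin ?ltW//.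
exists T'; last first.
  move=> f f2 fm; have [Fi Fc] := hT' f fm.
  apply: coef_inj; [exact: loc_int_integrable| | exact: tame_L1| |].
  - by apply: L2_loc_int; case: hTL2 => + _ _ _; apply.
  - by apply: tame_L2; case: hTL2 => + _ _ _; apply.
  by move=> Q j cQ; rewrite Fc// TE.
split; first exact: T'm.
- move=> f g fm gm fg; have [Fi Fc] := hT' f fm; have [Gi Gc] := hT' g gm.
  apply: coef_inj; [exact: loc_int_integrable|exact: loc_int_integrable|exact: tame_L1|exact: tame_L1|].
  move=> Q j cQ; rewrite Fc// Gc//; apply: eq_shift => // P k cP.
  by apply: coef_ae => //; [have [] := memP f fm|have [] := memP g gm].
- move=> a f g fm gm; have [Fi Fc] := hT' f fm; have [Gi Gc] := hT' g gm.
  have [fi fL fn] := memP f fm; have [gi gL gn] := memP g gm.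
  have um : fs_mem (H1 D mu) (fun x => a * f x + g x).
    split; first by apply/Lfun1_integrable; exact: integrableD (integrableZl _ _ fi) gi.
    have uL : loc_int (fun x => a * f x + g x) by apply: loc_int_add => //; exact: loc_int_scale.
    apply: le_lt_trans (ltry (2 * `|a| * fine (H1_norm D mu f) + 2 * fine (H1_norm D mu g))).
    apply: H1_norm_le => // N.
    have I1 c := sqa_integrable c (@cube_range_cube 0 N).
    have I2 := integrableZl measurableT (2 * `|a|) (I1 (coef f)).
    have I3 := integrableZl measurableT 2 (I1 (coef g)).
    apply: (@le_trans _ _ (\int[mu]_x (2 * `|a| * sqa (coef f) (cube_range 0 N) x + 2 * sqa (coef g) (cube_range 0 N) x))).
      apply: le_Rintegral => //; first exact: (integrableD measurableT I2 I3).
      move=> x _; apply: sqa_add => P j /cube_range_cube cP.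
      by rewrite coefD// ?coefZ//; exact: loc_int_scale.
    rewrite RintegralD// !RintegralZl//; apply: lerD.
      apply: ler_wpM2l; first by rewrite mulr_ge0.
      rewrite -lee_fin [leRHS]fineK; last exact: fnum.
      by apply: H1_norm_ge; [|exact: cube_range_uniq|move=> P; exact: cube_range_cube].
    apply: ler_wpM2l => //; rewrite -lee_fin [leRHS]fineK; last exact: fnum.
    by apply: H1_norm_ge; [|exact: cube_range_uniq|move=> P; exact: cube_range_cube].
  have [Ui Uc] := hT' _ um.
  have Vi : mu.-integrable setT (EFin \o (fun x => a * T' f x + T' g x)).
    exact: integrableD (integrableZl _ _ Fi) Gi.
  apply: coef_inj; [exact: loc_int_integrable|exact: loc_int_integrable|exact: tame_L1|exact: tame_L1|].
  move=> Q j cQ; have LF := loc_int_integrable Fi; have LG := loc_int_integrable Gi.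
  rewrite Uc// coefD//; last exact: loc_int_scale.
  rewrite coefZ// Fc// Gc//; apply: shift_linear => // P k cP.
  by rewrite coefD// ?coefZ//; exact: loc_int_scale.
by exists C.
Qed.

(** * Functions of bounded mean oscillation *)

Lemma bmo_bound_norm B f : loc_int f -> (BMO_norm D mu f <= B%:E)%E -> bmo_bound B f.
Proof.
move=> fL fB Q cQ; set c := average mu f _; pose k := gen Q.
pose u x := `|f x - condexp D mu (k - 1) f x|.
have uE x : Q x -> u x = `|f x - c|.
  by move=> Qx; rewrite /u condexpE -(ancestorE 1 cQ Qx).
have cu x : Q x -> condexp D mu k u x = average mu u Q by move=> Qx; rewrite condexpE dcube_gen.
have h1 : (`|average mu u Q|%:E <= B%:E)%E.
  apply: le_trans fB; apply: le_trans (Lnorm_ge_at cQ cu) _.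
  by apply: ereal_sup_ubound; exists k.
rewrite -(int_eq uE) avg_mul//; apply: ler_wpM2r; first exact/ltW/w_gt0.
by apply: le_trans (ler_norm _) _; rewrite -lee_fin.
Qed.

Lemma bmo_norm_bound B f : 0 <= B -> bmo_bound B f -> (BMO_norm D mu f <= B%:E)%E.
Proof.
move=> B0 fB; apply: ge_ereal_sup => _ [k _ <-]; rewrite unlock; case: ifPn => _; last by rewrite lee_fin.
apply: ess_sup_ler => x /=; rewrite lee_fin condexpE.
have cQ := dcube_cube k x; set u := fun y => _.
have -> : average mu u (dcube k x) = (w (dcube k x))^-1 *
    \int[mu]_(y in dcube k x) `|f y - average mu f (ancestor D 1 (dcube k x))|.
  congr (_ * _); apply: int_eq => y Qy; rewrite /u condexpE; congr (`| _ - average _ _ _|).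
  by rewrite (ancestorE 1 cQ Qy) gen_dcube.
have w0 := w_gt0 cQ.
rewrite ger0_norm; last first.
  by apply: mulr_ge0; [rewrite invr_ge0; exact: ltW|apply: Rintegral_ge0].
by rewrite mulrC ler_pdivrMr//; exact: fB.
Qed.

Lemma BMO_norm_ge0 f : (0 <= BMO_norm D mu f)%E.
Proof.
pose u := condexp D mu 0 (fun x => `|f x - condexp D mu (0 - 1) f x|).
apply: (@le_trans _ _ (Lnorm mu +oo%E (EFin \o u))).
  exact: Lnorm_ge0.
by apply: ereal_sup_ubound; exists 0.
Qed.

Lemma zero_coef_bmo F : loc_int F -> (forall Q j, cube Q -> coef F Q j = 0) -> BMO_norm D mu F = 0%E.
Proof.
move=> FL F0; apply/eqP; rewrite eq_le BMO_norm_ge0 andbT.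
apply: bmo_norm_bound => // Q cQ; rewrite average_ancestor// mul0r.
have ae := zero_coef_const FL F0 cQ.
suff -> : \int[mu]_(x in Q) `|F x - average mu F Q| = \int[mu]_(x in Q) (0 : R).
  by rewrite int_cst// mul0r.
congr fine; apply: ae_eq_integral; first exact: cube_measurable.
- by apply/measurable_EFinP/measurable_funTS; case: (loc_int_osc (average mu F Q) FL).
- exact: measurable_cst.
by apply: filterS ae => x /= H Qx; rewrite H// subrr normr0.
Qed.

(** Vanishing seminorm means [bmo_bound] with every positive constant; the one taken here makes the
    sigma bound of the coefficient equal to e. *)
Lemma bmo_zero_coef F : loc_int F -> BMO_norm D mu F = 0%E -> forall Q j, cube Q -> coef F Q j = 0.
Proof.
move=> FL F0 Q j cQ; have [K K1 hK] := sigma_facts.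
have hK' P l : cube P -> \int[mu]_(x in P) `|h P l x| <= K * sigma P by move=> /hK[].
have s0 := sigma_gt0 cQ; have K0 : 0 < K by lra.
apply/eqP; rewrite -normr_le0; apply/ler_addgt0Pr => e e0; rewrite add0r.
have B0 : 0 < e / (K * sigma Q) by rewrite divr_gt0// mulr_gt0.
have FB : bmo_bound (e / (K * sigma Q)) F.
  by apply: bmo_bound_norm => //; rewrite F0 lee_fin ltW.
have := bmo_sigma_bounded B0 FL FB hK' j cQ.
by rewrite -mulrA divfK// gt_eqF// mulr_gt0.
Qed.

Lemma BMO_eq F G : loc_int F -> loc_int G -> (forall Q j, cube Q -> coef F Q j = coef G Q j) ->
  fs_eq (BMO D mu) F G.
Proof.
move=> FL GL E; apply: zero_coef_bmo; first exact: loc_int_sub.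
by move=> Q j cQ; rewrite coefB// E// subrr.
Qed.

Lemma closed_measurable_rV (K : set Rn) : closed K -> measurable K.
Proof.
move=> cK; rewrite -(setCK K); apply: measurableC; apply: sub_sigma_algebra.
exact: closed_openC.
Qed.

Lemma cube_compact Q : cube Q -> exists2 K : set Rn, compact K & Q `<=` K.
Proof.
move=> cQ; have := cornerE cQ; set a := corner Q; set l := 2 ^ _ => QE.
exists [set v : Rn | forall i, [set` `[a ord0 i, a ord0 i + l]] (v ord0 i)].
  apply: (@rV_compact R n (fun i => [set` `[a ord0 i, a ord0 i + l]])) => i.
  exact: segment_compact.
by rewrite QE => x /= hx i; have /andP[h1 /ltW h2] := hx i; rewrite /= in_itv/= h1.
Qed.

Lemma compact_coord (K : set Rn) : compact K -> exists M : R, forall x, K x -> forall i, `|x ord0 i| <= M.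
Proof.
move=> cK.
have H i : exists M : R, forall x, K x -> `|x ord0 i| <= M.
  have cc : compact ((fun x : Rn => x ord0 i) @` K).
    apply: continuous_compact cK; apply: continuous_subspaceT => x; exact: coord_continuous.
  have [M [_ hM]] := compact_bounded cc.
  by exists (M + 1) => x Kx; apply: hM; [rewrite ltrDl|exists x].
have [M hM] := choice H.
exists (\sum_i `|M i|) => x Kx i; apply: le_trans (hM i x Kx) _.
by apply: le_trans (ler_norm _) _; rewrite (bigD1 i)//= lerDl; exact: sumr_ge0.
Qed.

(** Each cube lies in a compact box, and a compact set meets only finitely many cubes of generation
    0. *)
Lemma loc_integrableP f : loc_integrable mu f <-> loc_int f.
Proof.
split=> [[mf fK]|fL].
  split => // Q cQ; have [K cK QK] := cube_compact cQ.
  apply: integrableS (fK K cK) => //; last exact: cube_measurable.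
  by apply: closed_measurable_rV; apply: compact_closed cK; exact: norm_hausdorff.
split; first by case: fL.
move=> K cK; have [M hM] := compact_coord cK.
have mK : measurable K.
  by apply: closed_measurable_rV; apply: compact_closed cK; exact: norm_hausdorff.
have fin := fin_meet 0 M; set X := [set Q | _] in fin.
have gL : loc_int (fun x => f x * \1_K x) by apply: loc_int_mul => //; exact: bdd_meas_indic.
have [||gi _] := @int_tops 0 (fset_set X) _ (fset_uniq _) _ gL.
- by move=> Q; rewrite in_fset_set// inE => -[].
- move=> x nX; rewrite indicE memNset ?mulr0// => Kx; apply: (nX (dcube 0 x)); last exact: dcube_mem.
  rewrite in_fset_set// inE; split; first exact: dcubeP.
  by exists x; [exact: dcube_mem|exact: hM].
have := integrableS measurableT mK (@subsetT _ _) gi; apply: eq_integrable => // x Kx /=.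
by rewrite indicE Kx mulr1.
Qed.

(** * Renormalized Haar series and synthesis in BMO *)

Definition quad x : set Rn := [set y | exists k, dcube k x = dcube k y].
(** One representative per dyadic quadrant: the choice depends on the set [quad x] alone, which is
    the same for all points of the quadrant. *)
Definition base x : Rn := xget 0 (quad x).

Lemma dcube_le k l x y : l <= k -> dcube k x = dcube k y -> dcube l x = dcube l y.
Proof.
move=> lk E; symmetry; apply: dcube_eq; first exact: dcubeP.
by apply: (@dcube_sub l k x lk); rewrite E; exact: dcube_mem.
Qed.

Lemma base_eq x y : quad x y -> base x = base y.
Proof.
move=> [k xy]; congr xget; apply/seteqP; split => z [l lz].
  exists (Order.min k l); rewrite -(dcube_le _ xy) ?ge_min ?lexx//.
  by apply: dcube_le lz; rewrite ge_min lexx orbT.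
exists (Order.min k l); rewrite (dcube_le _ xy) ?ge_min ?lexx//.
by apply: dcube_le lz; rewrite ge_min lexx orbT.
Qed.

Lemma base_quad x : exists k, dcube k x = dcube k (base x).
Proof.
suff : quad x (base x) by [].
by apply: xgetPex; exists x, 0.
Qed.

Lemma base_cube Q x : cube Q -> Q x -> base x = base (pt Q).
Proof.
by move=> cQ Qx; apply: base_eq; exists (gen Q); rewrite !dcube_gen//; exact: pt_mem.
Qed.

(** On such cubes the renormalization cancels exactly the Haar terms of the cubes not contained in
    Q; gen Q <= 0 ensures that every strictly larger cube is among the renormalized ones. *)
Definition based Q := gen Q <= 0 /\ Q (base (pt Q)).

Lemma based_ancestor Q : cube Q -> exists i, based (ancestor D i Q).
Proof.
move=> cQ; have [k hk] := base_quad (pt Q).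
exists (`|gen Q|%N + `|gen Q - k|%N)%N; set i := (_ + _)%N.
have cA := ancestor_cube i cQ; have gA := gen_ancestor i cQ.
split; first by rewrite gA /i; move: (gen Q) => g; clear; lia.
rewrite -(base_cube cA (sub_ancestor i cQ (pt_mem cQ))).
rewrite (ancestorE i cQ (pt_mem cQ)) (dcube_le _ hk); first exact: dcube_mem.
by rewrite /i; move: (gen Q) => g; clear; lia.
Qed.

Lemma hsum_const b Q S x y : cube Q -> cube S -> ~ S `<=` Q -> Q x -> Q y ->
  hsum b S x = hsum b S y.
Proof.
move=> cQ cS SQ Qx Qy.
have [[z [Sz Qz]]|dj] := pselect (S `&` Q !=set0); last first.
  by rewrite !hsum_out// => Sz; apply: dj; [exists y|exists x].
have gSQ : gen S < gen Q by rewrite ltNge; apply/negP => /(cube_nested cS cQ Sz Qz).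
have QS := cube_nested cQ cS Qz Sz (ltW gSQ).
apply: eq_bigr => j _; have [c hc] := haar_sub j cS cQ QS gSQ.
by rewrite !hc.
Qed.

(* Renormalized Haar term: on large cubes the partial sums of the raw Haar
   series need not converge in L^1, so the value at the base point of the
   quadrant is subtracted from the terms of the large scales. *)
Definition renorm_term b S x : R := hsum b S x - (if gen S < 0 then hsum b S (base x) else 0).

Definition restrict_coef Q (b : set Rn -> J -> R) S (j : J) : R := if `[< S `<=` Q >] then b S j else 0.

(** The constant by which, on Q, the renormalized term of S differs from its Haar term when only
    subcubes of Q are kept. *)
Definition renorm_cst b Q S : R := (if `[< S `<=` Q >] then 0 else hsum b S (pt Q)) -
  (if gen S < 0 then hsum b S (base (pt Q)) else 0).

Lemma hsum_restrict Q b S x : hsum (restrict_coef Q b) S x = if `[< S `<=` Q >] then hsum b S x else 0.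
Proof. by rewrite /hsum /restrict_coef; case: ifP => // _; rewrite big1// => j _; rewrite mul0r. Qed.

Lemma dot_restrict Q b S : dot (restrict_coef Q b) (restrict_coef Q b) S = if `[< S `<=` Q >] then dot b b S else 0.
Proof. by rewrite /dot /restrict_coef; case: ifP => // _; rewrite big1// => j _; rewrite mul0r. Qed.

Lemma renorm_term_split b Q S x : cube Q -> cube S -> Q x -> renorm_term b S x = hsum (restrict_coef Q b) S x + renorm_cst b Q S.
Proof.
move=> cQ cS Qx; rewrite /renorm_term hsum_restrict /renorm_cst (base_cube cQ Qx).
case: asboolP => SQ; first by ring.
by rewrite (hsum_const b cQ cS SQ Qx (pt_mem cQ)); ring.
Qed.

Lemma renorm_cst_eq0 b Q S : cube Q -> cube S -> based Q -> ~ (S `<=` Q /\ gen S < 0) -> renorm_cst b Q S = 0.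
Proof.
move=> cQ cS [gQ Qb] H; rewrite /renorm_cst; case: asboolP => SQ.
  by case: ifP => [g0|_]; [case: H|rewrite subrr].
case: ifP => g0; first by rewrite (hsum_const b cQ cS SQ (pt_mem cQ) Qb) subrr.
rewrite subr0 hsum_out// => Sp; apply: SQ.
apply: (cube_nested cS cQ Sp (pt_mem cQ)); apply: le_trans gQ _.
by rewrite leNgt g0.
Qed.

Lemma renorm_term_bdd_meas b S : cube S -> bdd_meas (renorm_term b S).
Proof.
move=> cS; pose U := \bigcup_N ancestor D N S.
have mU : measurable U.
  by apply: bigcup_measurable => N _; apply: cube_measurable; exact: ancestor_cube.
pose c := if gen S < 0 then hsum b S (base (pt S)) else 0.
have -> : renorm_term b S = fun x => hsum b S x + (- c) * \1_U x.
  apply/funext => x; rewrite /renorm_term mulNr; congr (_ - _); rewrite /c.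
  case: ifP => _; last by rewrite mul0r.
  rewrite indicE; case: (boolP (x \in U)) => [/set_mem[N _ Ax]|/negP xU].
    have cA := ancestor_cube N cS.
    by rewrite mulr1 (base_cube cA Ax) -(base_cube cA (sub_ancestor N cS (pt_mem cS))).
  rewrite mulr0 hsum_out// => Sb; apply: xU; apply/mem_set.
  have [k hk] := base_quad x; exists `|gen S - k|%N => //.
  rewrite (ancestorE _ cS Sb) -(dcube_le _ hk); first exact: dcube_mem.
  by move: (gen S) => g; clear; lia.
by apply: bdd_meas_add; [exact: hsum_bdd_meas|apply: bdd_meas_mul; [exact: bdd_meas_cst|exact: bdd_meas_indic]].
Qed.

Definition renorm_sum b N x : R := \sum_(S <- cube_range 0 N) renorm_term b S x.

Lemma renorm_sum_bdd_meas b N : bdd_meas (renorm_sum b N).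
Proof. by apply: bdd_meas_sum => S /cube_range_cube; exact: renorm_term_bdd_meas. Qed.

Lemma renorm_sum_on b N Q x : cube Q -> Q x ->
  renorm_sum b N x = Fsum (restrict_coef Q b) (cube_range 0 N) x + \sum_(S <- cube_range 0 N) renorm_cst b Q S.
Proof.
move=> cQ Qx; rewrite /renorm_sum /Fsum -big_split/=; apply: eq_big_seq => S /cube_range_cube cS.
exact: renorm_term_split.
Qed.

Lemma Fsum_sqr c A : uniq A -> (forall P, P \in A -> cube P) ->
  \int[mu]_x (Fsum c A x ^+ 2) = \sum_(P <- A) dot c c P.
Proof.
move=> uA cA; have := @int_hsum_mul c A (fun=> Fsum c A).
move=> H; transitivity (\int[mu]_x (\sum_(P <- A) Fsum c A x * hsum c P x)).
  by apply: eq_Rintegral => x _; rewrite expr2 {2}/Fsum mulr_sumr.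
rewrite H; last by move=> P PA; split; [exact: cA|exact: Fsum_bdd_meas].
apply: eq_big_seq => P PA; apply: eq_bigr => j _; congr (_ * _).
by rewrite coef_Fsum// ?PA//; exact: cA.
Qed.

(** Integrate t <= e + t^2 / (4 e) and use orthogonality; the free e allows optimization on Q
    without taking square roots. *)
Lemma Fsum_L1_le c A Q (e : R) : cube Q -> 0 < e -> uniq A -> (forall P, P \in A -> cube P) ->
  \int[mu]_(x in Q) `|Fsum c A x| <= e * w Q + (\sum_(P <- A) dot c c P) / (4 * e).
Proof.
move=> cQ e0 uA cA; have FBM := Fsum_bdd_meas c cA; have F2 := bdd_meas_mul FBM FBM.
have FI : mu.-integrable setT (EFin \o (fun x => Fsum c A x * Fsum c A x)).
  apply: (int_setT_cubes cA F2) => x nA; rewrite /Fsum big1_seq ?mul0r// => P /andP[_ PA].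
  by rewrite hsum_out//; [exact: cA|exact: nA].
have e4 : 0 < 4 * e by rewrite mulr_gt0.
apply: (@le_trans _ _ (\int[mu]_(x in Q) (e + (4 * e)^-1 * (Fsum c A x * Fsum c A x)))).
  apply: int_le => //; [exact/loc_int_norm/bdd_meas_loc_int|by apply: loc_int_add; [exact: loc_int_cst|exact/loc_int_scale/bdd_meas_loc_int]|].
  move=> x _; rewrite -(ler_pM2l e4) mulrDr mulrA mulfV ?gt_eqF// mul1r -expr2.
  rewrite -(real_normK (num_real (Fsum c A x))); move: `|_| => t.
  have := sqr_ge0 (t - 2 * e); rewrite !expr2; nra.
rewrite intD//; [|exact: loc_int_cst|exact/loc_int_scale/bdd_meas_loc_int].
rewrite int_cst// intZ//; last exact: bdd_meas_loc_int.
rewrite lerD2l mulrC; apply: ler_wpM2r; first by rewrite invr_ge0 ltW.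
rewrite -Fsum_sqr//; apply: (@le_trans _ _ (\int[mu]_x `|Fsum c A x * Fsum c A x|)).
  apply: le_trans (sub_setT_int cQ FI); apply: int_le => //; [exact: bdd_meas_loc_int|exact/loc_int_norm/bdd_meas_loc_int|].
  by move=> x _; exact: ler_norm.
rewrite le_eqVlt; apply/predU1P; left; apply: eq_Rintegral => x _.
by rewrite -expr2 ger0_norm ?sqr_ge0.
Qed.

Lemma restrict_carleson b M Q A : carleson M b -> cube Q -> uniq A -> (forall P, P \in A -> cube P) ->
  \sum_(P <- A) dot (restrict_coef Q b) (restrict_coef Q b) P <= M ^+ 2 * w Q.
Proof.
move=> cM cQ uA cA; pose m := (\max_(P <- A) `|gen P - gen Q|%N.+1)%N.
apply: le_trans (cM Q m cQ).
under eq_bigr do rewrite dot_restrict.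
rewrite -big_mkcond/= -big_filter; apply: sum_seq_le.
- exact: filter_uniq.
- exact: tree_uniq.
- move=> P; rewrite mem_filter => /andP[/asboolP PQ PA]; have cP := cA P PA.
  apply/(mem_tree _ _ cQ); split => //.
  have : (`|gen P - gen Q|%N.+1 <= m)%N by rewrite /m (big_rem P)//= leq_max leqnn.
  by move: m (gen P) (gen Q); clear; lia.
- by move=> P _; exact: dot_ge0.
Qed.

Lemma int_normE Q f : cube Q -> loc_int f ->
  (\int[mu]_(x in Q) `|f x|%:E = (\int[mu]_(x in Q) `|f x|)%:E)%E.
Proof.
move=> cQ fL; rewrite /Rintegral fineK//; apply: integrable_fin_num.
  exact: cube_measurable.
exact: (loc_int_norm fL).2.
Qed.

(** It suffices to treat a large ancestor on which the base point lies. There only finitely many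
    constants survive, and the remaining Haar sums over subcubes are Cauchy in L^2 by the Carleson
    condition. *)
Lemma renorm_sum_cauchy b M Q (e : R) : 0 < M -> carleson M b -> cube Q -> 0 < e ->
  exists N0, forall N N', (N0 <= N)%N -> (N0 <= N')%N ->
     \int[mu]_(x in Q) `|renorm_sum b N x - renorm_sum b N' x| <= e.
Proof.
move=> M0 cM cQ e0; have [i bA] := based_ancestor cQ; have cA := ancestor_cube i cQ.
have QA := @sub_ancestor i Q cQ; move: (ancestor D i Q) bA cA QA => A bA cA QA.
have L N N' : loc_int (fun x => renorm_sum b N x - renorm_sum b N' x) by apply: loc_int_sub; apply/bdd_meas_loc_int/renorm_sum_bdd_meas.
pose u N := \sum_(P <- cube_range 0 N) dot (restrict_coef A b) (restrict_coef A b) P.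
have uE m k : u (m + k)%N = u m + \sum_(P <- cube_range m k) dot (restrict_coef A b) (restrict_coef A b) P.
  by rewrite /u cube_range_cat big_cat.
have um : {homo u : m k / (m <= k)%N >-> m <= k}.
  by move=> m k mk; rewrite -(subnKC mk) uE lerDl sumr_ge0// => P _; exact: dot_ge0.
have uB N : u N <= M ^+ 2 * w A by apply: restrict_carleson => //; [exact: cube_range_uniq|move=> P; exact: cube_range_cube].
have wA := w_gt0 cA.
have [t t0 tE] : exists2 t, 0 < t & t * (2 * w A) = e.
  by exists (e / (2 * w A)); rewrite ?divr_gt0 ?divfK ?mulr_gt0// mulf_neq0 ?pnatr_eq0 ?gt_eqF.
have te : 0 < 2 * t * e by rewrite !mulr_gt0.
have [N1 hN1] := mono_cauchy um uB te.
(* The tree has depth |gen A| = - gen A, so it consists of the subcubes of A of negative generation,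
   the only ones with a nonzero constant. Beyond [N2] all of them have been enumerated. *)
pose N2 := (\max_(P <- tree `|gen A|%N A) (cidx P).+1)%N.
have main m k : (N1 <= m)%N -> (N2 <= m)%N -> (m <= k)%N ->
    \int[mu]_(x in A) `|renorm_sum b k x - renorm_sum b m x| <= e.
  move=> N1m N2m mk.
  have FE x : A x -> `|renorm_sum b k x - renorm_sum b m x| = `|Fsum (restrict_coef A b) (cube_range m (k - m)) x|.
    move=> Ax; rewrite !(renorm_sum_on _ _ cA Ax) -(subnKC mk) /Fsum cube_range_cat !big_cat/= (subnKC mk).
    rewrite [X in _ + (_ + X)]big1_seq => [|S /andP[_ SA]]; first by congr `|_|; ring.
    have [cS /andP[mS _]] := (proj1 (mem_cube_range _ _ _) SA); apply: renorm_cst_eq0 => // -[SsA gS].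
    have : S \in tree `|gen A|%N A.
      apply/(mem_tree _ _ cA); split => //; case: bA => + _; move: (gen A) (gen S) gS; clear; lia.
    move=> ST; have : ((cidx S).+1 <= N2)%N by rewrite /N2 (big_rem S)//= leq_max leqnn.
    by move=> lt; have := leq_trans lt (leq_trans N2m mS); rewrite ltnn.
  rewrite (int_eq FE).
  apply: le_trans (Fsum_L1_le _ cA t0 (cube_range_uniq _ _) (@cube_range_cube _ _)) _.
  have := hN1 m k N1m mk; rewrite -[in u k](subnKC mk) uE addrAC subrr add0r => h1.
  have h2 : (\sum_(P <- cube_range m (k - m)) dot (restrict_coef A b) (restrict_coef A b) P) / (4 * t) <= e / 2.
    by rewrite ler_pdivrMr ?mulr_gt0//; apply: le_trans h1 _; lra.
  have h3 : t * w A = e / 2 by rewrite -tE; field.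
  lra.
exists (maxn N1 N2) => N N'; rewrite !geq_max => /andP[a1 a2] /andP[b1 b2].
have mono k m : \int[mu]_(x in Q) `|renorm_sum b k x - renorm_sum b m x| <= \int[mu]_(x in A) `|renorm_sum b k x - renorm_sum b m x|.
  rewrite -lee_fin -!int_normE//; apply: ge0_subset_integral => //; [exact: cube_measurable..|].
  by apply/measurable_EFinP/measurable_funTS; case: (loc_int_norm (L k m)).
apply: le_trans (mono _ _) _; case: (leqP N' N) => [|/ltnW] NN; first exact: main.
by under eq_Rintegral do rewrite distrC; exact: main.
Qed.

Lemma hsum_int_sup b Q S : cube Q -> cube S -> gen Q <= gen S -> \int[mu]_(x in Q) hsum b S x = 0.
Proof.
move=> cQ cS QS; rewrite /hsum (int_sum (F := fun j x => b S j * h S j x))//; last first.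
  by move=> j _; apply: loc_int_scale; exact: loc_int_haar.
by rewrite big1// => j _; rewrite intZ ?int_haar_sup ?mulr0//; exact: loc_int_haar.
Qed.

(** On Q the sum is a mean-zero Haar sum over subcubes plus a constant, so that constant is the
    average. Taking e = M / 2 in [Fsum_L1_le] makes both terms equal to M w(Q) / 2. *)
Lemma renorm_sum_osc b M N Q : 0 < M -> carleson M b -> cube Q ->
  \int[mu]_(x in Q) `|renorm_sum b N x - average mu (renorm_sum b N) Q| <= M * w Q.
Proof.
move=> M0 cM cQ; have w0 := w_gt0 cQ.
set k := \sum_(S <- cube_range 0 N) renorm_cst b Q S; pose G := Fsum (restrict_coef Q b) (cube_range 0 N).
have GL : loc_int G by apply/bdd_meas_loc_int/Fsum_bdd_meas => P; exact: cube_range_cube.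
have E x : Q x -> renorm_sum b N x = G x + k by exact: renorm_sum_on.
have G0 : \int[mu]_(x in Q) G x = 0.
  rewrite /G /Fsum int_sum//; last by move=> S /cube_range_cube cS; exact/bdd_meas_loc_int/hsum_bdd_meas.
  rewrite big1_seq// => S /andP[_ /cube_range_cube cS].
  under eq_Rintegral do rewrite hsum_restrict.
  case: asboolP => SQ; first by apply: hsum_int_sup => //; exact: cube_sub_genE.
  by rewrite int_cst// mul0r.
have -> : average mu (renorm_sum b N) Q = k.
  rewrite /average (int_eq E) intD//; last exact: loc_int_cst.
  by rewrite G0 add0r int_cst// mulrC mulfK// gt_eqF.
have E' x : Q x -> `|renorm_sum b N x - k| = `|G x| by move=> Qx; rewrite E// addrK.
rewrite (int_eq E').
have M2 : 0 < M / 2 by rewrite divr_gt0.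
apply: le_trans (Fsum_L1_le _ cQ M2 (cube_range_uniq _ _) (@cube_range_cube _ _)) _.
have h1 := restrict_carleson cM cQ (cube_range_uniq 0 N) (@cube_range_cube 0 N).
have h2 : (\sum_(P <- cube_range 0 N) dot (restrict_coef Q b) (restrict_coef Q b) P) / (4 * (M / 2)) <= M / 2 * w Q.
  rewrite ler_pdivrMr ?mulr_gt0//; apply: le_trans h1 _.
  by rewrite le_eqVlt; apply/predU1P; left; field.
lra.
Qed.

(** The oscillation bound is stated for every Carleson constant M' of b: F is constructed once from
    some M, whereas norm estimates will need constants arbitrarily close to the norm of the given
    function. *)
Lemma bmo_synthesis b M : 0 < M -> carleson M b -> exists F, [/\ loc_int F,
  forall P j, cube P -> coef F P j = b P j &
  forall M' Q, 0 < M' -> carleson M' b -> cube Q ->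
    \int[mu]_(x in Q) `|F x - average mu F Q| <= M' * w Q].
Proof.
move=> M0 cM.
have mE i : measurable (cenum i).
  by case: (cenumP i) => [/cube_measurable//|->]; exact: measurable0.
have L N := bdd_meas_loc_int (renorm_sum_bdd_meas b N).
have [||||F [mF Fi Flim]] := @L1_complete _ _ mu cenum (renorm_sum b).
- exact: mE.
- by move=> N; case: (L N).
- move=> i N; case: (cenumP i) => [/(L N).2//|->]; exact: integrable_set0.
- move=> i e e0; case: (cenumP i) => [cQ|->]; last first.
    by exists 0%N => N N' _ _; rewrite integral_set0 lee_fin ltW.
  have [N0 hN0] := renorm_sum_cauchy M0 cM cQ e0; exists N0 => N N' a1 a2.
  by rewrite int_normE ?lee_fin//; [exact: hN0|exact: loc_int_sub].
have FL : loc_int F by split => // Q cQ; rewrite -(cenumE cQ).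
have lim Q : cube Q -> forall e, 0 < e -> exists N0, forall N, (N0 <= N)%N ->
    \int[mu]_(x in Q) `|renorm_sum b N x - F x| <= e.
  move=> cQ e e0; have [N0 hN0] := Flim (cidx Q) e e0; exists N0 => N /hN0.
  by rewrite cenumE// int_normE ?lee_fin//; exact: loc_int_sub.
exists F; split => //.
- move=> P j cP; apply: (coef_lim cP FL L (lim P cP)); exists (cidx P).+1 => N PN.
  rewrite /coef pairing_int//.
  set k := \sum_(S <- cube_range 0 N) renorm_cst b P S; pose G := Fsum (restrict_coef P b) (cube_range 0 N).
  have cA := @cube_range_cube 0 N.
  have GL : loc_int G by exact/bdd_meas_loc_int/Fsum_bdd_meas.
  transitivity (\int[mu]_(x in P) (G x * h P j x + k * h P j x)).
    by apply: int_eq => x Px; rewrite (renorm_sum_on _ _ cP Px) mulrDl.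
  rewrite intD//; [|exact/loc_int_mul/haar_bdd_meas|by apply: loc_int_scale; exact: loc_int_haar].
  rewrite intZ ?haar_mean0 ?mulr0 ?addr0//; last exact: loc_int_haar.
  rewrite -pairing_int// -/(coef G P j) coef_Fsum ?cube_range_uniq//.
  have -> : P \in cube_range 0 N by apply/mem_cube_range; rewrite add0n.
  by rewrite /restrict_coef; case: asboolP => // nPP; case: nPP.
move=> M' Q M'0 cM' cQ; apply/ler_addgt0Pr => e e0.
have e2 : 0 < e / 2 by rewrite divr_gt0.
have [N hN] := lim Q cQ _ e2; have {}hN := hN N (leqnn N).
have osc := renorm_sum_osc N M'0 cM' cQ; have w0 := w_gt0 cQ.
set c := average mu F Q; set d := average mu (renorm_sum b N) Q in osc *.
have DL := loc_int_sub (L N) FL.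
have dc : w Q * `|d - c| <= e / 2.
  apply: le_trans hN; rewrite -[X in X * _](gtr0_norm w0) -normrM mulrC mulrBl -!avg_mul// -intB//.
  exact: int_norm.
apply: (@le_trans _ _ (\int[mu]_(x in Q) (`|renorm_sum b N x - F x| + (`|renorm_sum b N x - d| + `|d - c|)))).
  apply: int_le => //; [exact: loc_int_osc| |].
    by apply: loc_int_add; [exact: loc_int_norm|apply: loc_int_add; [exact: loc_int_osc|exact: loc_int_cst]].
  move=> x _; have -> : F x - c = (F x - renorm_sum b N x) + ((renorm_sum b N x - d) + (d - c)) by ring.
  apply: le_trans (ler_normD _ _) _; rewrite distrC lerD2l; exact: ler_normD.
have OL := loc_int_osc d (L N).
rewrite intD//; [|exact: loc_int_norm|by apply: loc_int_add => //; exact: loc_int_cst].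
rewrite intD//; last exact: loc_int_cst.
rewrite int_cst// [X in _ + (_ + X)]mulrC.
lra.
Qed.

(** The jump of averages to the parent is a Haar term of the parent, hence the second constant. *)
Lemma osc_bmo_bound M M' F : loc_int F -> terms_bounded M' (coef F) ->
  (forall Q, cube Q -> \int[mu]_(x in Q) `|F x - average mu F Q| <= M * w Q) ->
  bmo_bound (M + M') F.
Proof.
move=> FL lF oF Q cQ; have cA := ancestor_cube 1 cQ.
set a := average mu F (ancestor D 1 Q); set c := average mu F Q.
have Qd : Q \in desc 1 (ancestor D 1 Q).
  by apply/(mem_desc _ _ cA)/(descendantsP _ _ cA); exact: desc_ancestor.
have ca : `|c - a| <= M' by rewrite -hsum_coef//; exact: lF.
have w0 := w_gt0 cQ; have OL := loc_int_osc c FL.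
apply: (@le_trans _ _ (\int[mu]_(x in Q) (`|F x - c| + `|c - a|))).
  apply: int_le => //; [exact: loc_int_osc|by apply: loc_int_add => //; exact: loc_int_cst|].
  by move=> x _; apply: le_trans (ler_normD _ _); rewrite addrA subrK.
rewrite intD//; last exact: loc_int_cst.
rewrite int_cst// mulrDl; apply: lerD; first exact: oF.
by rewrite ler_pM2r.
Qed.

Lemma carleson_le M M' b : 0 <= M -> M <= M' -> carleson M b -> carleson M' b.
Proof.
move=> M0 MM cM Q m cQ; apply: le_trans (cM Q m cQ) _; apply: ler_wpM2r; first exact/ltW/w_gt0.
by rewrite ler_pXn2r ?nnegrE//; exact: le_trans MM.
Qed.

Lemma sigma_bounded_le M M' b : M <= M' -> sigma_bounded M b -> sigma_bounded M' b.
Proof.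
move=> MM sM Q j cQ; apply: le_trans (sM Q j cQ) _; apply: ler_wpM2r => //.
exact/ltW/sigma_gt0.
Qed.

Lemma bmo_bound_add (a B B' : R) f g : loc_int f -> loc_int g -> bmo_bound B f -> bmo_bound B' g ->
  bmo_bound (`|a| * B + B') (fun x => a * f x + g x).
Proof.
move=> fL gL fB gB Q cQ; have cA := ancestor_cube 1 cQ.
have afL := loc_int_scale a fL.
have -> : average mu (fun x => a * f x + g x) (ancestor D 1 Q) =
    a * average mu f (ancestor D 1 Q) + average mu g (ancestor D 1 Q).
  by rewrite /average intD// intZ// mulrDr mulrCA.
set c := average mu f _; set d := average mu g _.
have O1 := loc_int_osc c fL; have O2 := loc_int_osc d gL.
have aO1 := loc_int_scale `|a| O1.
apply: (@le_trans _ _ (\int[mu]_(x in Q) (`|a| * `|f x - c| + `|g x - d|))).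
  apply: int_le => //; [by apply: loc_int_osc; exact: loc_int_add|exact: loc_int_add|].
  move=> x _; rewrite -normrM; apply: le_trans (ler_normD _ _).
  by rewrite le_eqVlt; apply/predU1P; left; congr `|_|; ring.
rewrite intD// intZ// mulrDl; apply: lerD; last exact: gB.
by rewrite -mulrA; apply: ler_wpM2l => //; exact: fB.
Qed.

(** * The extension to BMO *)

Lemma BMO_extension r s T : haar_shift D mu h r s T -> bounded_operator (L2 mu) T ->
  extends_boundedly mu (BMO D mu) T.
Proof.
move=> hT hTL2; have [A0 A00 [beta [hb TE]]] := shift_coefs hT hTL2.
have [L L0 hL] := shift_bound s r A00; have {hL}hL := hL beta hb.
have [K K1 hK] := sigma_facts; have K0 : 0 < K by lra.
have hK1 Q j x : cube Q -> `|h Q j x| * sigma Q <= K by move=> /hK[].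
have hK2 Q j : cube Q -> \int[mu]_(x in Q) `|h Q j x| <= K * sigma Q by move=> /hK[].
pose bc f := shift beta s r (coef f).
(* [shift_bound] wants a single constant for both conditions: 8 K B dominates the sigma bound B K
   and, as K >= 1, the Carleson constant 8 B of [john_nirenberg]. *)
have bcP f B : 0 < B -> loc_int f -> bmo_bound B f ->
    sigma_bounded (L * (8 * K * B)) (bc f) /\ carleson (L * (8 * K * B)) (bc f).
  move=> B0 fL fB; apply: hL; first by rewrite !mulr_ge0// ltW.
    apply: sigma_bounded_le (bmo_sigma_bounded B0 fL fB hK2).
    by rewrite mulrC -mulrA ler_peMl ?mulr_ge0 ?(ltW K0) ?(ltW B0)// ler1n.
  apply: carleson_le (john_nirenberg B0 fL fB); first by rewrite mulr_ge0// ltW.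
  by rewrite -mulrA ler_pM2l// ler_peMl// ltW.
have ex f : exists F, loc_int f /\ (exists B, bmo_bound B f) -> [/\ loc_int F,
  forall P j, cube P -> coef F P j = bc f P j &
  forall M Q, 0 < M -> carleson M (bc f) -> cube Q ->
    \int[mu]_(x in Q) `|F x - average mu F Q| <= M * w Q].
  have [[fL [B fB]]|nf] := pselect (loc_int f /\ (exists B, bmo_bound B f)); last by exists f.
  have B0 : 0 < `|B| + 1 by rewrite ltr_wpDl.
  have fB' : bmo_bound (`|B| + 1) f.
    move=> Q cQ; apply: le_trans (fB Q cQ) _; apply: ler_wpM2r; first exact/ltW/w_gt0.
    by apply: le_trans (ler_norm _) _; rewrite lerDl.
  have [_ cM] := bcP f _ B0 fL fB'.
  have [|F hF] := bmo_synthesis _ cM; last by exists F.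
  by rewrite !mulr_gt0.
have [T' hT'] := choice ex.
have memP f : fs_mem (BMO D mu) f -> loc_int f /\ (exists B, bmo_bound B f).
  move=> [/loc_integrableP fL fn]; split => //; exists (fine (BMO_norm D mu f)).
  by apply: bmo_bound_norm => //; rewrite fineK// ge0_fin_numE// BMO_norm_ge0.
pose C := L * (8 * K) + (2 ^ n).-1%:R * (L * (8 * K) * K).
have C0 : 0 <= C by rewrite addr_ge0 ?mulr_ge0 ?ler0n// ltW.
have T'B f B : 0 < B -> loc_int f -> bmo_bound B f -> (BMO_norm D mu (T' f) <= (C * B)%:E)%E.
  move=> B0 fL fB; have [FL Fc Fo] := hT' f (conj fL (ex_intro _ B fB)).
  have [sb cb] := bcP f B B0 fL fB.
  have M0 : 0 < L * (8 * K * B) by rewrite !mulr_gt0.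
  apply: bmo_norm_bound; first by rewrite mulr_ge0// ltW.
  have -> : C * B = L * (8 * K * B) + (2 ^ n).-1%:R * (L * (8 * K * B) * K) by rewrite /C; ring.
  apply: osc_bmo_bound => //; last by move=> Q cQ; exact: Fo.
  have lb := sigma_bounded_terms (ltW M0) (ltW K0) hK1 sb.
  move=> Q x cQ; have -> : hsum (coef (T' f)) Q x = hsum (bc f) Q x.
    by apply: eq_bigr => j _; rewrite Fc.
  exact: lb.
have T'n f : fs_mem (BMO D mu) f -> (BMO_norm D mu (T' f) <= C%:E * BMO_norm D mu f)%E.
  move=> fm; have [fL _] := memP f fm; case: fm => _ fn.
  have fin : BMO_norm D mu f \is a fin_num by rewrite ge0_fin_numE// BMO_norm_ge0.
  have v0 := BMO_norm_ge0 f; rewrite -(fineK fin) -EFinM.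
  (* The norm of f may be zero while [T'B] needs B > 0, so B is taken slightly above the norm, and e
     / (C + 1) keeps the excess below e. *)
  apply/lee_addgt0Pr => e e0; rewrite -EFinD.
  have e1 : 0 < e / (C + 1) by rewrite divr_gt0// ltr_wpDl.
  have f0 : 0 <= fine (BMO_norm D mu f) by exact: fine_ge0.
  apply: le_trans (T'B f (fine (BMO_norm D mu f) + e / (C + 1)) _ fL _) _.
  - by rewrite ltr_wpDl.
  - by apply: bmo_bound_norm => //; rewrite EFinD fineK// leeDl// lee_fin ltW.
  rewrite lee_fin mulrDr lerD2l mulrA ler_pdivrMr ?ltr_wpDl// mulrC.
  by apply: ler_wpM2l; [exact: ltW|rewrite lerDl].
have T'm f : fs_mem (BMO D mu) f -> fs_mem (BMO D mu) (T' f).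
  move=> fm; have [FL _ _] := hT' f (memP f fm); split; first exact/loc_integrableP.
  apply: le_lt_trans (T'n f fm) _; case: fm => _ fn.
  by rewrite lte_mul_pinfty ?lee_fin.
exists T'; last first.
  move=> f f2 fm; have [FL Fc _] := hT' f (memP f fm).
  apply: BMO_eq => //; first by apply: L2_loc_int; case: hTL2 => + _ _ _; apply.
  by move=> Q j cQ; rewrite Fc// /bc TE.
split; first exact: T'm.
- move=> f g fm gm fg; have [fL _] := memP f fm; have [gL _] := memP g gm.
  have [FL Fc _] := hT' f (memP f fm); have [GL Gc _] := hT' g (memP g gm).
  apply: BMO_eq => // Q j cQ; rewrite Fc// Gc//; apply: eq_shift => // P k cP.
  have := bmo_zero_coef (loc_int_sub fL gL) fg k cP.
  by rewrite coefB// => /eqP; rewrite subr_eq0 => /eqP.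
- move=> a f g fm gm; have [fL [B fB]] := memP f fm; have [gL [B' gB]] := memP g gm.
  have [FL Fc _] := hT' f (memP f fm); have [GL Gc _] := hT' g (memP g gm).
  have afL := loc_int_scale a fL; have uL := loc_int_add afL gL.
  have uB : exists B0, bmo_bound B0 (fun x => a * f x + g x).
    by exists (`|a| * B + B'); exact: bmo_bound_add.
  have [UL Uc _] := hT' (fun x => a * f x + g x) (conj uL uB).
  have aFL := loc_int_scale a FL.
  apply: BMO_eq => //; first exact: loc_int_add.
  move=> Q j cQ; rewrite Uc// coefD// coefZ// Fc// Gc//.
  by apply: shift_linear => // P k cP; rewrite coefD// coefZ.
by exists C.
Qed.

End haar_shifts.

Theorem theorem1 (R : realType) (n : nat) (hn : (0 < n)%N)
    (D : int -> set (set 'rV[R]_n)) (hD : dyadic_system D)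
    (mu : {measure set 'rV[R]_n -> \bar R}) (hmu : dyadic_measure D mu)
    (h : set 'rV[R]_n -> 'I_(2 ^ n).-1 -> 'rV[R]_n -> R)
    (hh : haar_system D mu h) (hbal : balanced D mu h)
    (r s : nat) (T : ('rV[R]_n -> R) -> ('rV[R]_n -> R))
    (hT : haar_shift D mu h r s T) (hTL2 : bounded_operator (L2 mu) T) :
  extends_boundedly mu (H1 D mu) T /\ extends_boundedly mu (BMO D mu) T.

Proof.
split; first exact: (H1_extension hn hD hmu hh hbal hT hTL2).
exact: (BMO_extension hn hD hmu hh hbal hT hTL2).
Qed.
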